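(* Let $(M,F,\Phi)$ be a regular integrable system of type $(k,n)$ with compact orbits, with $M$ connected, and suppose that $\rho$ is non-trivial, i.e. $l>0$, with $\rho=(\rho_1,\dots,\rho_l)$. Then $\ker\rho_1$ gives rise to an $(n-1)$-toric foliation $\mathfrak{F}^{(1)}$ of $M$ refining the foliation $\mathfrak{F}$ of $M$ by the orbits of $\Phi$. More precisely, for any $b\in\mathcal{O}_M$ there exists a neighbourhood $U$ of $b$ with a local trivialization $\bar\psi:U\times S^1\times\mathbb{T}^{n-1}\to q_\Phi^{-1}(U)$ such that for any $(u,z)\in U\times S^1$ the set $\bar\psi\big(\{(u,z)\}\times\mathbb{T}^{n-1}\big)$ is a leaf of $\mathfrak{F}^{(1)}$.
   Context: A regular (non-Hamiltonian) integrable system of type $(k,n)$ with compact orbits is a triple $(M,F,\Phi)$, where $M$ is a smooth manifold of dimension $k+n$, $F=(f_1,\dots,f_k):M\to\mathbb{R}^k$ is a smooth submersion, and $\Phi$ is a smooth locally free action of $\mathbb{R}^n$ on $M$ (all isotropy groups are discrete), all of whose orbits are compact, with $F\circ\Phi^{T}=F$ for all $T\in\mathbb{R}^n$. Thus every orbit is an $n$-torus. Orbit space: $\mathcal{O}_M$ is the set of orbits of $\Phi$ with quotient map $q_\Phi:M\to\mathcal{O}_M$; $F$ factors as $F=\bar F\circ q_\Phi$, and $\mathcal{O}_M$ carries the unique smooth structure for which $q_\Phi$ is a submersion and $\bar F$ is a local diffeomorphism. A local trivialization over $U$ is a diffeomorphism onto $q_\Phi^{-1}(U)$ covering the identity of $U$.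 Lattice bundle: for $o\in\mathcal{O}_M$, $\mathcal{L}_o\subset\mathbb{R}^n$ is the common isotropy group of $\Phi$ at the points of $o$ (a lattice of rank $n$), and $\mathcal{L}=\bigsqcup_{o}\mathcal{L}_o\subset\mathcal{O}_M\times\mathbb{R}^n$. The map $\rho$: for $T\in\mathcal{L}_o$ and $x\in q_\Phi^{-1}(o)$ let $\lambda_{T,x}(s)=\Phi^{sT}(x)$, $s\in[0,1]$, a closed path. With $\mathrm{Tor}_{H_1(M)}$ the torsion subgroup of the integral homology $H_1(M)$, define $\rho:\mathcal{L}\to H_1(M)/\mathrm{Tor}_{H_1(M)}$ by $\rho(T)=[\lambda_{T,x}]$ (independent of $x$). The image of $\rho$ equals $\rho(\mathcal{L}_o)$ for every $o$ and is a free Abelian group of rank $l\le n$; choosing an isomorphism of it with $\mathbb{Z}^l$, write $\rho=(\rho_1,\dots,\rho_l):\mathcal{L}\to\mathbb{Z}^l$. $\ker\rho_1$ is the set of $w\in\mathcal{L}$ with $\rho_1(w)=0$. The foliation: $\mathfrak{F}^{(1)}$ is the partition of $M$ into the sets $\Phi^{V_o}(p)$, $p\in M$, $o=q_\Phi(p)$, where $V_o\subset\mathbb{R}^n$ is the $(n-1)$-dimensional linear span of $\ker\rho_1|_{\mathcal{L}_o}$. An $(n-1)$-toric foliation is a foliation whose leaves are $(n-1)$-tori; it refines $\mathfrak{F}$ if each of its leaves is contained in a leaf of $\mathfrak{F}$. *)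

(* Defs.v *)
(* MathComp-Analysis development: R^m is the space 'rV[R]_m of row vectors. *)
From HB Require Import structures.
From mathcomp Require Import all_boot all_order all_algebra generic_quotient.
From mathcomp Require Import ring_quotient.
From mathcomp Require Import all_classical all_reals all_analysis.
From mathcomp Require Import freeg.

Set Implicit Arguments.
Unset Strict Implicit.
Unset Printing Implicit Defensive.

Import Order.TTheory GRing.Theory Num.Theory.
Import numFieldNormedType.Exports.

Local Open Scope classical_set_scope.
Local Open Scope ring_scope.
Local Open Scope quotient_scope.

Section Euclidean.
Context {R : realType}.

Fixpoint Ck (r : nat) (m p : nat) (W : set 'rV[R]_m)
    (f : 'rV[R]_m -> 'rV[R]_p) : Prop :=
  (forall x, W x -> {for x, continuous f}) /\
  if r is r'.+1 then
    forall i : 'I_m, (forall x, W x -> derivable f x (delta_mx 0 i)) /\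
                     Ck r' W ('D_(delta_mx 0 i) f)
  else True.

Definition Cinfty (m p : nat) (W : set 'rV[R]_m)
  (f : 'rV[R]_m -> 'rV[R]_p) : Prop := forall r, Ck r W f.

End Euclidean.

(* The values of [chart_map] outside [dom] and of [chart_inv] outside [img] are
   irrelevant. *)
Record chart (R : realType) (m : nat) (M : topologicalType) := Chart {
  dom : set M;
  img : set 'rV[R]_m;
  chart_map : M -> 'rV[R]_m;
  chart_inv : 'rV[R]_m -> M }.

Section Charts.
Context {R : realType} {m : nat} {M : topologicalType}.
Implicit Types (c d : chart R m M) (A : set (chart R m M)).

(* [chart_map c] is a homeomorphism from the open set [dom c] onto the open set
   [img c], with inverse [chart_inv c]. *)
Record is_chart c : Prop := {
  dom_open : open (dom c);
  img_open : open (img c);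
  chart_map_img : forall x, dom c x -> img c (chart_map c x);
  chart_inv_dom : forall v, img c v -> dom c (chart_inv c v);
  chart_mapK : forall x, dom c x -> chart_inv c (chart_map c x) = x;
  chart_invK : forall v, img c v -> chart_map c (chart_inv c v) = v;
  chart_map_continuous : forall x, dom c x -> {for x, continuous (chart_map c)};
  chart_inv_continuous :
    forall v, img c v -> {for v, continuous (chart_inv c)} }.

Definition transition_smooth c d : Prop :=
  Cinfty (img c `&` chart_inv c @^-1` dom d) (chart_map d \o chart_inv c).

Definition maximal_atlas A : set (chart R m M) :=
  [set c | is_chart c /\
    forall d, A d -> transition_smooth c d /\ transition_smooth d c].

End Charts.

Record manifold (R : realType) (m : nat) (M : topologicalType) := Manifold {
  atlas :> set (chart R m M);
  atlas_chart : forall c, atlas c -> is_chart c;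
  atlas_cover : forall x : M, exists2 c, atlas c & dom c x;
  atlas_compatible : forall c d, atlas c -> atlas d -> transition_smooth c d;
  manifold_hausdorff : hausdorff_space M;
  manifold_second_countable : @second_countable M }.

Definition euclidean_atlas (R : realType) (m : nat) :
    set (chart R m 'rV[R]_m) :=
  [set Chart setT setT id id].

Definition prod_chart (R : realType) (m p : nat) (M N : topologicalType)
    (c : chart R m M) (d : chart R p N) : chart R (m + p) (M * N)%type :=
  {| dom := dom c `*` dom d;
     img := [set v | img c (lsubmx v) /\ img d (rsubmx v)];
     chart_map := fun x => row_mx (chart_map c x.1) (chart_map d x.2);
     chart_inv := fun v => (chart_inv c (lsubmx v), chart_inv d (rsubmx v)) |}.

Definition prod_atlas (R : realType) (m p : nat) (M N : topologicalType)
    (A : set (chart R m M)) (B : set (chart R p N)) :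
    set (chart R (m + p) (M * N)%type) :=
  [set prod_chart c d | c in A & d in B].

Section SmoothMaps.
Context {R : realType} {m p : nat} {M N : topologicalType}.
Variables (A : set (chart R m M)) (B : set (chart R p N)).
Implicit Type f : M -> N.

Definition in_charts (c : chart R m M) (d : chart R p N) f :
    'rV[R]_m -> 'rV[R]_p := chart_map d \o f \o chart_inv c.

(* Only the germ of [f] at [x] matters, so this also applies to maps that are
   meaningful on an open subset of [M] only. *)
Definition smooth_at f (x : M) : Prop :=
  {for x, continuous f} /\
  exists c d, [/\ A c, B d, dom c x, dom d (f x) &
    exists W, [/\ open W, W (chart_map c x) & Cinfty W (in_charts c d f)]].

Definition smooth_on (U : set M) f : Prop := forall x, U x -> smooth_at f x.

Definition submersion f : Prop :=
  smooth_on setT f /\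
  forall x, exists c d, [/\ A c, B d, dom c x, dom d (f x) &
    range ('d (in_charts c d f) (chart_map c x)) = setT].

Definition immersion f : Prop :=
  smooth_on setT f /\
  forall x, exists c d, [/\ A c, B d, dom c x, dom d (f x) &
    injective ('d (in_charts c d f) (chart_map c x))].

End SmoothMaps.

Definition diffeomorphism (R : realType) (m p : nat) (M N : topologicalType)
    (A : set (chart R m M)) (B : set (chart R p N))
    (U : set M) (V : set N) (f : M -> N) : Prop :=
  [/\ open U, open V, set_bij U V f, smooth_on A B U f &
    exists g : N -> M, {in U, cancel f g} /\ smooth_on B A V g].

Section Torus.
Context {R : realType} {m : nat}.

Definition eq_mod_Z (x y : 'rV[R]_m) : bool :=
  [forall j, x 0 j - y 0 j \is a Num.int].

Lemma eq_mod_Z_equiv : equiv_class_of eq_mod_Z.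
Proof.
split=> [x|x y|y x z].
- by apply/forallP => j; rewrite subrr rpred0.
- by apply: eq_forallb => j; rewrite -rpredN opprB.
- move=> /forallP xy /forallP yz; apply/forallP => j.
  by rewrite -(subrKA (y 0 j)) rpredD.
Qed.

Canonical eq_mod_Z_equivRel := EquivRelPack eq_mod_Z_equiv.

End Torus.

Definition torus (R : realType) (m : nat) : Type :=
  quotient_topology {eq_quot (@eq_mod_Z R m)}.

HB.instance Definition _ (R : realType) (m : nat) :=
  Topological.copy (torus R m) (quotient_topology {eq_quot (@eq_mod_Z R m)}).

Definition torus_proj (R : realType) (m : nat) : 'rV[R]_m -> torus R m :=
  \pi_(quotient_topology {eq_quot (@eq_mod_Z R m)}).

(* The charts are the local inverses of the covering R^m -> R^m / Z^m. *)
Definition torus_atlas (R : realType) (m : nat) :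
    set (chart R m (torus R m)) :=
  [set c | is_chart c /\
    forall v, img c v -> chart_inv c v = torus_proj v].

Definition std_simplex (R : realType) (q : nat) : set 'rV[R]_q.+1 :=
  [set t | (forall i, 0 <= t 0 i) /\ \sum_i t 0 i = 1].
Arguments std_simplex : clear implicits.

Section Simplices.
Context {R : realType}.

Definition face_row (q : nat) (i : 'I_q.+2) (t : 'rV[R]_q.+1) : 'rV[R]_q.+2 :=
  \row_j (if unlift i j is Some l then t 0 l else 0).

Lemma face_row_in (q : nat) (i : 'I_q.+2) (t : std_simplex R q) :
  face_row i (set_val t) \in std_simplex R q.+1.
Proof.
rewrite inE; have [t0 t1] := set_valP t; split=> [j|].
  by rewrite mxE; case: unliftP => // l _; exact: t0.
rewrite (bigD1_ord i) //= mxE unlift_none add0r -t1.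
by apply: eq_bigr => l _; rewrite mxE liftK.
Qed.

Definition face (q : nat) (i : 'I_q.+2) (t : std_simplex R q) :
  std_simplex R q.+1 :=
  exist (fun v => v \in std_simplex R q.+1) _ (face_row_in i t).

Lemma face_continuous (q : nat) (i : 'I_q.+2) : continuous (@face q i).
Proof.
apply: continuous_comp_initial => t U [P nP PU].
have /= cval := @initial_continuous _ _ (@set_val _ (std_simplex R q)) t.
have nV : nbhs (set_val t) (face_row i @^-1` U).
  exists (fun=> fun l => P 0 (fintype.lift i l)) => [a l|v Pv].
    by have := nP 0 (fintype.lift i l); rewrite !mxE liftK (ord1 a).
  apply: PU => a j; rewrite (ord1 a) !mxE.
  have := nP 0 j; rewrite mxE; case: unliftP => [l ->|_] //.
  exact: nbhs_singleton.
exact: cval nV.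
Qed.

HB.instance Definition _ (q : nat) (i : 'I_q.+2) :=
  isContinuous.Build _ _ (@face q i) (@face_continuous q i).

End Simplices.

Section Homology.
Context (R : realType) (M : topologicalType).

Definition singular_simplex (q : nat) : choiceType :=
  continuousType (std_simplex R q) M.

Definition chain (q : nat) : lmodType int := {freeg (singular_simplex q) / int}.

Definition singular_face (q : nat) (s : singular_simplex q.+1) (i : 'I_q.+2) :
  singular_simplex q := (s : continuousType _ _) \o @face R q i.

Definition boundary (q : nat) : chain q.+1 -> chain q :=
  fglift (fun s => \sum_(i < q.+2) (-1) ^+ i *: << singular_face s i >>).

Lemma boundary_is_additive (q : nat) : additive (@boundary q).
Proof. exact: lift_is_additive. Qed.

HB.instance Definition _ (q : nat) :=
  GRing.isAdditive.Build (chain q.+1) (chain q) (@boundary q)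
    (@boundary_is_additive q).

Definition is_cycle (q : nat) : {pred chain q.+1} :=
  fun c => boundary c == 0.

Lemma is_cycle_zmod_closed (q : nat) : zmod_closed (@is_cycle q).
Proof.
split=> [|c d]; rewrite !unfold_in ?raddf0 // => /eqP c0 /eqP d0.
by rewrite raddfB/= c0 d0 subrr.
Qed.

HB.instance Definition _ (q : nat) :=
  GRing.isZmodClosed.Build (chain q.+1) (@is_cycle q)
    (@is_cycle_zmod_closed q).

Definition cycle (q : nat) : Type := {c : chain q.+1 | c \in @is_cycle q}.

HB.instance Definition _ (q : nat) := SubChoice.on (cycle q).
HB.instance Definition _ (q : nat) :=
  [SubChoice_isSubZmodule of cycle q by <:].

Definition is_boundary (q : nat) : {pred cycle q} :=
  fun c => `[< exists d : chain q.+2, val c = boundary d >].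

Lemma is_boundary_zmod_closed (q : nat) : zmod_closed (@is_boundary q).
Proof.
split=> [|c d]; rewrite !unfold_in.
  by apply/asboolP; exists 0; rewrite !raddf0.
move=> /asboolP[c' cE] /asboolP[d' dE]; apply/asboolP; exists (c' - d').
by rewrite !raddfB/= cE dE.
Qed.

HB.instance Definition _ (q : nat) :=
  GRing.isZmodClosed.Build (cycle q) (@is_boundary q)
    (@is_boundary_zmod_closed q).

(* [homology q] is the integral singular homology group H_{q+1}(M). *)
Definition homology (q : nat) : zmodType := Quotient.quot (@is_boundary q).

Definition is_torsion (q : nat) : {pred homology q} :=
  fun a => `[< exists2 j : nat, (0 < j)%N & a *+ j = 0 >].

Lemma is_torsion_zmod_closed (q : nat) : zmod_closed (@is_torsion q).
Proof.
split=> [|a b]; rewrite !unfold_in.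
  by apply/asboolP; exists 1%N.
move=> /asboolP[i i0 ai] /asboolP[j j0 bj]; apply/asboolP.
exists (i * j)%N; first by rewrite muln_gt0 i0.
by rewrite mulrnBl mulrnA ai mul0rn mulnC mulrnA bj mul0rn subrr.
Qed.

HB.instance Definition _ (q : nat) :=
  GRing.isZmodClosed.Build (homology q) (@is_torsion q)
    (@is_torsion_zmod_closed q).

Definition H1_mod_torsion : zmodType := Quotient.quot (@is_torsion 0).

Definition homology_class (c : cycle 0) : H1_mod_torsion :=
  \pi_(Quotient.quot (@is_torsion 0)) (\pi_(Quotient.quot (@is_boundary 0)) c).

End Homology.

Definition isotropy (R : realType) (n : nat) (M : Type)
    (act : 'rV[R]_n -> M -> M) (x : M) : set 'rV[R]_n :=
  [set T | act T x = x].

Definition orbit_of (R : realType) (n : nat) (M : Type)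
    (act : 'rV[R]_n -> M -> M) (x : M) : set M :=
  [set act T x | T in setT].

Record regular_system (R : realType) (k n : nat) (M : topologicalType)
    (X : manifold R (k + n) M) := RegularSystem {
  momentum : M -> 'rV[R]_k;
  act : 'rV[R]_n -> M -> M;
  momentum_submersion : submersion X (@euclidean_atlas R k) momentum;
  act_smooth :
    smooth_on (prod_atlas (@euclidean_atlas R n) X) X setT
      (fun w : 'rV[R]_n * M => act w.1 w.2);
  act0 : forall x, act 0 x = x;
  actD : forall S T x, act (S + T) x = act S (act T x);
  act_locally_free :
    forall x, isotropy act x `<=` isolated (isotropy act x);
  orbit_compact : forall x, compact (orbit_of act x);
  momentum_act : forall T x, momentum (act T x) = momentum x }.

Section System.
Context {R : realType} {k n : nat} {M : topologicalType}.
Context {X : manifold R (k + n) M}.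
Variable S : regular_system X.

Definition same_orbit (x y : M) : bool := `[< orbit_of (act S) x y >].

Lemma same_orbit_equiv : equiv_class_of same_orbit.
Proof.
have sym x y : same_orbit x y -> same_orbit y x.
  move=> /asboolP[T _ <-]; apply/asboolP; exists (- T) => //.
  by rewrite -actD addNr act0.
split=> [x|x y|y x z].
- by apply/asboolP; exists 0; rewrite ?act0.
- by apply/idP/idP; exact: sym.
- move=> /asboolP[T _ <-] /asboolP[T' _ <-]; apply/asboolP.
  by exists (T' + T); rewrite ?actD.
Qed.

Canonical same_orbit_equivRel := EquivRelPack same_orbit_equiv.

Definition orbit_space : topologicalType :=
  quotient_topology {eq_quot same_orbit}.

Definition orbit_proj (x : M) : orbit_space :=
  \pi_(quotient_topology {eq_quot same_orbit}) x.

Definition orbit_repr (o : orbit_space) : M :=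
  repr (o : quotient_topology {eq_quot same_orbit}).

Lemma orbit_reprK (o : orbit_space) : orbit_proj (orbit_repr o) = o.
Proof. exact: reprK. Qed.

(* [momentum S] is constant on orbits, so this is its factorization through
   [orbit_proj]. *)
Definition momentum_bar (o : orbit_space) : 'rV[R]_k :=
  momentum S (orbit_repr o).

(* The smooth structure on the orbit space making [momentum_bar] a local
   diffeomorphism: its charts are the local restrictions of [momentum_bar]. *)
Definition orbit_atlas : set (chart R k orbit_space) :=
  [set c | is_chart c /\
    forall o, dom c o -> chart_map c o = momentum_bar o].

Definition lattice (o : orbit_space) : set 'rV[R]_n :=
  [set T | forall x, orbit_proj x = o -> isotropy (act S) x T].

Definition lattice_bundle : set (orbit_space * 'rV[R]_n) :=
  [set w | lattice w.1 w.2].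

Lemma act_path_continuous (T : 'rV[R]_n) (x : M) :
  continuous (fun t : std_simplex R 1 => act S (set_val t 0 1 *: T) x).
Proof.
move=> t.
have c1 : {for t, continuous (fun t : std_simplex R 1 => set_val t 0 1 : R)}.
  apply: (@continuous_comp _ _ _ _ (fun v : 'rV[R]_2 => v 0 1)).
    exact: initial_continuous.
  exact: coord_continuous.
have c2 : {for t, continuous (fun t : std_simplex R 1 => set_val t 0 1 *: T)}.
  by apply: (@cvgZr_tmp R 'rV[R]_n _ (nbhs t) _ _ _ T c1).
have [act_cont _] := act_smooth S (x := (set_val t 0 1 *: T, x)) I.
by apply: (@continuous2_cvg _ _ _ _ (nbhs t) _ _ _ (act S) _ _ act_cont c2);
  exact: cvg_cst.
Qed.

(* The path s |-> Phi^{sT}(x), 0 <= s <= 1, as a singular simplex: the point s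
   of [0, 1] has barycentric coordinates (1 - s, s). *)
Definition act_path (T : 'rV[R]_n) (x : M) : singular_simplex R M 1 :=
  mkcts (@act_path_continuous T x).

Lemma act_path_cycle (T : 'rV[R]_n) (x : M) : isotropy (act S) x T ->
  << act_path T x >> \in @is_cycle R M 0.
Proof.
move=> xT; rewrite unfold_in /boundary liftU scale1r !big_ord_recl big_ord0.
rewrite addr0 expr0 scale1r expr1 scaleN1r subr_eq0; apply/eqP; congr << _ >>.
apply/continuousEP => t.
have /= [_] := set_valP t; rewrite big_ord1 => t1.
transitivity x.
  rewrite /= /mkcts /face /= set_valE /= mxE.
  case: unliftP => [l _|//]; rewrite (ord1 l) t1 scale1r; exact: xT.
rewrite /= /mkcts /face /= set_valE /= mxE.
have -> : (1 : 'I_2) = fintype.lift ord0 ord0 by apply/val_inj.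
by rewrite unlift_none scale0r act0.
Qed.

Lemma lattice_bundle_isotropy (w : lattice_bundle) :
  isotropy (act S) (orbit_repr (set_val w).1) (set_val w).2.
Proof.
have /= := set_valP w; apply; exact: orbit_reprK.
Qed.

(* The class does not depend on the point of the orbit at which the loop is
   based; [orbit_repr] selects one. *)
Definition rho (w : lattice_bundle) : H1_mod_torsion R M :=
  homology_class (exist (fun c => c \in @is_cycle R M 0) _
    (act_path_cycle (lattice_bundle_isotropy w))).

(* [phi] is an isomorphism of the image of [rho] with Z^l; then
   rho_i(w) = phi (rho w) 0 i. *)
Definition rho_coordinates (l : nat)
    (phi : H1_mod_torsion R M -> 'rV[int]_l) : Prop :=
  set_bij (range rho) setT phi /\
  {in range rho &, {morph phi : a b / a + b}}.

Definition ker_rho (l : nat) (phi : H1_mod_torsion R M -> 'rV[int]_l)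
    (i : 'I_l) : set lattice_bundle :=
  [set w | phi (rho w) 0 i = 0].

Definition linear_span (B : set 'rV[R]_n) : set 'rV[R]_n :=
  [set v | exists2 s : seq 'rV[R]_n, [set` s] `<=` B & v \in span s].

(* V_o, for K = ker rho_1. *)
Definition fiber_span (K : set lattice_bundle) (o : orbit_space) :
    set 'rV[R]_n :=
  linear_span
    [set T | exists w : lattice_bundle, K w /\ set_val w = (o, T)].

Definition foliation_by (K : set lattice_bundle) : set (set M) :=
  range (fun p : M => [set act S v p | v in fiber_span K (orbit_proj p)]).

Definition orbit_foliation : set (set M) := range (orbit_of (act S)).

End System.

Arguments orbit_space {R k n M X} S.
Arguments orbit_proj {R k n M X} S x.
Arguments orbit_atlas {R k n M X} S.
Arguments lattice_bundle {R k n M X} S.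
Arguments rho {R k n M X} S w.
Arguments rho_coordinates {R k n M X} S {l} phi.
Arguments ker_rho {R k n M X} S {l} phi i.
Arguments foliation_by {R k n M X} S K.
Arguments orbit_foliation {R k n M X} S.

(* Leaves are compact, so that their leaf topology is the topology induced
   by M; the last m - d coordinates of a foliated chart are the transverse
   ones. *)
Definition foliated_chart (R : realType) (m d : nat) (M : topologicalType)
    (P : set (set M)) (c : chart R m M) : Prop :=
  forall L, P L -> forall x, (L `&` dom c) x ->
    connected_component (L `&` dom c) x =
    [set y | dom c y /\
      forall i : 'I_m, (d <= i)%N -> chart_map c y 0 i = chart_map c x 0 i].

(* The torus being compact, an injective immersion is an embedding. *)
Definition embedded_torus (R : realType) (m d : nat) (M : topologicalType)
    (X : manifold R m M) (L : set M) : Prop :=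
  exists g : torus R d -> M,
    [/\ immersion (@torus_atlas R d) X g, injective g & range g = L].

Definition toric_foliation (R : realType) (m d : nat) (M : topologicalType)
    (X : manifold R m M) (P : set (set M)) : Prop :=
  [/\ partition P id setT,
      forall L, P L -> embedded_torus d X L &
      forall x, exists c, [/\ maximal_atlas X c, dom c x &
                              foliated_chart d P c]].

Definition refines (M : Type) (P Q : set (set M)) : Prop :=
  forall L, P L -> exists2 L', Q L' & L `<=` L'.

Definition local_trivialization (R : realType) (k n : nat)
    (M : topologicalType) (X : manifold R (k + n) M) (S : regular_system X)
    (U : set (orbit_space S))
    (psi : orbit_space S * torus R 1 * torus R n.-1 -> M) : Prop :=
  diffeomorphism
    (prod_atlas (prod_atlas (orbit_atlas S) (@torus_atlas R 1))
                (@torus_atlas R n.-1))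
    X (U `*` setT `*` setT) (orbit_proj S @^-1` U) psi /\
  forall u z t, U u -> orbit_proj S (psi (u, z, t)) = u.

(* Main.v *)
(* Near a compact orbit the system has a smooth section [sigma] of the momentum
   map (inverse function theorem), and the implicit function theorem applied to
   [act T (sigma u) = sigma u] continues a basis of the period lattice to a
   smooth frame [E u] of the lattices at the points [sigma u]; by compactness
   there are no other periods nearby.  A loop of periods moves by a homotopy, so
   [rho_1] is locally constant along such a frame.  Since [M] is connected and
   [rho_1] takes the value 1 somewhere, it takes it at every point, and hence
   every period lattice has a basis on which [rho_1] is (1, 0, ..., 0); such a
   basis is found as one of minimal determinant.  With this adapted frame,
   [(u, s) |-> act (s E(u)) (sigma u)] descends to the trivialization
   [U * T^n -> q^-1(U)], and the leaves are the images of the subtori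
   [u = const, s_1 = const]. *)
From HB Require Import structures.
Require Import Defs.
From mathcomp Require Import all_boot all_order all_algebra.
From mathcomp Require Import all_classical all_reals all_analysis.
From mathcomp Require Import generic_quotient ring_quotient freeg.
From mathcomp Require Import perm ring lra zify.
Import Defs.

Set Implicit Arguments.
Unset Strict Implicit.
Unset Printing Implicit Defensive.

Import Order.TTheory GRing.Theory Num.Theory.
Import numFieldNormedType.Exports.

Local Open Scope classical_set_scope.
Local Open Scope ring_scope.

(** * Calculus on row vectors *)

(** Compactness of an orbit yields at first only n periods independent over R: they may generate a
    proper sublattice, and lattices at different points are comparable only through continuation.
    The value 1 is therefore spread over M with such crude frames: modulo the frame a period near
    the orbit moves into a fixed ball, where it is close to a period of the central orbit with the
    same value of [rho_1]. Only then is a basis built, at each point separately. A period of value 1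
    makes this possible by subtraction alone, since its multiples correct every other period to
    value 0. That a minimal determinant is reached is a matter of denominators: relative to one
    independent frame all periods have a common denominator, so the absolute determinants of frames
    of periods are natural multiples of a fixed number; and a period with a fractional coordinate,
    put in place of a row of value 0, makes the determinant smaller. Smoothness is handled through
    germs at points, because most maps arise from local inverses whose domains are not explicit. *)

Section RowNorm.
Context {R : realType} {m : nat}.
Implicit Types (x y v : 'rV[R]_m).

Lemma coord_le_norm v i : `|v 0 i| <= `|v|.
Proof.
rewrite [leRHS]/Num.Def.normr/= mx_normrE.
by apply: le_trans; last exact: (le_bigmax _ _ (0, i)).
Qed.

Lemma row_norm_le v (c : R) : 0 <= c -> (forall i, `|v 0 i| <= c) -> `|v| <= c.
Proof.
move=> c0 vc; rewrite [leLHS]/Num.Def.normr/= mx_normrE.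
by apply: bigmax_le => // -[i j] _ /=; rewrite (ord1 i).
Qed.

Lemma row_ballP x (d : R) y : ball x d y <-> `|x - y| < d.
Proof. by rewrite -ball_normE. Qed.

End RowNorm.

Section MeanValue.
Context {R : realType}.

(** The endpoints come in either order, since they will be coordinate increments of unknown sign.
    With [c = 0] and [eps = 0] this gives constancy. *)
Lemma MVT_dist (h : R -> R) (c eps a b : R) :
  (forall t, Num.min a b <= t <= Num.max a b ->
     derivable h t 1 /\ `|'D_1 h t - c| <= eps) ->
  `|h b - h a - c * (b - a)| <= eps * `|b - a|.
Proof.
wlog ab : a b / a <= b => [H|].
  have /orP[ab|ba] := le_total a b; first exact: H.
  move=> hab; have := H b a ba.
  rewrite minC maxC => /(_ hab).
  rewrite (distrC b a) -[X in X <= _ -> _]normrN.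
  by congr (is_true (`|_| <= _)); ring.
rewrite (min_idPl ab) (max_idPr ab) => hab.
have [] := @MVT_segment R h ('D_1 h) a b ab.
- move=> t /[!in_itv]/= /andP[/ltW ta /ltW tb].
  by have [|dt _] := hab t; [rewrite ta tb|exact: derivableP].
- apply: derivable_within_continuous => t; rewrite in_itv /= => /hab[] //.
move=> t /[!in_itv]/= /hab [_ tc] ->.
by rewrite -mulrBl normrM ler_wpM2r.
Qed.

Variable m : nat.
Implicit Types (x y v z : 'rV[R]_m) (f : 'rV[R]_m -> R).

Lemma derivable_line f z v (t : R) : derivable f (z + t *: v) v ->
  derivable (fun s : R => f (z + s *: v)) t 1 /\
  'D_1 (fun s : R => f (z + s *: v)) t = 'D_v f (z + t *: v).
Proof.
rewrite /derivable /derive /=.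
set g1 := fun h => h^-1 *: _; set g2 := fun h => h^-1 *: _.
suff -> : g1 = g2 by [].
apply/funext => h; rewrite /g1 /g2 /=; congr (_ *: (f _ - _)).
by rewrite [_ *: 1]mulr1 scalerDl addrCA addrA.
Qed.

Definition hybrid x y (i : nat) : 'rV[R]_m :=
  \row_j (if (j < i)%N then x 0 j else y 0 j).

Lemma hybrid0 x y : hybrid x y 0 = y.
Proof. by apply/rowP => j; rewrite mxE. Qed.

Lemma hybridm x y : hybrid x y m = x.
Proof. by apply/rowP => j; rewrite mxE ltn_ord. Qed.

Lemma hybridS x y (i : 'I_m) :
  hybrid x y i.+1 = hybrid x y i + (x 0 i - y 0 i) *: delta_mx 0 i.
Proof.
apply/rowP => j; rewrite !mxE eqxx /= ltnS leq_eqVlt (inj_eq val_inj).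
have [->|_] := eqVneq j i; last by rewrite mulr0 addr0.
by rewrite ltnn /= mulr1 addrC subrK.
Qed.

(* Walking from [y] to [x] one coordinate at a time. *)
Lemma strict_derivative f x0 :
  (\forall x \near x0, forall i, derivable f x (delta_mx 0 i)) ->
  (forall i, {for x0, continuous ('D_(delta_mx 0 i) f)}) ->
  forall eps : R, 0 < eps -> exists2 d : R, 0 < d & forall x y,
    ball x0 d x -> ball x0 d y ->
    `|f x - f y - \sum_i (x 0 i - y 0 i) * 'D_(delta_mx 0 i) f x0|
      <= eps * `|x - y|.
Proof.
move=> df cf eps eps0.
have : \forall x \near x0, forall i, derivable f x (delta_mx 0 i) /\
    `|'D_(delta_mx 0 i) f x - 'D_(delta_mx 0 i) f x0| <= eps / m.+1%:R.
  near=> x => i; split; first by move: i; near: x.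
  move: i; near: x; apply: filter_forall => i.
  have /cvgr_distC_le := cf i; apply; exact: divr_gt0.
move=> /nbhs_ballP[d /= d0 dP]; exists d => // x y xd yd.
(* A ball of the sup norm is a box, so every point of the walk stays in it. *)
have hd (i : 'I_m) (t : R) :
    Num.min 0 (x 0 i - y 0 i) <= t <= Num.max 0 (x 0 i - y 0 i) ->
    ball x0 d (hybrid x y i + t *: delta_mx 0 i).
  move=> tP; split=> // a j; rewrite (ord1 a) !mxE eqxx /=.
  move: xd yd => [_ /(_ 0 j) xd] [_ /(_ 0 j) yd].
  case: ltnP => [ji|ij].
    by rewrite [j == i]lt_eqF // mulr0 addr0.
  have [ji|_] := eqVneq j i; last by rewrite mulr0 addr0.
  move: xd yd; rewrite ji /= mulr1 -!ball_normE /= !ltr_distl => xd yd.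
  move: tP; rewrite ge_min le_max; lra.
have -> : f x - f y = \sum_(i < m) (f (hybrid x y i.+1) - f (hybrid x y i)).
  have := telescope_sumr (fun i => f (hybrid x y i)) (leq0n m).
  by rewrite hybridm hybrid0 big_mkord => ->.
rewrite -sumrB; apply: le_trans (ler_norm_sum _ _ _) _.
apply: (@le_trans _ _ (\sum_(i < m) eps / m.+1%:R * `|x - y|)); last first.
  rewrite sumr_const card_ord -[X in X <= _]mulr_natr mulrAC ler_wpM2r // -mulrA ger_pMr //.
  by rewrite mulrC ler_pdivrMr ?ltr0n // mul1r ler_nat.
apply: ler_sum => i _; rewrite hybridS.
pose h (t : R) := f (hybrid x y i + t *: delta_mx 0 i).
have -> : f (hybrid x y i) = h 0 by rewrite /h scale0r addr0.
rewrite -/(h (x 0 i - y 0 i)).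
have := @MVT_dist h ('D_(delta_mx 0 i) f x0) (eps / m.+1%:R) 0 (x 0 i - y 0 i).
rewrite subr0 (mulrC (x 0 i - y 0 i)) => H; apply: le_trans (H _) _.
  move=> t /hd /dP /(_ i)[dt bt].
  by have [? ->] := derivable_line dt.
rewrite ler_wpM2l //; first exact/ltW/divr_gt0.
by have := coord_le_norm (x - y) i; rewrite !mxE.
Unshelve. all: by end_near. Qed.

End MeanValue.

Section PartialsDifferentiable.
Context {R : realType} {m : nat}.
Implicit Types (x y v : 'rV[R]_m) (f : 'rV[R]_m -> R).

(** With its second point fixed at [x0], [strict_derivative] is the little-o estimate that
    characterizes the differential. *)
Lemma partials_diff f x0 :
  (\forall x \near x0, forall i, derivable f x (delta_mx 0 i)) ->
  (forall i, {for x0, continuous ('D_(delta_mx 0 i) f)}) ->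
  differentiable f x0 /\
  forall v, 'd f x0 v = \sum_i v 0 i * 'D_(delta_mx 0 i) f x0.
Proof.
move=> df cf.
pose L v := \sum_i v 0 i * 'D_(delta_mx 0 i) f x0.
have L_lin : linear L.
  move=> a u v; rewrite /L scaler_sumr -big_split; apply: eq_bigr => i _ /=.
  by rewrite !mxE mulrDl -mulrA.
pose dL : {linear 'rV[R]_m -> R} :=
  HB.pack L (GRing.isLinear.Build _ _ _ _ L L_lin).
have cL : continuous L.
  move=> x; apply: differentiable_continuous.
  have -> : L = \sum_(i < m) (fun v => v 0 i * 'D_(delta_mx 0 i) f x0).
    by apply/funext => v; rewrite fct_sumE.
  apply: differentiable_sum => i; apply: differentiableM => //.
  exact: differentiable_coord.
move: (@diff_unique R 'rV[R]_m R f dL x0 cL); set P := (X in (X -> _) -> _) => dE.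
have fo : P.
  rewrite /P; apply/eqaddoP => _/posnumP[e].
  have [d d0 dP] := strict_derivative df cf (gt0 e).
  near=> x; rewrite /= /cst.
  have := dP (x + x0) x0; rewrite addrK => H.
  have -> : (f \o shift x0 - (cst (f x0) + L)) x =
      f (x + x0) - f x0 - \sum_i ((x + x0) 0 i - x0 0 i) * 'D_(delta_mx 0 i) f x0.
    rewrite !fctE /= /cst opprD addrA; congr (_ - _); apply: eq_bigr => i _.
    by rewrite mxE addrK.
  apply: H; last exact: ballxx.
  rewrite -ball_normE /= opprD addrCA subrr addr0 normrN.
  near: x; exact: (@nbhs0_lt _ 'rV[R]_m _ d0).
have {}dE := dE fo.
split; last by move=> v; rewrite dE.
apply/diff_locallyP; rewrite dE; split=> //.
Unshelve. all: by end_near. Qed.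

End PartialsDifferentiable.

Lemma near_eq_continuous (T U : topologicalType) (f g : T -> U) (x : T) :
  (\forall y \near x, f y = g y) ->
  {for x, continuous f} -> {for x, continuous g}.
Proof.
move=> fg cf; suff : g @ x --> g x by [].
rewrite -(nbhs_singleton fg); apply: cvg_trans cf.
by apply: near_eq_cvg; apply: filterS fg => y ->.
Qed.

Lemma near_all (T : topologicalType) (P : T -> Prop) (x : T) :
  (forall y, P y) -> \forall y \near x, P y.
Proof. by move=> PT; apply: filterE. Qed.

(** * Germs of functions of class C^r *)

Section Germs.
Context {R : realType}.

(** Unlike [Ck], this carries no domain: each condition holds on some neighbourhood of [x], so the
    closure lemmas need no bookkeeping of open sets. *)
Fixpoint germ_Ck (r : nat) (m : nat) (f : 'rV[R]_m -> R) (x : 'rV[R]_m) :=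
  (\forall y \near x, {for y, continuous f}) /\
  if r is r'.+1 then
    forall i : 'I_m, (\forall y \near x, derivable f y (delta_mx 0 i)) /\
                     germ_Ck r' ('D_(delta_mx 0 i) f) x
  else True.

Section Scalar.
Context {m : nat}.
Implicit Types (x y : 'rV[R]_m) (f g : 'rV[R]_m -> R) (r : nat).

Lemma germ_continuous r f x : germ_Ck r f x -> {for x, continuous f}.
Proof. by case: r => [|r] [/nbhs_singleton]. Qed.

Lemma germ_Ck_eq r f g x : (\forall y \near x, f y = g y) ->
  germ_Ck r f x -> germ_Ck r g x.
Proof.
have cfg f' g' : (\forall y \near x, f' y = g' y) ->
    (\forall y \near x, {for y, continuous f'}) ->
    \forall y \near x, {for y, continuous g'}.
  move=> /near_join fg; apply: filterS2 fg => y fg cf.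
  exact: near_eq_continuous fg cf.
elim: r f g => [|r IH] f g fg [cf df]; split; rewrite //=; first exact: cfg fg cf.
  exact: cfg fg cf.
move=> i; have [di ri] := df i; split.
  by apply: filterS2 (near_join fg) di => y; exact: near_eq_derivable.
by apply: IH ri; apply: filterS (near_join fg) => y; exact: near_eq_derive.
Qed.

Lemma germ_CkS r f x : germ_Ck r.+1 f x -> germ_Ck r f x.
Proof.
elim: r f => [|r IH] f [cf df]; split => // i.
by have [di ri] := df i; split => //; exact: IH.
Qed.

Lemma germ_Ck_near r f x : germ_Ck r f x -> \forall y \near x, germ_Ck r f y.
Proof.
elim: r f => [|r IH] f [cf df].
  by apply: filterS (near_join cf) => y.
have : \forall y \near x, forall i,
    (\near y, derivable f y (delta_mx 0 i)) /\
    germ_Ck r ('D_(delta_mx 0 i) f) y.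
  near=> y => i; split; move: i; near: y; apply: filter_forall => i;
    have [di ri] := df i; first exact: near_join di.
  exact: IH.
by apply: filterS2 (near_join cf) => y.
Unshelve. all: by end_near. Qed.

Lemma germ_diff r f x : germ_Ck r.+1 f x ->
  differentiable f x /\
  forall v, 'd f x v = \sum_i v 0 i * 'D_(delta_mx 0 i) f x.
Proof.
move=> [_ df]; apply: partials_diff => [|i]; last first.
by have [_ /germ_continuous] := df i.
near=> y => i; move: i; near: y.
by apply: filter_forall => i; have [] := df i.
Unshelve. all: by end_near. Qed.

Lemma germ_Ck_cst r (c : R) x : germ_Ck r (fun=> c) x.
Proof.
have cc (c' : R) : \forall y \near x, {for y, continuous (fun=> c' : R)}.
  by apply: near_all => y; exact: cst_continuous.
elim: r c => [|r IH] c; (split; first exact: cc) => // i.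
 split; first by apply: near_all => y; exact: derivable_cst.
by apply: germ_Ck_eq (IH 0); apply: near_all => y; rewrite derive_cst.
Qed.

Lemma germ_CkD r f g x : germ_Ck r f x -> germ_Ck r g x ->
  germ_Ck r (fun y => f y + g y) x.
Proof.
elim: r f g => [|r IH] f g [cf df] [cg dg];
  (split; first by apply: filterS2 cf cg => y cfy cgy; exact: continuousD) => // i.
 have [di ri] := df i; have [dgi rgi] := dg i; split.
  by apply: filterS2 di dgi => y dy dgy; exact: (derivableD dy dgy).
apply: germ_Ck_eq (IH _ _ ri rgi); apply: filterS2 di dgi => y *.
by rewrite -deriveD.
Qed.

Lemma germ_CkM r f g x : germ_Ck r f x -> germ_Ck r g x ->
  germ_Ck r (fun y => f y * g y) x.
Proof.
elim: r f g => [|r IH] f g Hf Hg;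
  have [cf df] := Hf; have [cg dg] := Hg;
  (split; first by apply: filterS2 cf cg => y cfy cgy; exact: continuousM) => // i.
 have [di ri] := df i; have [dgi rgi] := dg i; split.
  by apply: filterS2 di dgi => y dy dgy; exact: (derivableM dy dgy).
apply: germ_Ck_eq (germ_CkD (IH _ _ (germ_CkS Hf) rgi) (IH _ _ (germ_CkS Hg) ri)).
by apply: filterS2 di dgi => y *; rewrite -deriveM.
Qed.

Lemma germ_CkN r f x : germ_Ck r f x -> germ_Ck r (fun y => - f y) x.
Proof.
move=> Hf; apply: germ_Ck_eq (germ_CkM (germ_Ck_cst r (-1) x) Hf).
by apply: near_all => y; rewrite mulN1r.
Qed.

Lemma germ_CkV r f x : f x != 0 -> germ_Ck r f x ->
  germ_Ck r (fun y => (f y)^-1) x.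
Proof.
move=> fx0 Hf.
have f0 : \forall y \near x, f y != 0.
  by have := germ_continuous Hf => /cvgr_neq0; apply.
elim: r Hf => [|r IH] Hf; have [cf df] := Hf;
  (split; first by apply: filterS2 f0 cf => y y0 cfy; exact: continuousV) => // i.
 have [di ri] := df i; split.
  by apply: filterS2 f0 di => y y0 dy; exact: derivableV.
(* The derivative [- f^-2 * f'] involves the inverse at order [r] only. *)
have Hi := IH (germ_CkS Hf).
apply: germ_Ck_eq (germ_CkM (germ_CkN (germ_CkM Hi Hi)) ri).
by apply: filterS2 f0 di => y y0 yd; rewrite deriveV // expr2 invfM.
Qed.

Lemma germ_Ck_sum r (I : Type) (s : seq I) (F : I -> 'rV[R]_m -> R) x :
  (forall i, germ_Ck r (F i) x) -> germ_Ck r (fun y => \sum_(i <- s) F i y) x.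
Proof.
move=> HF; elim: s => [|i s IH].
  by apply: germ_Ck_eq (germ_Ck_cst r 0 x); apply: near_all => y; rewrite big_nil.
apply: germ_Ck_eq (germ_CkD (HF i) IH).
by apply: near_all => y; rewrite big_cons.
Qed.

Lemma germ_Ck_prod r (I : Type) (s : seq I) (F : I -> 'rV[R]_m -> R) x :
  (forall i, germ_Ck r (F i) x) -> germ_Ck r (fun y => \prod_(i <- s) F i y) x.
Proof.
move=> HF; elim: s => [|i s IH].
  by apply: germ_Ck_eq (germ_Ck_cst r 1 x); apply: near_all => y; rewrite big_nil.
apply: germ_Ck_eq (germ_CkM (HF i) IH).
by apply: near_all => y; rewrite big_cons.
Qed.

Lemma germ_Ck_coord r (j : 'I_m) x : germ_Ck r (fun y => y 0 j) x.
Proof.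
have cc : \forall y \near x, {for y, continuous (fun v : 'rV[R]_m => v 0 j)}.
  by apply: near_all => y; exact: coord_continuous.
case: r => [|r]; (split; first exact: cc) => // i.
 split.
  by apply: near_all => y; apply/diff_derivable/differentiable_coord.
apply: germ_Ck_eq (germ_Ck_cst r ((delta_mx 0 i : 'rV[R]_m) 0 j) x).
apply: near_all => y.
have := @derive_mx R 'rV[R]_m 1 m id y (delta_mx 0 i)
  (@derivable_id R 'rV[R]_m y (delta_mx 0 i)).
by rewrite derive_id => /matrixP /(_ 0 j) ->; rewrite mxE.
Qed.

End Scalar.
End Germs.

Section Composition.
Context {R : realType}.

Lemma row_continuous (T : topologicalType) (p : nat) (f : T -> 'rV[R]_p) x :
  (forall j, {for x, continuous (fun y => f y 0 j)}) -> {for x, continuous f}.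
Proof.
move=> cf; suff : f @ x --> f x by [].
move=> U [P nP PU]; rewrite nbhs_filterE.
have : \forall y \near x, forall j, P 0 j (f y 0 j).
  near=> y => j; move: j; near: y; apply: filter_forall => j.
  exact: (cf j _ (nP 0 j)).
by apply: filterS => y Py; apply: PU => i j; rewrite (ord1 i).
Unshelve. all: by end_near. Qed.

Lemma row_sum_delta p (v : 'rV[R]_p) : v = \sum_j v 0 j *: delta_mx 0 j.
Proof.
apply/rowP => j; rewrite summxE (bigD1 j) //= big1 => [|i ij].
  by rewrite !mxE !eqxx mulr1 addr0.
by rewrite !mxE (negbTE (_ : j != i)) 1?eq_sym // andbF mulr0.
Qed.

Lemma row_differentiable m p (f : 'rV[R]_m -> 'rV[R]_p) x :
  (forall j, differentiable (fun y => f y 0 j) x) -> differentiable f x.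
Proof.
move=> df.
have -> : f = \sum_(j < p) (fun y => f y 0 j *: delta_mx 0 j).
  by apply/funext => y; rewrite fct_sumE -row_sum_delta.
apply: differentiable_sum => j; exact: differentiableZl.
Qed.

(** By the chain rule a derivative of the composite is a sum of products in which a partial
    derivative of [g] is composed with [f]; hence the induction on [r] ranges over all [g]. *)
Lemma germ_Ck_comp r m p (f : 'rV[R]_m -> 'rV[R]_p) (g : 'rV[R]_p -> R) x :
  (forall j, germ_Ck r (fun y => f y 0 j) x) -> germ_Ck r g (f x) ->
  germ_Ck r (fun y => g (f y)) x.
Proof.
elim: r g => [|r IH] g Hf Hg.
all: have cf : {for x, continuous f} by
  apply: row_continuous => j; exact: germ_continuous (Hf j).
all: have [cg dg] := Hg.
all: have cfn : \forall y \near x, {for y, continuous f} by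
  (have : \forall y \near x, forall j, {for y, continuous (fun y => f y 0 j)} by
     near=> y => j; move: j; near: y; apply: filter_forall => j;
     have [] := Hf j); apply: filterS => y; exact: row_continuous.
all: have cc : \forall y \near x, {for y, continuous (fun y => g (f y))} by
  (have := cf _ cg; apply: filterS2 cfn => y cfy cgy;
  exact: (continuous_comp cfy cgy)).
  by split.
split => // i.
have dfn : \forall y \near x, differentiable f y.
  have : \forall y \near x, forall j, differentiable (fun y => f y 0 j) y.
    near=> y => j; move: j; near: y; apply: filter_forall => j.
    by apply: filterS (germ_Ck_near (Hf j)) => y /germ_diff[].
  by apply: filterS => y; exact: row_differentiable.
have dgn := cf _ (germ_Ck_near Hg).
split.
  apply: filterS2 dfn dgn => y dfy /germ_diff[dgy _].
  exact/diff_derivable/(differentiable_comp dfy dgy).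
have HD : germ_Ck r (fun y => \sum_j 'D_(delta_mx 0 i) (fun y => f y 0 j) y *
    'D_(delta_mx 0 j) g (f y)) x.
  apply: (@germ_Ck_sum _ _ r _ _ (fun (j : 'I_p) y =>
    'D_(delta_mx 0 i) (fun y => f y 0 j) y * 'D_(delta_mx 0 j) g (f y))) => j.
  apply: germ_CkM.
    by have [_ /(_ i)[]] := Hf j.
  apply: (IH ('D_(delta_mx 0 j) g)) => [j'|]; first exact: germ_CkS.
  by have [] := dg j.
apply: germ_Ck_eq HD; apply: filterS2 dfn dgn => y dfy /germ_diff[dgy dgE].
rewrite (deriveE (f := fun y => g (f y))); last exact: (differentiable_comp dfy dgy).
rewrite (diff_comp dfy dgy) /= dgE; apply: eq_bigr => j _.
rewrite -deriveE // derive_mx; last exact: diff_derivable.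
by rewrite mxE.
Unshelve. all: by end_near. Qed.

Definition smooth_pt m p (f : 'rV[R]_m -> 'rV[R]_p) x :=
  forall r j, germ_Ck r (fun y => f y 0 j) x.

Section SmoothGerm.
Context {m p q : nat}.
Implicit Types (x : 'rV[R]_m) (f g : 'rV[R]_m -> 'rV[R]_p).

Lemma smooth_pt_continuous f x : smooth_pt f x -> {for x, continuous f}.
Proof. by move=> sf; apply: row_continuous => j; exact: germ_continuous (sf 0%N j). Qed.

Lemma smooth_pt_eq f g x : (\forall y \near x, f y = g y) ->
  smooth_pt f x -> smooth_pt g x.
Proof.
by move=> fg sf r j; apply: germ_Ck_eq (sf r j); apply: filterS fg => y ->.
Qed.

Lemma smooth_pt_comp f (g : 'rV[R]_p -> 'rV[R]_q) x :
  smooth_pt f x -> smooth_pt g (f x) -> smooth_pt (fun y => g (f y)) x.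
Proof. by move=> sf sg r j; apply: (germ_Ck_comp (g := fun z => g z 0 j)). Qed.

Lemma smooth_pt_differentiable f x : smooth_pt f x -> differentiable f x.
Proof.
by move=> sf; apply: row_differentiable => j; have [] := germ_diff (sf 1%N j).
Qed.

(* [Ck] quantifies pointwise over its domain, so only the points of [W] matter
   here, and no openness is needed in this direction. *)
Lemma smooth_pt_Cinfty (W : set 'rV[R]_m) f :
  (forall x, W x -> smooth_pt f x) -> Cinfty W f.
Proof.
move=> sf r.
have {sf} : forall x, W x -> forall j, germ_Ck r (fun y => f y 0 j) x by move=> x /sf.
elim: r f => [|r IH] f sf; split => //=.
1,2: by move=> x Wx; apply: row_continuous => j; exact: germ_continuous (sf _ Wx j).
have df x : W x -> forall i, differentiable f x.
  by move=> Wx i; apply: row_differentiable => j; have [] := germ_diff (sf _ Wx j).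
move=> i; split=> [x Wx|]; first exact/diff_derivable/df.
apply: IH => x Wx j; have [_ /(_ i)[_]] := sf _ Wx j.
apply: germ_Ck_eq.
have : \forall y \near x, forall j, differentiable (fun y => f y 0 j) y.
  near=> y => j'; move: j'; near: y; apply: filter_forall => j'.
  by apply: filterS (germ_Ck_near (sf _ Wx j')) => y /germ_diff[].
apply: filterS => y /row_differentiable dfy.
rewrite (derive_mx (M := f)); last exact: diff_derivable.
by rewrite mxE.
Unshelve. all: by end_near. Qed.

Lemma Cinfty_smooth_pt (W : set 'rV[R]_m) f x :
  open W -> W x -> Cinfty W f -> smooth_pt f x.
Proof.
move=> Wo Wx sf r j; have {sf} := sf r.
have nW : \forall y \near x, W y by exact: open_nbhs_nbhs.
elim: r f => [|r IH] f [cf df].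
all: have cn : \forall y \near x, {for y, continuous (fun y => f y 0 j)} by
  (apply: filterS nW => y /cf cfy;
   exact: (continuous_comp cfy (@coord_continuous _ _ _ 0 j _))).
  by split.
split => // i; have [di ri] := df i.
have dj : \forall y \near x, derivable (fun y => f y 0 j) y (delta_mx 0 i) by
  apply: filterS nW => y /di /derivable_mxP /(_ 0 j).
split => //; apply: germ_Ck_eq (IH _ ri).
apply: filterS nW => y /di dy.
by rewrite derive_mx // mxE.
Qed.

End SmoothGerm.

Lemma smooth_pt_coordfun m p (h : 'I_p -> 'I_m) x :
  smooth_pt (fun v : 'rV[R]_m => \row_j v 0 (h j)) x.
Proof.
move=> r j; apply: germ_Ck_eq (germ_Ck_coord r (h j) x).
by apply: near_all => y; rewrite mxE.
Qed.

Lemma smooth_pt_mulmx m p (A : 'M[R]_(m, p)) x :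
  smooth_pt (fun v : 'rV[R]_m => v *m A) x.
Proof.
move=> r j; apply: germ_Ck_eq (germ_Ck_sum (index_enum _) (fun i : 'I_m =>
  germ_CkM (germ_Ck_coord r i x) (germ_Ck_cst r (A i j) x))).
by apply: near_all => y; rewrite mxE.
Qed.

Lemma smooth_pt_id m x : smooth_pt (fun v : 'rV[R]_m => v) x.
Proof. move=> r j; exact: germ_Ck_coord. Qed.

Lemma smooth_pt_cst m p (c : 'rV[R]_p) x : smooth_pt (fun v : 'rV[R]_m => c) x.
Proof. move=> r j; exact: germ_Ck_cst. Qed.

Lemma smooth_ptD m p (f g : 'rV[R]_m -> 'rV[R]_p) x :
  smooth_pt f x -> smooth_pt g x -> smooth_pt (fun v => f v + g v) x.
Proof.
move=> sf sg r j; apply: germ_Ck_eq (germ_CkD (sf r j) (sg r j)).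
by apply: near_all => y; rewrite mxE.
Qed.

Lemma smooth_pt_row_mx m p q (f : 'rV[R]_m -> 'rV[R]_p) (g : 'rV[R]_m -> 'rV[R]_q) x :
  smooth_pt f x -> smooth_pt g x -> smooth_pt (fun v => row_mx (f v) (g v)) x.
Proof.
move=> sf sg r j; case: (fintype.splitP j) => i ij.
  apply: germ_Ck_eq (sf r i); apply: near_all => y.
  have -> : j = lshift q i by exact/val_inj.
  by rewrite row_mxEl.
apply: germ_Ck_eq (sg r i); apply: near_all => y.
have -> : j = rshift p i by exact/val_inj.
by rewrite row_mxEr.
Qed.

Lemma smooth_pt_lsubmx m p q (f : 'rV[R]_m -> 'rV[R]_(p + q)) x :
  smooth_pt f x -> smooth_pt (fun v => lsubmx (f v)) x.
Proof.
move=> sf r j; apply: germ_Ck_eq (sf r (lshift q j)).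
by apply: near_all => y; rewrite mxE.
Qed.

Lemma smooth_pt_rsubmx m p q (f : 'rV[R]_m -> 'rV[R]_(p + q)) x :
  smooth_pt f x -> smooth_pt (fun v => rsubmx (f v)) x.
Proof.
move=> sf r j; apply: germ_Ck_eq (sf r (rshift p j)).
by apply: near_all => y; rewrite mxE.
Qed.

End Composition.

(** * The inverse function theorem *)
Section InverseFunction.
Context {R : realType}.

Lemma mulmx_norm_le m p (A : 'M[R]_(m, p)) :
  exists2 C : R, 0 < C & forall v : 'rV[R]_m, `|v *m A| <= C * `|v|.
Proof.
exists (\sum_i \sum_j `|A i j| + 1).
  rewrite ltr_wpDl //; apply: sumr_ge0 => i _; exact: sumr_ge0.
move=> v; apply: row_norm_le => [|j].
  rewrite mulr_ge0 // addr_ge0 //; apply: sumr_ge0 => i _; exact: sumr_ge0.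
rewrite mxE; apply: le_trans (ler_norm_sum _ _ _) _.
rewrite mulrDl mul1r ler_wpDr // mulr_suml; apply: ler_sum => i _.
rewrite normrM mulrC ler_pM //; last exact: coord_le_norm.
by rewrite (bigD1 j) //= lerDl; apply: sumr_ge0.
Qed.

(** Row vectors act on the left, so this is the transpose of the usual Jacobian matrix, and the
    chain rule multiplies in the order of application. *)
Definition jacobi m p (f : 'rV[R]_m -> 'rV[R]_p) (x : 'rV[R]_m) : 'M[R]_(m, p) :=
  \matrix_(i, j) 'D_(delta_mx 0 i) (fun y => f y 0 j) x.

Lemma smooth_pt_jacobi m p (f : 'rV[R]_m -> 'rV[R]_p) x i j r :
  smooth_pt f x -> germ_Ck r (fun y => jacobi f y i j) x.
Proof.
move=> sf; have [_ /(_ i)[_]] := sf r.+1 j.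
by apply: germ_Ck_eq; apply: near_all => y; rewrite mxE.
Qed.

Lemma diff_jacobi m p (f : 'rV[R]_m -> 'rV[R]_p) x :
  (forall j, germ_Ck 1 (fun y => f y 0 j) x) ->
  forall v, 'd f x v = v *m jacobi f x.
Proof.
move=> sf v.
have df : differentiable f x.
  by apply: row_differentiable => j; have [] := germ_diff (sf j).
apply/rowP => j; have [dj djE] := germ_diff (sf j).
have := djE v; rewrite -!deriveE // derive_mx; last exact: diff_derivable.
by rewrite mxE => ->; rewrite mxE; apply: eq_bigr => i _; rewrite mxE.
Qed.

(** Both points are free: on a ball the map is nearly linear, hence injective with Lipschitz inverse
    when its Jacobian is invertible; with one point fixed, the same estimate differentiates that
    inverse. *)
Lemma strict_diff m p (f : 'rV[R]_m -> 'rV[R]_p) x0 :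
  (forall j, germ_Ck 1 (fun y => f y 0 j) x0) ->
  forall eps : R, 0 < eps -> exists2 d : R, 0 < d & forall x y,
    ball x0 d x -> ball x0 d y ->
    `|f x - f y - (x - y) *m jacobi f x0| <= eps * `|x - y|.
Proof.
move=> sf eps eps0.
(* Taking the radius along the filter at 0 gives one radius for all coordinates. *)
have : \forall d \near (0:R)^'+, forall j x y, ball x0 d x -> ball x0 d y ->
    `|(f x - f y - (x - y) *m jacobi f x0) 0 j| <= eps * `|x - y|.
  near=> d => j; move: j; near: d; apply: filter_forall => j.
  have dn : \forall x \near x0, forall i,
      derivable (fun y => f y 0 j) x (delta_mx 0 i).
    near=> x => i; move: i; near: x; apply: filter_forall => i.
    by have [_ /(_ i)[]] := sf j.
  have cn i : {for x0, continuous ('D_(delta_mx 0 i) (fun y => f y 0 j))}.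
    by have [_ /(_ i)[_ H]] := sf j; exact: (germ_continuous (r := 0) H).
  have [d d0 dP] := strict_derivative dn cn eps0.
  near=> e => x y xe ye.
  have ed : e <= d by near: e; exact: nbhs_right_le.
  have := dP x y (le_ball ed xe) (le_ball ed ye).
  congr (is_true (`|_| <= _)); rewrite !mxE; congr (_ - _).
  by apply: eq_bigr => i _; rewrite !mxE.
move=> H; near ((0 : R)^'+) => d; exists d => // x y xd yd.
apply: row_norm_le => [|j]; first by rewrite mulr_ge0 // ltW.
by move: j x y xd yd; near: d.
Unshelve. all: by end_near. Qed.

Lemma germ_Ck_det p m (A : 'rV[R]_p -> 'M[R]_m) r x :
  (forall i j, germ_Ck r (fun y => A y i j) x) -> germ_Ck r (fun y => \det (A y)) x.
Proof.
move=> HA; rewrite /determinant.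
apply: germ_Ck_sum => s; apply: germ_CkM; first exact: germ_Ck_cst.
by apply: germ_Ck_prod => i; exact: HA.
Qed.

(** Cramer's rule: cofactors divided by the determinant, both polynomial in the entries. *)
Lemma germ_Ck_invmx p m (A : 'rV[R]_p -> 'M[R]_m) r x i j :
  A x \in unitmx ->
  (forall i j, germ_Ck r (fun y => A y i j) x) ->
  germ_Ck r (fun y => invmx (A y) i j) x.
Proof.
move=> uA HA; have HD := germ_Ck_det HA.
have D0 : \det (A x) != 0 by rewrite -unitfE -unitmxE.
have un : \forall y \near x, A y \in unitmx.
  have := germ_continuous HD => /cvgr_neq0 /(_ D0).
  by apply: filterS => y; rewrite unitmxE unitfE.
apply: (@germ_Ck_eq _ _ _
  (fun y => (\det (A y))^-1 * ((-1) ^+ (j + i) * \det (row' j (col' i (A y)))))).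
  by apply: filterS un => y; rewrite /invmx => ->; rewrite !mxE.
apply: germ_CkM; first exact: germ_CkV.
apply: germ_CkM; first exact: germ_Ck_cst.
apply: germ_Ck_det => i' j'.
apply: germ_Ck_eq (HA (fintype.lift j i') (fintype.lift i j')).
by apply: near_all => y; rewrite !mxE.
Qed.

End InverseFunction.

Section InverseFunctionTheorem.
Context {R : realType}.

Lemma continuous_norm_comp (T : topologicalType) m (f : T -> 'rV[R]_m) x :
  {for x, continuous f} -> {for x, continuous (fun y => `|f y|)}.
Proof. by move=> cf; exact: (cvg_norm cf). Qed.

(** Minimize [|N x - z|] over the compact closed ball. At a minimizer [x], the point
    [x' = x - (N x - z)] at least halves the distance to [z], so this distance is 0. The bound
    [r / 5] puts minimizers within [4 * (r / 5)] of [x0], which leaves room for [x'] in the ball. *)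
Lemma near_id_surj m (N : 'rV[R]_m -> 'rV[R]_m) x0 (r : R) : 0 < r ->
  (forall x, closed_ball_ Num.norm x0 r x -> {for x, continuous N}) ->
  (forall x y, closed_ball_ Num.norm x0 r x -> closed_ball_ Num.norm x0 r y ->
     `|N x - N y - (x - y)| <= 2^-1 * `|x - y|) ->
  forall z, `|z - N x0| < r / 5 ->
  exists2 x, `|x0 - x| < r & N x = z.
Proof.
move=> r0 cN HN z zr.
pose K := closed_ball_ Num.norm x0 r.
have K0 : K x0 by rewrite /K /closed_ball_ /= subrr normr0 ltW.
have cK : compact K.
  apply: bounded_closed_compact; last exact: closed_closed_ball_.
  exists (`|x0| + r); split; first exact: num_real.
  move=> M /ltW hM x Kx; apply: (le_trans _ hM).
  have := ler_normD x0 (x - x0); rewrite addrC subrK => /le_trans; apply.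
  by rewrite lerD2l distrC.
have cf : {within K, continuous (fun x => `|N x - z|)}.
  apply: continuous_in_subspaceT => x /[1!inE] Kx.
  apply: (@continuous_norm_comp _ _ (fun x => N x - z) x).
  apply: continuousB; [exact: cN | exact: cst_continuous].
have [x /[1!inE] Kx xmin] := EVT_min_rV (ex_intro _ x0 K0) cK cf.
have key u v : K u -> K v -> `|u - v| <= 2 * `|N u - N v|.
  move=> Ku Kv; have := HN u v Ku Kv.
  have := ler_normD (N u - N v) (- (N u - N v - (u - v))).
  rewrite normrN opprB addrCA subrr addr0; lra.
have xd : `|N x - z| <= `|N x0 - z| by apply: xmin; rewrite inE.
have dz : `|N x0 - z| < r / 5 by rewrite distrC.
have x0x : `|x0 - x| <= 4 * (r / 5).
  apply: le_trans (key _ _ K0 Kx) _.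
  have := ler_normD (N x0 - z) (- (N x - z)).
  rewrite normrN opprB addrA subrK; lra.
exists x; first by apply: le_lt_trans x0x _; lra.
apply/eqP; rewrite -subr_eq0 -normr_le0.
pose x' := x - (N x - z).
have Kx' : K x'.
  rewrite /K /closed_ball_ /= /x' opprB addrCA.
  apply: le_trans (ler_normD _ _) _; lra.
have : `|N x - z| <= `|N x' - z| by apply: xmin; rewrite inE.
have := HN x' x Kx' Kx.
have -> : x' - x = - (N x - z) by rewrite /x' addrAC subrr add0r.
rewrite normrN; have -> : N x' - N x - - (N x - z) = N x' - z.
  by rewrite opprK addrA subrK.
lra.
Qed.

Theorem inverse_function m (G : 'rV[R]_m -> 'rV[R]_m) (x0 : 'rV[R]_m) :
  (\forall x \near x0, smooth_pt G x) -> jacobi G x0 \in unitmx ->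
  exists (A B : set 'rV[R]_m) (H : 'rV[R]_m -> 'rV[R]_m),
    [/\ open A, A x0, open B &
     [/\ forall x, A x -> B (G x) /\ H (G x) = x,
      forall y, B y -> A (H y) /\ G (H y) = y &
      forall y, B y -> smooth_pt H y]].
Proof.
move=> sGn uJ; have sG := nbhs_singleton sGn; set J0 := jacobi G x0.
have [C C0 HC] := mulmx_norm_le (invmx J0).
(* [C] bounds [invmx J0]; with this accuracy [N = G *m invmx J0] differs from the identity by a
   1/2-Lipschitz map. *)
have e0 : 0 < (2 * C)^-1 by rewrite invr_gt0 mulr_gt0.
have [d1 d10 Hd1] := strict_diff (sG 1%N) e0.
have uJn : \forall x \near x0, jacobi G x \in unitmx.
  have HD := germ_Ck_det (fun i j => smooth_pt_jacobi i j 0 sG).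
  have D0 : \det J0 != 0 by rewrite -unitfE -unitmxE.
  have := germ_continuous HD => /cvgr_neq0 /(_ D0).
  by apply: filterS => y; rewrite unitmxE unitfE.
have [d2 d20 Hd2] : exists2 d : R, 0 < d & forall x, ball x0 d x ->
    jacobi G x \in unitmx /\ smooth_pt G x.
  have /nbhs_ballP[d /= d0 Hd] : \forall x \near x0,
    jacobi G x \in unitmx /\ smooth_pt G x by exact: filterI.
  by exists d => // x /Hd.
(* Halved, so that the closed ball of radius [r] lies in both open balls. *)
pose r := Num.min d1 d2 / 2.
have r0 : 0 < r by rewrite divr_gt0 // lt_min d10 d20.
have rd1 x : `|x0 - x| <= r -> ball x0 d1 x.
  move=> xr; apply/row_ballP; apply: le_lt_trans xr _.
  rewrite /r; have : Num.min d1 d2 <= d1 by rewrite ge_min lexx.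
  have : 0 < Num.min d1 d2 by rewrite lt_min d10 d20.
  lra.
have rd2 x : `|x0 - x| <= r -> jacobi G x \in unitmx /\ smooth_pt G x.
  move=> xr; apply: Hd2; apply/row_ballP; apply: le_lt_trans xr _.
  rewrite /r; have : Num.min d1 d2 <= d2 by rewrite ge_min lexx orbT.
  have : 0 < Num.min d1 d2 by rewrite lt_min d10 d20.
  lra.
pose N x := G x *m invmx J0.
have NH x y : `|x0 - x| <= r -> `|x0 - y| <= r ->
    `|N x - N y - (x - y)| <= 2^-1 * `|x - y|.
  move=> xr yr; have := Hd1 x y (rd1 _ xr) (rd1 _ yr).
  move=> H; have := HC (G x - G y - (x - y) *m J0).
  rewrite mulmxBl mulmxK // mulmxBl => /le_trans; apply.
  apply: (le_trans (ler_wpM2l (ltW C0) H)).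
  by rewrite invfM mulrA mulrCA mulfV ?gt_eqF // mulr1.
have cN x : `|x0 - x| <= r -> {for x, continuous N}.
  move=> /rd2[_ sGx]; apply: smooth_pt_continuous.
  exact: (smooth_pt_comp sGx (smooth_pt_mulmx _ _)).
have Nlip x y : `|x0 - x| <= r -> `|x0 - y| <= r -> `|x - y| <= 2 * `|N x - N y|.
  move=> xr yr; have := NH x y xr yr.
  have := ler_normD (N x - N y) (- (N x - N y - (x - y))).
  rewrite normrN opprB addrCA subrr addr0; lra.
have Glip x y : `|x0 - x| <= r -> `|x0 - y| <= r -> `|x - y| <= 2 * C * `|G x - G y|.
  move=> xr yr; apply: le_trans (Nlip _ _ xr yr) _.
  by rewrite -mulrA ler_pM2l // /N -mulmxBl.
pose B := [set y : 'rV[R]_m | `|y *m invmx J0 - N x0| < r / 5].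
pose A := [set x : 'rV[R]_m | `|x0 - x| < r] `&` [set x | B (G x)].
have Bo : open B.
  have cf y : {for y, continuous (fun y : 'rV[R]_m => `|y *m invmx J0 - N x0|)}.
    apply: (@continuous_norm_comp _ _ (fun y : 'rV[R]_m => y *m invmx J0 - N x0) y).
    apply: continuousB; last exact: cst_continuous.
    exact/smooth_pt_continuous/smooth_pt_mulmx.
  rewrite -[B]/((fun y : 'rV[R]_m => `|y *m invmx J0 - N x0|) @^-1` [set t | t < r / 5]).
  by apply: open_comp => [z _|]; [exact: cf|exact: open_lt].
have surj y : exists x, B y -> `|x0 - x| < r /\ G x = y.
  have [By|nBy] := pselect (B y); last by exists x0.
  have [x xr Nx] := @near_id_surj m N x0 r r0 cN NH _ By.
  exists x => _; split=> //.
  by rewrite -[G x](mulmxKV uJ) -/(N x) Nx mulmxKV.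
have [H HH] := choice surj.
exists A, B, H.
have Hinj x : A x -> H (G x) = x.
  move=> [xr BGx]; have [Hr HG] := HH _ BGx.
  apply/eqP; rewrite -subr_eq0 -normr_le0.
  by apply: le_trans (Glip _ _ (ltW Hr) (ltW xr)) _; rewrite HG subrr normr0 mulr0.
have HA y : B y -> A (H y) by move=> By; have [Hr HG] := HH _ By; split; rewrite //= HG.
have Hlip y y' : B y -> B y' -> `|H y - H y'| <= 2 * C * `|y - y'|.
  move=> By By'; have [Hr HG] := HH _ By; have [Hr' HG'] := HH _ By'.
  by apply: le_trans (Glip _ _ (ltW Hr) (ltW Hr')) _; rewrite HG HG'.
have C20 : 0 < 2 * C by rewrite mulr_gt0.
have nB y : B y -> \forall z \near y, B z by move=> By; exact: open_nbhs_nbhs.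
have cH y : B y -> {for y, continuous H}.
  move=> By; apply/(@cvgrPdist_lt _ _ _ (nbhs y) _ H (H y)) => e e1; near=> z.
  have Bz : B z by near: z; exact: nB.
  apply: le_lt_trans (Hlip _ _ By Bz) _.
  rewrite mulrC -ltr_pdivlMr //.
  by near: z; apply/nbhs_ballP; exists (e / (2 * C)) => [|t /row_ballP]; rewrite //= divr_gt0.
have dH y : B y -> forall v : 'rV[R]_m,
    is_derive y v H (v *m invmx (jacobi G (H y))).
  move=> By v; have [Hr HG] := HH _ By; have [ux sx] := rd2 _ (ltW Hr).
  set J := jacobi G (H y).
  have [C' C'0 HC'] := mulmx_norm_le (invmx J).
  suff : (fun h => h^-1 *: ((H \o shift y) (h *: v) - H y)) @ (0 : R)^'
      --> v *m invmx J.
    by move=> cv; apply: DeriveDef; [apply/cvg_ex; eexists; exact: cv|exact: cvg_lim].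
  apply/cvgrPdist_le => e e1.
  (* Absorbs the bound of [invmx J] and the Lipschitz constant of [H]; the summand 1 guards against
     [v = 0]. *)
  pose eps := e / (C' * (2 * C) * (`|v| + 1)).
  have eps0 : 0 < eps by rewrite divr_gt0 // !mulr_gt0 // ltr_wpDl.
  have [d d0 Hd] := strict_diff (sx 1%N) eps0.
  have shc : (fun h : R => h *: v + y) @ (0 : R) --> y.
    suff : (fun h : R => h *: v + y) @ (0 : R) --> 0 *: v + y by rewrite scale0r add0r.
    by apply: cvgD; [apply: cvgZr_tmp; exact: cvg_id|exact: cvg_cst].
  near=> h.
  have h0 : h != 0 by near: h; exact: nbhs_dnbhs_neq.
  have Bh : B (h *: v + y).
    by near: h; apply: nbhs_dnbhs; exact: (shc _ (nB _ By)).
  have [Hhr HGh] := HH _ Bh.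
  have bh : ball (H y) d (H (h *: v + y)).
    near: h; apply: nbhs_dnbhs.
    have nb : nbhs (H y) (ball (H y) d) by exact: nbhsx_ballx.
    exact: (shc _ (cH _ By _ nb)).
  have := Hd _ _ bh (ballxx _ d0).
  rewrite HGh HG addrK -/J => est.
  have {est} := le_trans (HC' _) (ler_wpM2l (ltW C'0) est).
  rewrite mulmxBl mulmxK // -scalemxAl => est.
  rewrite -[v *m _](scalerK h0) -scalerBr normrZ normfV ler_pdivrMl ?normr_gt0 //.
  apply: le_trans est _.
  have := Hlip _ _ Bh By; rewrite addrK normrZ => lip.
  apply: (@le_trans _ _ (C' * (eps * (2 * C * (`|h| * `|v|))))).
    by rewrite !ler_pM2l.
  rewrite /eps.
  have -> : C' * (e / (C' * (2 * C) * (`|v| + 1)) * (2 * C * (`|h| * `|v|))) =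
     `|h| * e * (`|v| / (`|v| + 1)).
    by field; rewrite !gt_eqF //= ltr_wpDl.
  rewrite ger_pMr ?mulr_gt0 ?normr_gt0 //.
  by rewrite ler_pdivrMr ?ltr_wpDl // mul1r lerDl.
split=> //.
- rewrite openE => x [xr BGx]; have [_ sx] := rd2 _ (ltW xr).
  apply: filterI.
    apply/nbhs_ballP; exists (r - `|x0 - x|) => [|z /row_ballP xz] /=.
      by rewrite subr_gt0.
    have := ler_distD x x0 z; lra.
  exact: (smooth_pt_continuous sx (nB _ BGx)).
- by split; rewrite /= ?subrr ?normr0 // /B /= -/(N _) subrr normr0 divr_gt0.
split.
- by move=> x Ax; split; [case: Ax|exact: Hinj].
- by move=> y By; split; [exact: HA|have [] := HH _ By].
(* Bootstrap: the partial derivatives of [H] at [y] are the entries of [invmx (jacobi G (H y))], so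
   order [k] for [H] gives order [k + 1]. *)
move=> y By r'; elim: r' y By => [|k IH] y By j.
all: have cn : \forall z \near y, {for z, continuous (fun w => H w 0 j)} by
  (apply: filterS (nB _ By) => z /cH cHz;
   exact: (continuous_comp cHz (@coord_continuous _ _ _ 0 j _))).
  by split.
split => // i; split.
  apply: filterS (nB _ By) => z Bz.
  have [dz _] := dH z Bz (delta_mx 0 i).
  by move/derivable_mxP : dz => /(_ 0 j).
have [ux sx] : jacobi G (H y) \in unitmx /\ smooth_pt G (H y).
  by apply: rd2; have [/ltW] := HH _ By.
have := germ_Ck_comp (IH y By) (germ_Ck_invmx i j ux
  (fun i j => smooth_pt_jacobi i j k sx)).
apply: germ_Ck_eq; apply: filterS (nB _ By) => z Bz.
have [dz dzE] := dH z Bz (delta_mx 0 i).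
move: dzE; rewrite derive_mx // => /matrixP /(_ 0 j).
by rewrite mxE => ->; rewrite -rowE mxE.
Unshelve. all: by end_near. Qed.

End InverseFunctionTheorem.

(** * Smooth maps of manifolds *)
Section SmoothNear.
Context {R : realType}.

(** [smooth_pt] lets the neighbourhood shrink with the order of differentiation; asking for it at
    all nearby points gives [Cinfty] on one open set. *)
Definition smooth_near m p (f : 'rV[R]_m -> 'rV[R]_p) (x : 'rV[R]_m) : Prop :=
  \forall y \near x, smooth_pt f y.

Lemma smooth_near_pt m p (f : 'rV[R]_m -> 'rV[R]_p) x :
  smooth_near f x -> smooth_pt f x.
Proof. exact: nbhs_singleton. Qed.

Lemma smooth_near_continuous m p (f : 'rV[R]_m -> 'rV[R]_p) x :
  smooth_near f x -> {for x, continuous f}.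
Proof. by move=> /smooth_near_pt /smooth_pt_continuous. Qed.

Lemma smooth_near_join m p (f : 'rV[R]_m -> 'rV[R]_p) x :
  smooth_near f x -> \forall y \near x, smooth_near f y.
Proof. exact: near_join. Qed.

Lemma smooth_near_eq m p (f g : 'rV[R]_m -> 'rV[R]_p) x :
  (\forall y \near x, f y = g y) -> smooth_near f x -> smooth_near g x.
Proof.
by move=> /near_join fg; apply: filterS2 fg => y; exact: smooth_pt_eq.
Qed.

Lemma smooth_near_comp m p q (f : 'rV[R]_m -> 'rV[R]_p)
    (g : 'rV[R]_p -> 'rV[R]_q) x :
  smooth_near f x -> smooth_near g (f x) -> smooth_near (fun y => g (f y)) x.
Proof.
move=> sf sg; have cf := smooth_near_continuous sf.
by apply: filterS2 sf (cf _ sg) => y; exact: smooth_pt_comp.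
Qed.

Lemma smooth_near_Cinfty m p (W : set 'rV[R]_m) (f : 'rV[R]_m -> 'rV[R]_p) :
  (forall x, W x -> smooth_near f x) -> Cinfty W f.
Proof. by move=> sf; apply: smooth_pt_Cinfty => x /sf /smooth_near_pt. Qed.

Lemma Cinfty_smooth_near m p (W : set 'rV[R]_m) (f : 'rV[R]_m -> 'rV[R]_p) x :
  open W -> W x -> Cinfty W f -> smooth_near f x.
Proof.
move=> Wo Wx sf; apply: filterS (open_nbhs_nbhs (conj Wo Wx)) => y Wy.
exact: Cinfty_smooth_pt Wo Wy sf.
Qed.

Lemma smooth_near_id m (x : 'rV[R]_m) : smooth_near (fun v => v) x.
Proof. by apply: near_all => y; exact: smooth_pt_id. Qed.

Lemma smooth_near_cst m p (c : 'rV[R]_p) (x : 'rV[R]_m) :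
  smooth_near (fun=> c) x.
Proof. by apply: near_all => y; exact: smooth_pt_cst. Qed.

Lemma smooth_near_coordfun m p (h : 'I_p -> 'I_m) (x : 'rV[R]_m) :
  smooth_near (fun v => \row_j v 0 (h j)) x.
Proof. by apply: near_all => y; exact: smooth_pt_coordfun. Qed.

Lemma smooth_near_mulmxr m p (A : 'M[R]_(m, p)) (x : 'rV[R]_m) :
  smooth_near (fun v => v *m A) x.
Proof. by apply: near_all => y; exact: smooth_pt_mulmx. Qed.

Lemma smooth_nearD m p (f g : 'rV[R]_m -> 'rV[R]_p) x :
  smooth_near f x -> smooth_near g x -> smooth_near (fun v => f v + g v) x.
Proof. by move=> sf sg; apply: filterS2 sf sg => y; exact: smooth_ptD. Qed.

Lemma smooth_near_row_mx m p q (f : 'rV[R]_m -> 'rV[R]_p)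
    (g : 'rV[R]_m -> 'rV[R]_q) x :
  smooth_near f x -> smooth_near g x -> smooth_near (fun v => row_mx (f v) (g v)) x.
Proof. by move=> sf sg; apply: filterS2 sf sg => y; exact: smooth_pt_row_mx. Qed.

Lemma smooth_near_lsubmx m p q (f : 'rV[R]_m -> 'rV[R]_(p + q)) x :
  smooth_near f x -> smooth_near (fun v => lsubmx (f v)) x.
Proof. by move=> sf; apply: filterS sf => y; exact: smooth_pt_lsubmx. Qed.

Lemma smooth_near_rsubmx m p q (f : 'rV[R]_m -> 'rV[R]_(p + q)) x :
  smooth_near f x -> smooth_near (fun v => rsubmx (f v)) x.
Proof. by move=> sf; apply: filterS sf => y; exact: smooth_pt_rsubmx. Qed.

Lemma near_ord (T : topologicalType) (p : nat) (P : 'I_p -> T -> Prop) (x : T) :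
  (forall i, \forall y \near x, P i y) -> \forall y \near x, forall i, P i y.
Proof.
by move=> HP; near=> y => i; move: i; near: y; exact: filter_forall.
Unshelve. all: by end_near. Qed.

Lemma smooth_near_mulmx m p q (f : 'rV[R]_m -> 'rV[R]_p)
    (E : 'rV[R]_m -> 'M[R]_(p, q)) x :
  smooth_near f x -> (forall i, smooth_near (fun v => row i (E v)) x) ->
  smooth_near (fun v => f v *m E v) x.
Proof.
move=> sf sE; apply: filterS2 sf (near_ord sE) => y {}sf {}sE r j.
apply: germ_Ck_eq (germ_Ck_sum (index_enum _) (fun i : 'I_p =>
  germ_CkM (sf r i) (sE i r j))).
by apply: near_all => z; rewrite mxE; apply: eq_bigr => i _; rewrite mxE.
Qed.

Lemma smooth_near_invmx m p (E : 'rV[R]_m -> 'M[R]_p) x :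
  E x \in unitmx -> (forall i, smooth_near (fun v => row i (E v)) x) ->
  (\forall y \near x, E y \in unitmx) /\
  forall i, smooth_near (fun v => row i (invmx (E v))) x.
Proof.
move=> uE sE.
have gE r i j y : smooth_pt (fun v => row i (E v)) y -> germ_Ck r (fun v => E v i j) y.
  by move=> /(_ r j); apply: germ_Ck_eq; apply: near_all => z; rewrite mxE.
have un : \forall y \near x, E y \in unitmx.
  have HD := germ_Ck_det (fun i j => gE 0%N i j x (smooth_near_pt (sE i))).
  have D0 : \det (E x) != 0 by rewrite -unitfE -unitmxE.
  have := germ_continuous HD => /cvgr_neq0 /(_ D0).
  by apply: filterS => y; rewrite unitmxE unitfE.
split => // i; apply: filterS2 un (near_ord sE) => y uy sEy r j.
apply: germ_Ck_eq (germ_Ck_invmx i j uy (fun i j => gE r i j y (sEy i))).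
by apply: near_all => z; rewrite mxE.
Qed.

End SmoothNear.

Lemma open_preimage_on (T U : topologicalType) (f : T -> U) (O : set T) (V : set U) :
  open O -> open V -> (forall x, O x -> {for x, continuous f}) ->
  open (O `&` f @^-1` V).
Proof.
move=> Oo Vo cf; rewrite openE => x [Ox Vx]; apply: filterI.
  exact: open_nbhs_nbhs.
exact: (cf x Ox _ (open_nbhs_nbhs (conj Vo Vx))).
Qed.

Lemma near_open (T : topologicalType) (P : T -> Prop) (x : T) :
  (\forall y \near x, P y) ->
  exists W : set T, [/\ open W, W x & forall y, W y -> P y].
Proof.
move=> nP; have : nbhs x [set y | P y] by exact: nP.
by rewrite nbhsE => -[W [Wo Wx] WP]; exists W.
Qed.

Section ManifoldMaps.
Context {R : realType} {m : nat} {M : topologicalType}.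
Variable X : manifold R m M.

(** A family with any number [p] of parameters. Here and in [fun_smooth] all charts around the point
    are tested, which makes composition immediate; [curve_smoothP] and [fun_smoothP] reduce the test
    to one chart. *)
Definition curve_smooth p (g : 'rV[R]_p -> M) (v : 'rV[R]_p) : Prop :=
  {for v, continuous g} /\
  forall d, atlas X d -> dom d (g v) -> smooth_near (fun w => chart_map d (g w)) v.

Definition fun_smooth p (f : M -> 'rV[R]_p) (x : M) : Prop :=
  forall d, atlas X d -> dom d x ->
    smooth_near (fun w => f (chart_inv d w)) (chart_map d x).

Lemma near_dom (d : chart R m M) x : atlas X d -> dom d x -> \forall y \near x, dom d y.
Proof. by move=> /atlas_chart Xd dx; apply: open_nbhs_nbhs; split=> //; exact: dom_open. Qed.

Lemma near_img (d : chart R m M) v : atlas X d -> img d v -> \forall w \near v, img d w.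
Proof. by move=> /atlas_chart Xd dx; apply: open_nbhs_nbhs; split=> //; exact: img_open. Qed.

Lemma transition_near c d x : atlas X c -> atlas X d -> dom c x -> dom d x ->
  smooth_near (fun w => chart_map d (chart_inv c w)) (chart_map c x).
Proof.
move=> Xc Xd cx dx; have hc := atlas_chart Xc; have hd := atlas_chart Xd.
apply: (@Cinfty_smooth_near R m m (img c `&` chart_inv c @^-1` dom d)).
- apply: open_preimage_on; [exact: img_open|exact: dom_open|].
  by move=> v cv; exact: chart_inv_continuous.
- by split; [exact: chart_map_img|rewrite /preimage /= chart_mapK].
- exact: atlas_compatible Xc Xd.
Qed.

Lemma curve_smoothP p (g : 'rV[R]_p -> M) v d : {for v, continuous g} ->
  atlas X d -> dom d (g v) -> smooth_near (fun w => chart_map d (g w)) v ->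
  curve_smooth g v.
Proof.
move=> cg Xd dg sg; split=> // d' Xd' dg'.
have := smooth_near_comp sg (transition_near Xd Xd' dg dg').
apply: smooth_near_eq.
have nd : \forall w \near v, dom d (g w) by exact: (cg _ (near_dom Xd dg)).
apply: filterS nd => w dw.
by rewrite (chart_mapK (atlas_chart Xd) dw).
Qed.

Lemma fun_smoothP p (f : M -> 'rV[R]_p) x d : atlas X d -> dom d x ->
  smooth_near (fun w => f (chart_inv d w)) (chart_map d x) -> fun_smooth f x.
Proof.
move=> Xd dx sf d' Xd' dx'; have hd := atlas_chart Xd; have hd' := atlas_chart Xd'.
have sf' : smooth_near (fun w => f (chart_inv d w))
    (chart_map d (chart_inv d' (chart_map d' x))) by rewrite (chart_mapK hd' dx').
have := smooth_near_comp (transition_near Xd' Xd dx' dx) sf'.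
apply: smooth_near_eq.
have nd : \forall w \near chart_map d' x, dom d (chart_inv d' w).
  apply: (chart_inv_continuous hd'); first exact: chart_map_img.
  by rewrite (chart_mapK hd' dx'); exact: near_dom.
by apply: filterS nd => w dw; rewrite (chart_mapK hd dw).
Qed.

Lemma exists_chart x : exists2 d, atlas X d & dom d x.
Proof. exact: atlas_cover. Qed.

Lemma curve_smooth_comp p q (h : 'rV[R]_q -> 'rV[R]_p) (g : 'rV[R]_p -> M) v :
  smooth_near h v -> curve_smooth g (h v) -> curve_smooth (fun w => g (h w)) v.
Proof.
move=> sh [cg sg]; have ch := smooth_near_continuous sh.
split; first exact: (continuous_comp ch cg).
by move=> d Xd dg; exact: (smooth_near_comp sh (sg d Xd dg)).
Qed.

Lemma fun_smooth_continuous p (f : M -> 'rV[R]_p) x :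
  fun_smooth f x -> {for x, continuous f}.
Proof.
move=> sf; have [d Xd dx] := exists_chart x; have hd := atlas_chart Xd.
have : {for x, continuous (fun y => f (chart_inv d (chart_map d y)))}.
  apply: (@continuous_comp _ _ _ (chart_map d) (fun w => f (chart_inv d w))).
    exact: chart_map_continuous.
  exact: smooth_near_continuous (sf d Xd dx).
apply: near_eq_continuous; apply: filterS (near_dom Xd dx) => y dy.
by rewrite chart_mapK.
Qed.

Lemma fun_curve_smooth p q (f : M -> 'rV[R]_q) (g : 'rV[R]_p -> M) v :
  curve_smooth g v -> fun_smooth f (g v) -> smooth_near (fun w => f (g w)) v.
Proof.
move=> [cg sg] sf; have [d Xd dg] := exists_chart (g v).
have := smooth_near_comp (sg d Xd dg) (sf d Xd dg).
apply: smooth_near_eq.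
have nd : \forall w \near v, dom d (g w) by exact: (cg _ (near_dom Xd dg)).
apply: filterS nd => w dw.
by rewrite (chart_mapK (atlas_chart Xd) dw).
Qed.

Lemma fun_smooth_comp p q (f : M -> 'rV[R]_p) (h : 'rV[R]_p -> 'rV[R]_q) x :
  fun_smooth f x -> smooth_near h (f x) -> fun_smooth (fun y => h (f y)) x.
Proof.
move=> sf sh d Xd dx; apply: smooth_near_comp (sf d Xd dx) _.
by rewrite (chart_mapK (atlas_chart Xd) dx).
Qed.

Lemma chart_inv_smooth d v : atlas X d -> img d v -> curve_smooth (chart_inv d) v.
Proof.
move=> Xd dv; have hd := atlas_chart Xd; have dd := chart_inv_dom hd dv.
apply: (@curve_smoothP _ _ _ d) => //; first exact: chart_inv_continuous.
apply: smooth_near_eq (smooth_near_id v).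
by apply: filterS (near_img Xd dv) => w dw; rewrite chart_invK.
Qed.

Lemma chart_map_smooth d x : atlas X d -> dom d x -> fun_smooth (chart_map d) x.
Proof. by move=> Xd dx d' Xd' dx'; exact: transition_near. Qed.

(** [P] is an arbitrary local condition built into the choice of [A], so that the inverse does not
    have to be shrunk afterwards. *)
Lemma inverse_function_chart (g : 'rV[R]_m -> M) v0 d (P : 'rV[R]_m -> Prop) :
  (\forall v \near v0, P v) -> curve_smooth g v0 -> atlas X d -> dom d (g v0) ->
  jacobi (fun v => chart_map d (g v)) v0 \in unitmx ->
  exists (A : set 'rV[R]_m) (O : set M) (H : M -> 'rV[R]_m),
    [/\ open A, A v0, open O &
     [/\ forall v, A v -> O (g v) /\ H (g v) = v,
      forall x, O x -> A (H x) /\ g (H x) = x,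
      forall v, A v -> P v &
      forall x, O x -> fun_smooth H x]].
Proof.
move=> nP sg Xd dg uJ; have hd := atlas_chart Xd.
have [cg sgd] := sg.
have nW : \forall v \near v0, P v /\ dom d (g v).
  apply: filterI => //.
  exact: (cg _ (near_dom Xd dg)).
have [W [Wo W0 HW]] := near_open nW.
have [A0 [B0 [H0 [A0o A00 B0o [AB BA sH]]]]] := inverse_function (sgd d Xd dg) uJ.
pose B := B0 `&` H0 @^-1` W.
have Bo : open B.
  by apply: open_preimage_on => // y /sH; exact: smooth_pt_continuous.
pose O := dom d `&` chart_map d @^-1` B.
have Oo : open O.
  apply: open_preimage_on => //; first exact: dom_open.
  by move=> x; exact: chart_map_continuous.
exists (A0 `&` W), O, (fun x => H0 (chart_map d x)); split=> //.
  exact: openI.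
split.
- move=> v [A0v Wv]; have [B0v Hv] := AB v A0v.
  by split=> //; split; [have [] := HW v Wv|split => //=; rewrite Hv].
- move=> x [dx [B0x WHx]]; have [A0x HGx] := BA _ B0x; split; first by split.
  have [_ dgx] := HW _ WHx.
  by rewrite -(chart_mapK hd dgx) HGx chart_mapK.
- by move=> v [_ /HW[]].
- move=> x [dx [B0x WHx]]; apply: (@fun_smooth_comp _ _ (chart_map d) H0).
    exact: chart_map_smooth.
  by apply: filterS (open_nbhs_nbhs (conj B0o B0x)) => y; exact: sH.
Qed.

End ManifoldMaps.

Section Jacobians.
Context {R : realType}.

Lemma mulmx_jacobi m p (f : 'rV[R]_m -> 'rV[R]_p) x (v : 'rV[R]_m) :
  smooth_near f x -> v *m jacobi f x = 'd f x v.
Proof. by move=> /smooth_near_pt /(_ 1%N) sf; rewrite diff_jacobi. Qed.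

Lemma jacobi_comp m p q (f : 'rV[R]_m -> 'rV[R]_p) (g : 'rV[R]_p -> 'rV[R]_q) x :
  smooth_near f x -> smooth_near g (f x) ->
  jacobi (fun y => g (f y)) x = jacobi f x *m jacobi g (f x).
Proof.
move=> sf sg; apply/row_matrixP => i; rewrite !rowE mulmxA.
rewrite !mulmx_jacobi //; last exact: smooth_near_comp.
have df := smooth_pt_differentiable (smooth_near_pt sf).
have dg := smooth_pt_differentiable (smooth_near_pt sg).
by rewrite (diff_comp df dg).
Qed.

Lemma jacobi_linear m p (f : {linear 'rV[R]_m -> 'rV[R]_p}) x v :
  (forall y, smooth_near f y) -> v *m jacobi f x = f v.
Proof.
move=> sf; rewrite mulmx_jacobi // diff_lin // => y.
exact: smooth_near_continuous.
Qed.

Lemma jacobi_affine m p (A : 'M[R]_(m, p)) c x :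
  jacobi (fun v => c + v *m A) x = A.
Proof.
have sA y : smooth_near (fun v : 'rV[R]_m => v *m A) y by exact: smooth_near_mulmxr.
have sf : smooth_near (fun v => c + v *m A) x.
  by apply: smooth_nearD => //; exact: smooth_near_cst.
apply/row_matrixP => i; rewrite !rowE mulmx_jacobi //.
have dA : differentiable (mulmxr A : 'rV[R]_m -> 'rV[R]_p) x.
  exact: smooth_pt_differentiable (smooth_near_pt (sA x)).
have dL : 'D_(delta_mx 0 i) (mulmxr A : 'rV[R]_m -> 'rV[R]_p) x = delta_mx 0 i *m A.
  rewrite (deriveE _ dA) diff_lin // => y.
  exact: smooth_near_continuous.
rewrite -(deriveE _ (smooth_pt_differentiable (smooth_near_pt sf))).
have dA' : derivable (mulmxr A : 'rV[R]_m -> 'rV[R]_p) x (delta_mx 0 i) by exact: diff_derivable.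
have := deriveD (@derivable_cst R 'rV[R]_m 'rV[R]_p c x (delta_mx 0 i)) dA'.
by rewrite dL derive_cst add0r.
Qed.

Lemma jacobi_eq m p (f g : 'rV[R]_m -> 'rV[R]_p) x :
  (\forall y \near x, f y = g y) -> jacobi f x = jacobi g x.
Proof.
move=> fg; apply/matrixP => i j; rewrite !mxE; apply: near_eq_derive.
by apply: filterS fg => y ->.
Qed.

End Jacobians.

(** * Sections of the momentum map *)
Section SystemLocal.
Context {R : realType} {k n : nat} {M : topologicalType}.
Context {X : manifold R (k + n) M}.
Variable S : regular_system X.

Lemma momentum_smooth x : fun_smooth X (momentum S) x.
Proof.
have [_ [c [d [Xc -> cx _ [W [Wo Wx sW]]]]]] := (momentum_submersion S).1 x I.
apply: (fun_smoothP Xc cx); exact: Cinfty_smooth_near Wo Wx sW.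
Qed.

Lemma act_continuous2 T x :
  {for (T, x), continuous (fun w : 'rV[R]_n * M => act S w.1 w.2)}.
Proof. by have [] := act_smooth S (x := (T, x)) I. Qed.

Lemma curve_smooth_act p (h : 'rV[R]_p -> 'rV[R]_n) (g : 'rV[R]_p -> M) v :
  smooth_near h v -> curve_smooth X g v ->
  curve_smooth X (fun w => act S (h w) (g w)) v.
Proof.
move=> sh sg; have [cg sgd] := sg.
have [cont [c [d [[e -> [c1 Xc1 <-]] Xd [_ cx] dx [W [Wo Wx sW]]]]]] :=
  act_smooth S (x := (h v, g v)) I.
apply: (curve_smoothP _ Xd dx).
  apply: (@continuous2_cvg _ _ _ _ (nbhs v) _ _ _ (act S) _ _ cont _ cg).
  exact: smooth_near_continuous sh.
have sa := Cinfty_smooth_near Wo Wx sW.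
have := smooth_near_comp (smooth_near_row_mx sh (sgd c1 Xc1 cx)) sa.
apply: smooth_near_eq.
have nd : \forall w \near v, dom c1 (g w) by exact: (cg _ (near_dom Xc1 cx)).
apply: filterS nd => w dw.
by rewrite /in_charts /= row_mxKl row_mxKr (chart_mapK (atlas_chart Xc1) dw).
Qed.

Lemma actNK T x : act S (- T) (act S T x) = x.
Proof. by rewrite -actD addNr act0. Qed.

Lemma actC T T' x : act S T (act S T' x) = act S T' (act S T x).
Proof. by rewrite -!actD addrC. Qed.

Lemma isotropy_act T x : isotropy (act S) (act S T x) = isotropy (act S) x.
Proof.
apply/seteqP; split=> T' /=; rewrite /isotropy /= actC; last by move->.
by move=> /(congr1 (act S (- T))); rewrite !actNK.
Qed.

(** [A] is a one-sided inverse of the Jacobian of the momentum: along the affine slice [v0 + w *m A]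
    of a chart the momentum has the identity as Jacobian at 0, so the slice can be reparametrized by
    its momentum values. *)
Lemma local_section p : exists (B : set 'rV[R]_k) (sigma : 'rV[R]_k -> M),
  [/\ open B, B (momentum S p), sigma (momentum S p) = p &
   forall u, B u -> curve_smooth X sigma u /\ momentum S (sigma u) = u].
Proof.
have [c [d [Xc dE cx _]]] := (momentum_submersion S).2 p; rewrite {}dE {d}.
set f := in_charts _ _ _; set v0 := chart_map c p => rf.
have hc := atlas_chart Xc.
have sf : smooth_near f v0 by exact: (momentum_smooth Xc cx).
have [A HA] : exists A : 'M[R]_(k, k + n), A *m jacobi f v0 = 1%:M.
  have : forall i : 'I_k, exists v, 'd f v0 v = delta_mx 0 i.
    move=> i; have : range ('d f v0) (delta_mx 0 i) by rewrite rf.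
    by move=> [v _ vE]; exists v.
  move=> /choice[a Ha]; exists (\matrix_i a i).
  apply/row_matrixP => i.
  by rewrite row_mul rowK mulmx_jacobi // Ha row1.
pose aff (w : 'rV[R]_k) := v0 + w *m A.
have saff w : smooth_near aff w.
  by apply: smooth_nearD; [exact: smooth_near_cst|exact: smooth_near_mulmxr].
have aff0 : aff 0 = v0 by rewrite /aff mul0mx addr0.
have sfa : smooth_near (fun w => f (aff w)) 0.
  by apply: smooth_near_comp => //; rewrite aff0.
have uJ : jacobi (fun w => f (aff w)) 0 \in unitmx.
  by rewrite jacobi_comp // ?aff0 // jacobi_affine HA unitmx1.
have [A0 [B0 [H0 [A0o A00 B0o [AB BA sH]]]]] := inverse_function sfa uJ.
have f0 : f (aff 0) = momentum S p by rewrite aff0 /f /in_charts /= chart_mapK.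
pose W := [set w | img c (aff w)].
have Wo : open W.
  rewrite (_ : W = setT `&` aff @^-1` img c); last by rewrite setTI.
  apply: open_preimage_on => [||w _]; [exact: openT|exact: img_open|].
  exact: smooth_near_continuous.
exists (B0 `&` H0 @^-1` W), (fun u => chart_inv c (aff (H0 u))); split.
- by apply: open_preimage_on => // u /sH; exact: smooth_pt_continuous.
- have [B0p HF0] := AB 0 A00; rewrite -f0; split=> //=.
  by rewrite HF0 /W /= aff0; exact: chart_map_img.
- by have [B0p HF0] := AB 0 A00; rewrite -f0 HF0 aff0 chart_mapK.
- move=> u [B0u Wu]; split; last by have [_] := BA u B0u.
  apply: (@curve_smooth_comp _ _ _ X _ _ (fun u => aff (H0 u)) (chart_inv c)).
    apply: (@smooth_near_comp _ _ _ _ H0 aff) => //.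
    by apply: filterS (open_nbhs_nbhs (conj B0o B0u)) => y; exact: sH.
  exact: chart_inv_smooth.
Qed.

Lemma curve_smooth_orbit x (T : 'rV[R]_n) : curve_smooth X (fun T => act S T x) T.
Proof.
apply: (@curve_smooth_act _ id (fun=> x)); first exact: smooth_near_id.
split=> [|d _ _]; [exact: cst_continuous|exact: smooth_near_cst].
Qed.

(* By the flow property a vector killed by the differential of the orbit map
   at [0] is killed everywhere along its line, which is then stationary. *)
Lemma locally_free_jacobi x d (tau : 'rV[R]_n) : atlas X d -> dom d x ->
  tau *m jacobi (fun T => chart_map d (act S T x)) 0 = 0 -> tau = 0.
Proof.
move=> Xd dx tau0; have hd := atlas_chart Xd.
pose g T := chart_map d (act S T x).
have sg T : dom d (act S T x) -> smooth_near g T.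
  by move=> dT; have [_] := curve_smooth_orbit x T; apply.
have killed T : dom d (act S T x) -> tau *m jacobi g T = 0.
  move=> dT.
  (* Near [T] the orbit map factors through a neighbourhood of 0: translate by [- T], apply [g],
     then act by [T] in the chart. *)
  pose K w := chart_map d (act S T (chart_inv d w)).
  have sK : smooth_near K (g (T - T)).
    have dgx : img d (chart_map d x) by exact: chart_map_img.
    rewrite /g subrr act0.
    have [_] := @curve_smooth_act _ (fun=> T) (chart_inv d) _
      (smooth_near_cst T _) (chart_inv_smooth Xd dgx).
    by apply=> //; rewrite chart_mapK.
  have sT : smooth_near (fun T' => - T + T') T.
    by apply: smooth_nearD; [exact: smooth_near_cst|exact: smooth_near_id].
  have sgT : smooth_near (fun T' => g (- T + T')) T.
    apply: (@smooth_near_comp _ _ _ _ (fun T' => - T + T') g) => //.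
    by apply: sg; rewrite addNr act0.
  have -> : jacobi g T = jacobi (fun T' => K (g (- T + T'))) T.
    apply: jacobi_eq.
    have cT := smooth_near_continuous sT.
    have nd : \forall y \near - T + T, dom d (act S y x).
      have [cy _] := curve_smooth_orbit x (- T + T).
      by apply: (cy _ (near_dom Xd _)); rewrite addNr act0.
    have nd' : \forall T' \near T, dom d (act S (- T + T') x) by exact: (cT _ nd).
    apply: filterS nd' => T' dT'.
    by rewrite /K /g chart_mapK // -actD addrA subrr add0r.
  rewrite (jacobi_comp (f := fun T' => g (- T + T')) (g := K)) //; last by rewrite addrC.
  rewrite (jacobi_comp (f := fun T' => - T + T') (g := g)) //; last first.
    by apply: sg; rewrite addNr act0.
  have -> : jacobi (fun T' : 'rV[R]_n => - T + T') T = 1%:M.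
    rewrite -[RHS](jacobi_affine 1%:M (- T) T); apply: jacobi_eq.
    by apply: near_all => y; rewrite mulmx1.
  by rewrite mul1mx addNr mulmxA tau0 mul0mx.
have [e e0 He] : exists2 e : R, 0 < e &
    forall s, `|s| <= e -> dom d (act S (s *: tau) x).
  have [cy _] := curve_smooth_orbit x 0.
  have cs : (fun s : R => s *: tau) @ (0 : R) --> 0 *: tau.
    by apply: cvgZr_tmp; exact: cvg_id.
  rewrite scale0r in cs.
  have nd : \forall s \near (0 : R), dom d (act S (s *: tau) x).
    have d0 : dom d (act S 0 x) by rewrite act0.
    have nd0 : \forall T \near (0 : 'rV[R]_n), dom d (act S T x).
      exact: (cy _ (near_dom Xd d0)).
    exact: (cs _ nd0).
  have /nbhs_ballP[e /= e0 He] := nd.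
  exists (e / 2) => [|s se]; first exact: divr_gt0.
  by apply: He; rewrite -ball_normE /= sub0r normrN; lra.
have cst s : `|s| <= e -> act S (s *: tau) x = x.
  move=> se; have ds := He s se.
  rewrite -(chart_mapK hd ds) -[RHS](chart_mapK hd dx); congr chart_inv.
  apply/rowP => j; apply/eqP; rewrite -subr_eq0 -normr_le0.
  have := @MVT_dist R (fun s => g (0 + s *: tau) 0 j) 0 0 0 s.
  rewrite /g !mul0r subr0 scale0r !add0r act0; apply => t ts.
  have te : `|t| <= e.
    apply: le_trans se; move: ts; rewrite ge_min le_max ler_norml.
    have := ler_norm s; have := ler_normr s; have := ler_norm (- s); rewrite normrN; lra.
  have sgt := sg _ (He t te); rewrite -[t *: tau]add0r in sgt.
  have dt : derivable (fun T => g T 0 j) (0 + t *: tau) tau.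
    have /derivable_mxP := diff_derivable (v := tau)
      (smooth_pt_differentiable (smooth_near_pt sgt)); apply.
  have [d1 d2] := derivable_line dt; split => //; rewrite d2 subr0.
  suff D0 : 'D_tau (fun T => g T 0 j) (0 + t *: tau) = 0 by rewrite D0 normr0.
  have Hk := killed _ (He t te); rewrite -[t *: tau]add0r in Hk; move: Hk.
  rewrite mulmx_jacobi // -deriveE;
    last exact: smooth_pt_differentiable (smooth_near_pt sgt).
  rewrite derive_mx; last first.
    exact/diff_derivable/smooth_pt_differentiable/smooth_near_pt.
  move=> /matrixP /(_ 0 j); rewrite [in LHS]mxE [RHS]mxE => H.
  exact: H.
(* Small multiples of [tau] fix [x], while 0 is isolated in the isotropy group. *)
have [_ [V nV VE]] := act_locally_free (r := S) (x := x) (act0 S x).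
have nz : (fun s : R => s *: tau) @ (0 : R) --> 0 *: tau.
  by apply: cvgZr_tmp; exact: cvg_id.
rewrite scale0r in nz.
have ns : \forall s \near (0 : R), V (s *: tau) by exact: (nz _ nV).
have [r /= r0 Hr] := (nbhs_ballP _ _).1 ns.
pose s := Num.min e r / 2.
have s0 : 0 < s by rewrite divr_gt0 // lt_min e0 r0.
have me : Num.min e r <= e by rewrite ge_min lexx.
have mr : Num.min e r <= r by rewrite ge_min lexx orbT.
have se : `|s| <= e by rewrite gtr0_norm // /s; lra.
have : (V `&` isotropy (act S) x) (s *: tau).
  split; last exact: cst.
  by apply: Hr; rewrite -ball_normE /= sub0r normrN gtr0_norm // /s; lra.
rewrite VE => /eqP; rewrite scaler_eq0 gt_eqF //= => /eqP.
by [].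
Qed.

Definition flow_out (sigma : 'rV[R]_k -> M) (v : 'rV[R]_(k + n)) : M :=
  act S (rsubmx v) (sigma (lsubmx v)).

Definition is_section (B : set 'rV[R]_k) (sigma : 'rV[R]_k -> M) : Prop :=
  open B /\ forall u, B u -> curve_smooth X sigma u /\ momentum S (sigma u) = u.

Lemma momentum_flow_out B sigma v : is_section B sigma -> B (lsubmx v) ->
  momentum S (flow_out sigma v) = lsubmx v.
Proof. by move=> [_ sB] /sB[_ Fu]; rewrite /flow_out momentum_act. Qed.

Lemma curve_smooth_flow_out B sigma v : is_section B sigma -> B (lsubmx v) ->
  curve_smooth X (flow_out sigma) v.
Proof.
move=> [_ sB] Bv; apply: (@curve_smooth_act _ (fun v => rsubmx v)
    (fun v => sigma (lsubmx v))).
  exact/smooth_near_rsubmx/smooth_near_id.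
apply: (@curve_smooth_comp _ _ _ _ _ _ (fun v => lsubmx v) sigma).
  exact/smooth_near_lsubmx/smooth_near_id.
by have [] := sB _ Bv.
Qed.

(** A vector killed by the Jacobian has zero first part, because the momentum composed with
    [flow_out] is the projection to [B]; its second part is then killed by the differential of the
    orbit map, so it is 0 by local freeness. [v0] may lie far along the orbit; because of the
    periods the inverse is only local. *)
Lemma flow_out_etale B sigma v0 (P : 'rV[R]_(k + n) -> Prop) :
  is_section B sigma -> B (lsubmx v0) -> (\forall v \near v0, P v) ->
  exists (A : set 'rV[R]_(k + n)) (O : set M) (H : M -> 'rV[R]_(k + n)),
    [/\ open A, A v0, open O &
     [/\ forall v, A v -> O (flow_out sigma v) /\ H (flow_out sigma v) = v,
      forall x, O x -> A (H x) /\ flow_out sigma (H x) = x,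
      forall v, A v -> P v &
      forall x, O x -> fun_smooth X H x]].
Proof.
move=> sB Bv nP; have sg := curve_smooth_flow_out sB Bv.
set x := flow_out sigma v0 in sg *.
have [d Xd dx] := exists_chart X x.
apply: (inverse_function_chart nP sg Xd dx).
have hd := atlas_chart Xd.
pose g v := chart_map d (flow_out sigma v).
have sgd : smooth_near g v0 by have [_] := sg; exact.
have nd : \forall v \near v0, dom d (flow_out sigma v).
  by have [cg _] := sg; exact: (cg _ (near_dom Xd dx)).
rewrite -row_free_unit; apply/inj_row_free => w w0.
have lw : lsubmx w = 0.
  pose f w := momentum S (chart_inv d w).
  have sf : smooth_near f (g v0) by exact: (momentum_smooth Xd dx).
  have := jacobi_comp sgd sf.
  have -> : jacobi (fun y => f (g y)) v0 = jacobi (fun v : 'rV[R]_(k + n) => lsubmx v) v0.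
    apply: jacobi_eq.
    have nB : \forall v \near v0, B (lsubmx v).
      have cl : {for v0, continuous (fun v : 'rV[R]_(k + n) => lsubmx v)}.
        exact/smooth_near_continuous/smooth_near_lsubmx/smooth_near_id.
      exact: (cl _ (open_nbhs_nbhs (conj sB.1 Bv))).
    apply: filterS2 nd nB => v dv Bv'.
    by rewrite /f /g (chart_mapK hd dv) (momentum_flow_out sB).
  move=> /(congr1 (mulmx w)); rewrite mulmxA w0 mul0mx.
  rewrite (jacobi_linear (f := lsubmx)) // => y.
  exact/smooth_near_lsubmx/smooth_near_id.
have rw : rsubmx w = 0.
  apply: (locally_free_jacobi Xd dx).
  pose i (T : 'rV[R]_n) := v0 + T *m row_mx 0 1%:M.
  have si : smooth_near i 0.
    by apply: smooth_nearD; [exact: smooth_near_cst|exact: smooth_near_mulmxr].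
  have i0 : i 0 = v0 by rewrite /i mul0mx addr0.
  have -> : jacobi (fun T => chart_map d (act S T x)) 0 = jacobi (fun T => g (i T)) 0.
    apply: jacobi_eq; apply: near_all => T; rewrite /g /flow_out /i.
    rewrite mul_mx_row mulmx0 mulmx1 -[v0 in RHS]hsubmxK add_row_mx row_mxKl row_mxKr.
    by rewrite addr0 addrC actD.
  rewrite (jacobi_comp (f := i) (g := g)) ?i0 // jacobi_affine mulmxA.
  rewrite mul_mx_row mulmx0 mulmx1 -lw.
  by rewrite hsubmxK.
by rewrite -[w]hsubmxK lw rw row_mx0.
Qed.

End SystemLocal.

Section IntegerCombinations.
Context {R : realType} {n : nat}.
Variable L : set 'rV[R]_n.
Hypotheses (L0 : L 0) (LB : forall T T', L T -> L T' -> L (T - T')).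

Lemma sub_closedN T : L T -> L (- T).
Proof. by move=> LT; rewrite -sub0r; exact: LB. Qed.

Lemma sub_closedD T T' : L T -> L T' -> L (T + T').
Proof. by move=> LT LT'; rewrite -[T']opprK; apply: LB => //; exact: sub_closedN. Qed.

Lemma sub_closedMz T (z : int) : L T -> L (T *~ z).
Proof.
move=> LT; have LTn j : L (T *+ j).
  elim: j => [|j IH]; first by rewrite mulr0n.
  by rewrite mulrS; exact: sub_closedD.
by case: z => j; [exact: LTn|rewrite NegzE mulrNz; exact/sub_closedN/LTn].
Qed.

Lemma comb_sum m (E : 'M[R]_(m, n)) (s : 'rV[int]_m) :
  map_mx intr s *m E = \sum_i row i E *~ s 0 i.
Proof. by rewrite mulmx_sum_row; apply: eq_bigr => i _; rewrite mxE scaler_int. Qed.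

Lemma sub_closed_comb m (E : 'M[R]_(m, n)) (s : 'rV[int]_m) :
  (forall i, L (row i E)) -> L (map_mx intr s *m E).
Proof.
move=> LE; rewrite comb_sum; elim/big_ind: _ => [//|T T'|i _].
- exact: sub_closedD.
- exact: sub_closedMz.
Qed.

(** Additivity is asked on [L] only: [h] will be [rho1] at a point, which is meaningful on
    periods. *)
Variable h : 'rV[R]_n -> int.
Hypothesis hB : forall T T', L T -> L T' -> h (T - T') = h T - h T'.

Lemma hom0 : h 0 = 0.
Proof. by rewrite -(subrr (0 : 'rV[R]_n)) hB // subrr. Qed.

Lemma homD T T' : L T -> L T' -> h (T + T') = h T + h T'.
Proof.
move=> LT LT'; have LN := sub_closedN LT'.
by rewrite -[in LHS](opprK T') hB // -(sub0r T') hB // hom0 sub0r opprK.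
Qed.

Lemma homMz T (z : int) : L T -> h (T *~ z) = h T * z.
Proof.
move=> LT; have hn j : h (T *+ j) = h T * j%:Z.
  elim: j => [|j IH]; first by rewrite mulr0n hom0 mulr0.
  by rewrite mulrS homD // ?IH ?intS ?mulrDr ?mulr1 //; exact: (sub_closedMz j LT).
case: z => j; first exact: hn.
rewrite NegzE mulrNz -[- _]sub0r hB //; last exact: (sub_closedMz j.+1 LT).
by rewrite hom0 sub0r mulrN; congr (- _); exact: hn.
Qed.

Lemma hom_comb m (E : 'M[R]_(m, n)) (s : 'rV[int]_m) : (forall i, L (row i E)) ->
  h (map_mx intr s *m E) = \sum_i h (row i E) * s 0 i.
Proof.
move=> LE; rewrite comb_sum.
suff [] : L (\sum_i row i E *~ s 0 i) /\
    h (\sum_i row i E *~ s 0 i) = \sum_i h (row i E) * s 0 i by [].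
elim/big_rec2: _ => [|i y T _ [LT hT]]; first by split=> //; exact: hom0.
have Li := sub_closedMz (s 0 i) (LE i).
by split; [exact: sub_closedD|rewrite homD // hT homMz].
Qed.

End IntegerCombinations.

(** * Orbits and period lattices *)
Section OrbitSpace.
Context {R : realType} {k n : nat} {M : topologicalType}.
Context {X : manifold R (k + n) M}.
Variable S : regular_system X.
Local Notation q := (orbit_proj S).
Local Notation L := (isotropy (act S)).

Lemma orbit_projP x y : q x = q y <-> exists T, act S T x = y.
Proof.
split=> [/eqquotP /asboolP [T _ <-]|[T Tx]]; first by exists T.
by apply/eqquotP/asboolP; exists T.
Qed.

Lemma orbit_proj_act T x : q (act S T x) = q x.
Proof. by apply/esym/orbit_projP; exists T. Qed.

Lemma orbit_proj_continuous : continuous q.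
Proof. exact: pi_continuous. Qed.

Lemma momentum_bar_proj x : momentum_bar (q x) = momentum S x.
Proof.
have /orbit_projP[T Tx] : q (orbit_repr (q x)) = q x by exact: orbit_reprK.
by rewrite /momentum_bar -[in RHS]Tx momentum_act.
Qed.

Lemma momentum_continuous : continuous (momentum S).
Proof. by move=> x; exact: (fun_smooth_continuous (@momentum_smooth R k n M X S x)). Qed.

Lemma momentum_bar_continuous : continuous (@momentum_bar R k n M X S).
Proof.
apply/quotient_continuous; rewrite (_ : _ \o _ = momentum S).
  exact: momentum_continuous.
by apply/funext => x; exact: momentum_bar_proj.
Qed.

Lemma orbit_open (U : set (orbit_space S)) : open (q @^-1` U) -> open U.
Proof. by []. Qed.

Section SliceChart.
Variables (B : set 'rV[R]_k) (sigma : 'rV[R]_k -> M).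
Hypothesis sB : is_section S B sigma.

Definition slice_orbits : set (orbit_space S) := [set q (sigma u) | u in B].

(** The quotient topology asks for the saturation of the slice to be open, and [flow_out] is a local
    homeomorphism at every [(u, T)], whatever the size of [T]. *)
Lemma slice_orbits_open : open slice_orbits.
Proof.
apply: orbit_open; rewrite openE => x [u Bu /orbit_projP[T Tx]].
pose v0 : 'rV[R]_(k + n) := row_mx u T.
have B0 : B (lsubmx v0) by rewrite row_mxKl.
have nB : \forall v \near v0, B (lsubmx v).
  have cl : {for v0, continuous (fun v : 'rV[R]_(k + n) => lsubmx v)}.
    exact/smooth_near_continuous/smooth_near_lsubmx/smooth_near_id.
  exact: (cl _ (open_nbhs_nbhs (conj sB.1 B0))).
have [A [ O [H [Ao Av0 Oo [AO OA AB _]]]]] := flow_out_etale sB B0 nB.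
have Ox : O x by have [] := AO _ Av0; rewrite /flow_out row_mxKl row_mxKr Tx.
have nO : \forall y \near x, O y by exact: open_nbhs_nbhs.
apply: filterS nO => y Oy.
have [AH <-] := OA _ Oy; exists (lsubmx (H y)); first exact: AB.
by rewrite /flow_out orbit_proj_act.
Qed.

Definition slice_chart : chart R k (orbit_space S) :=
  Chart slice_orbits B (@momentum_bar R k n M X S) (fun u => q (sigma u)).

Lemma slice_chart_in : orbit_atlas S slice_chart.
Proof.
have [Bo sBu] := sB.
split; last by [].
split=> /=.
- exact: slice_orbits_open.
- exact: Bo.
- by move=> _ [u Bu <-]; rewrite momentum_bar_proj; have [_ ->] := sBu _ Bu.
- by move=> u Bu; exists u.
- by move=> _ [u Bu <-]; rewrite momentum_bar_proj; have [_ ->] := sBu _ Bu.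
- by move=> u Bu; rewrite momentum_bar_proj; have [_ ->] := sBu _ Bu.
- by move=> x _; exact: momentum_bar_continuous.
- move=> u Bu; apply: (@continuous_comp _ _ _ sigma q).
    by have [[]] := sBu _ Bu.
  exact: orbit_proj_continuous.
Qed.

End SliceChart.

Lemma isotropy0 x : L x 0.
Proof. exact: act0. Qed.

Lemma isotropyB x T T' : L x T -> L x T' -> L x (T - T').
Proof.
rewrite /isotropy /= => xT xT'.
by rewrite actD -[X in act S (- T') X]xT' actNK xT.
Qed.

Lemma isotropyD x T T' : L x T -> L x T' -> L x (T + T').
Proof. by apply: sub_closedD; [exact: isotropy0|exact: isotropyB]. Qed.

Lemma isotropy_comb m x (E : 'M[R]_(m, n)) (s : 'rV[int]_m) :
  (forall i, L x (row i E)) -> L x (map_mx intr s *m E).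
Proof. by apply: sub_closed_comb; [exact: isotropy0|exact: isotropyB]. Qed.

Lemma isotropy_discrete x : exists2 d : R, 0 < d &
  forall T, L x T -> `|T| < d -> T = 0.
Proof.
have [_ [V nV VE]] := act_locally_free (isotropy0 x).
have [d /= d0 Hd] := (nbhs_ballP _ _).1 nV.
exists d => // T xT Td; have : (V `&` L x) T.
  by split => //; apply: Hd; rewrite -ball_normE /= sub0r normrN.
by rewrite VE.
Qed.

Lemma hausdorff_near_neq (T : topologicalType) (f g : T -> M) (x : T) :
  {for x, continuous f} -> {for x, continuous g} -> f x <> g x ->
  \forall y \near x, f y <> g y.
Proof.
move=> cf cg fg; have := manifold_hausdorff X; rewrite open_hausdorff.
move=> /(_ (f x) (g x)) [|[U V] [/= Uf Vg] [Uo Vo /eqP UV]]; first exact/eqP.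
have nU := cf _ (open_nbhs_nbhs (conj Uo (set_mem Uf))).
have nV := cg _ (open_nbhs_nbhs (conj Vo (set_mem Vg))).
near=> y => fgy.
have Uy : U (f y) by near: y; exact: nU.
have Vy : V (g y) by near: y; exact: nV.
by have : set0 (f y); [rewrite -UV; split => //; rewrite fgy|].
Unshelve. all: by end_near. Qed.

End OrbitSpace.

Section Lattice.
Context {R : realType} {k n : nat} {M : topologicalType}.
Context {X : manifold R (k + n) M}.
Variable S : regular_system X.
Variables (B : set 'rV[R]_k) (sigma : 'rV[R]_k -> M).
Hypothesis sB : is_section S B sigma.
Local Notation L := (isotropy (act S)).

Lemma near_lsubmx (v0 : 'rV[R]_(k + n)) : B (lsubmx v0) ->
  \forall v \near v0, B (lsubmx v).
Proof.
move=> B0; have cl : {for v0, continuous (fun v : 'rV[R]_(k + n) => lsubmx v)}.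
  exact/smooth_near_continuous/smooth_near_lsubmx/smooth_near_id.
exact: (cl _ (open_nbhs_nbhs (conj sB.1 B0))).
Qed.

(** The continuation is the second component of the local inverse of [flow_out] at [(b, T0)],
    evaluated at [sigma u]; this makes sense because [T0] brings [sigma b] back to itself.
    Uniqueness on [N] holds because [flow_out] sends a period over [u] to [sigma u], where the
    inverse has a single value. *)
Lemma isotropy_continuation b T0 : B b -> L (sigma b) T0 ->
  exists (tau : 'rV[R]_k -> 'rV[R]_n) (B' : set 'rV[R]_k) (N : set 'rV[R]_(k + n)),
    [/\ tau b = T0, open B', B' b, open N &
     [/\ N (row_mx b T0),
      forall u, B' u -> B u /\ smooth_near tau u /\ L (sigma u) (tau u) &
      forall v, N v -> L (sigma (lsubmx v)) (rsubmx v) -> rsubmx v = tau (lsubmx v)]].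
Proof.
move=> Bb LT0; pose v0 : 'rV[R]_(k + n) := row_mx b T0.
have B0 : B (lsubmx v0) by rewrite row_mxKl.
have [A [ O [H [Ao Av0 Oo [AO OA AB sH]]]]] := flow_out_etale sB B0 (near_lsubmx B0).
have v0b : flow_out S sigma v0 = sigma b.
  by rewrite /flow_out row_mxKl row_mxKr; exact: LT0.
exists (fun u => rsubmx (H (sigma u))), (B `&` sigma @^-1` O), A.
have [ O0 H0] := AO _ Av0.
split=> //.
- by rewrite -v0b H0 row_mxKr.
- apply: open_preimage_on => //; first by have [] := sB.
  by move=> u /(proj2 sB)[[]].
- by split => //; rewrite /= -v0b.
split=> //.
  move=> u [Bu Ou]; split=> //; have [su Fu] := (proj2 sB) _ Bu.
  have [AH HE] := OA _ Ou; split.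
    apply: (smooth_near_rsubmx (f := fun u => H (sigma u))).
    by apply: (fun_curve_smooth su); exact: sH.
  have := momentum_flow_out sB (AB _ AH).
  by rewrite HE Fu => lb; have := HE; rewrite /flow_out -lb.
move=> v Av Lv; have [ Ov HE] := AO _ Av.
by rewrite -[LHS](congr1 rsubmx HE) /flow_out Lv.
Qed.

(** Around each point of the orbit the flow coordinates are bounded, and at points of the orbit
    itself their first part is [b], the momentum being constant on orbits. Compactness leaves one
    bound for all. *)
Lemma orbit_bounded b : B b -> exists2 r : R, 0 < r &
  forall T, exists2 T', `|T'| < r & act S T' (sigma b) = act S T (sigma b).
Proof.
move=> Bb; pose x := sigma b.
have /compact_near_coveringP : compact (orbit_of (act S) x) by exact: orbit_compact.
pose P (j : nat) y := orbit_of (act S) x y ->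
  exists2 T', `|T'| < j%:R & act S T' x = y.
move=> /(_ nat \oo P _) H.
have {}H : \forall j \near \oo, orbit_of (act S) x `<=` P j.
  apply: H => y [T0 _ T0y].
  pose v0 : 'rV[R]_(k + n) := row_mx b T0.
  have B0 : B (lsubmx v0) by rewrite row_mxKl.
  have [A [ O [H [Ao Av0 Oo [AO OA AB sH]]]]] := flow_out_etale sB B0 (near_lsubmx B0).
  have v0y : flow_out S sigma v0 = y by rewrite /flow_out row_mxKl row_mxKr.
  have Oy : O y by rewrite -v0y; have [] := AO _ Av0.
  have cH : {for y, continuous (fun y => `|H y|)}.
    apply: (continuous_norm_comp (f := H)).
    exact: fun_smooth_continuous (sH _ Oy).
  have nH : \forall z \near y, `|H z| < `|H y| + 1.
    by apply: (cvgr_lt _ cH); rewrite ltrDl.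
  have nO : \forall z \near y, O z by exact: open_nbhs_nbhs.
  near=> z j => oz /=.
  have Oz : O z by near: z.
  have [AH HE] := OA _ Oz.
  exists (rsubmx (H z)).
    have : `|H z| < `|H y| + 1 by near: z.
    have : `|H y| + 1 <= j%:R by near: j; exact: nbhs_infty_ger.
    move=> h1 h2; apply: le_lt_trans (lt_le_trans h2 h1).
    apply: row_norm_le => // i; rewrite mxE; exact: coord_le_norm.
  have [T _ /= Tz] := oz.
  have lb : lsubmx (H z) = b.
    have [_ Fb] := (proj2 sB) _ Bb.
    by rewrite -(momentum_flow_out sB (AB _ AH)) HE -Tz momentum_act.
  by rewrite -[RHS]HE /flow_out lb.
have [N _ HN] := H.
exists (N.+1)%:R; first by rewrite ltr0n.
move=> T; apply: (HN N.+1 (leqnSn N) (act S T x)).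
all: by exists T.
Unshelve. all: by end_near. Qed.

(** The point reached by [N] times a basis vector is also reached by a short vector [T' i], of norm
    below [r], and the difference of the two is a period. Since [N > n * r], the matrix of
    differences is a multiple of the identity plus a smaller perturbation, hence invertible. *)
Lemma isotropy_independent b : B b ->
  exists f : 'M[R]_n, f \in unitmx /\ forall i, L (sigma b) (row i f).
Proof.
move=> Bb; have [r r0 Hr] := orbit_bounded Bb.
pose N := (Num.truncn (n%:R * r)).+1.
have Nn : n%:R * r < N%:R by rewrite /N truncnS_gt.
have : forall i : 'I_n, exists T, `|T| < r /\
    act S T (sigma b) = act S (N%:R *: delta_mx 0 i) (sigma b).
  by move=> i; have [T ? ?] := Hr (N%:R *: delta_mx 0 i); exists T.
move=> /choice[T' HT'].
exists (N%:R *: 1%:M - \matrix_i T' i); split; last first.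
  move=> i; rewrite linearB linearZ /= row1 rowK; have [_ E] := HT' i.
  by rewrite /isotropy /= addrC actD -E actNK.
rewrite -row_free_unit; apply/inj_row_free => v /eqP.
rewrite mulmxBr subr_eq0 -scalemxAr mulmx1 => /eqP vE.
apply/eqP; rewrite -normr_le0 leNgt; apply/negP => v0.
have : `|N%:R *: v| <= n%:R * r * `|v|.
  apply: row_norm_le => [|j]; first by rewrite !mulr_ge0 // ltW.
  rewrite vE mxE; apply: le_trans (ler_norm_sum _ _ _) _.
  have -> : n%:R * r * `|v| = \sum_(i < n) r * `|v|.
    by rewrite sumr_const card_ord -mulrA mulr_natl.
  apply: ler_sum => i _; rewrite normrM mulrC ler_pM //; last exact: coord_le_norm.
  rewrite mxE; apply: le_trans (coord_le_norm _ _) _.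
  by have [/ltW] := HT' i.
by rewrite normrZ ler_pM2r // normr_nat leNgt Nn.
Qed.

End Lattice.

Section Frames.
Context {R : realType} {k n : nat} {M : topologicalType}.
Context {X : manifold R (k + n) M}.
Variable S : regular_system X.
Variables (B : set 'rV[R]_k) (sigma : 'rV[R]_k -> M).
Hypothesis sB : is_section S B sigma.
Local Notation L := (isotropy (act S)).

(** Independence is over R: the rows need not generate all the periods of [sigma u]. *)
Definition isotropy_frame (B' : set 'rV[R]_k) (E : 'rV[R]_k -> 'M[R]_n) : Prop :=
  open B' /\ forall u, B' u -> [/\ B u, E u \in unitmx &
    forall i, smooth_near (fun u => row i (E u)) u /\ L (sigma u) (row i (E u))].

Lemma frame_continuation b (f : 'M[R]_n) : B b -> f \in unitmx ->
  (forall i, L (sigma b) (row i f)) ->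
  exists B' E, [/\ isotropy_frame B' E, B' b & E b = f].
Proof.
move=> Bb uf Lf.
have : forall i, exists tau : 'rV[R]_k -> 'rV[R]_n, tau b = row i f /\
    \forall u \near b, B u /\ smooth_near tau u /\ L (sigma u) (tau u).
  move=> i; have [tau [B' [N [tb B'o B'b _ [_ HB' _]]]]] :=
    isotropy_continuation sB Bb (Lf i).
  exists tau; split=> //.
  by apply: filterS (open_nbhs_nbhs (conj B'o B'b)) => u; exact: HB'.
move=> /choice[tau Htau]; pose E u := \matrix_i tau i u.
have Eb : E b = f.
  by apply/row_matrixP => i; rewrite rowK; have [] := Htau i.
have rE u i : row i (E u) = tau i u by rewrite rowK.
have n1 : \forall u \near b, forall i, smooth_near (fun u => row i (E u)) u /\
    L (sigma u) (row i (E u)).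
  apply: near_ord => i; have [_] := Htau i; apply: filterS => u [_ [sm Lu]].
  rewrite rE; split=> //; apply: smooth_near_eq sm.
  by apply: near_all => y; rewrite rE.
have n2 : \forall u \near b, E u \in unitmx.
  have uEb : E b \in unitmx by rewrite Eb.
  have sEb i : smooth_near (fun u => row i (E u)) b by have [] := nbhs_singleton n1 i.
  by have [] := smooth_near_invmx uEb sEb.
have n3 : \forall u \near b, B u by exact: open_nbhs_nbhs (conj sB.1 Bb).
have n4 : \forall u \near b, [/\ B u, E u \in unitmx &
    forall i, smooth_near (fun u => row i (E u)) u /\ L (sigma u) (row i (E u))].
  by near=> u; split; near: u.
have [W [Wo Wb HW]] := near_open n4.
by exists W, E.
Unshelve. all: by end_near. Qed.

(** The period comes first in the pair of filters, to fit [compact_near_coveringP]. *)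
Lemma near_row_mx (b : 'rV[R]_k) (T : 'rV[R]_n) (P : 'rV[R]_(k + n) -> Prop) :
  (\forall v \near row_mx b T, P v) ->
  \forall T' \near T & u \near b, P (row_mx u T').
Proof.
move=> nP.
have cr : {for (T, b), continuous (fun z : 'rV[R]_n * 'rV[R]_k => row_mx z.2 z.1)}.
  apply: row_continuous => j; case: (fintype.splitP j) => i ij.
    have -> : j = lshift n i by exact/val_inj.
    rewrite (_ : (fun _ => _) = (fun z : 'rV[R]_n * 'rV[R]_k => z.2 0 i)).
      apply: (@continuous_comp _ _ _ snd (fun v : 'rV[R]_k => v 0 i)).
        exact: cvg_snd.
      exact: coord_continuous.
    by apply/funext => z; rewrite row_mxEl.
  have -> : j = rshift k i by exact/val_inj.
  rewrite (_ : (fun _ => _) = (fun z : 'rV[R]_n * 'rV[R]_k => z.1 0 i)).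
    apply: (@continuous_comp _ _ _ fst (fun v : 'rV[R]_n => v 0 i)).
      exact: cvg_fst.
    exact: coord_continuous.
  by apply/funext => z; rewrite row_mxEr.
exact: (cr _ nP).
Qed.

(* Modulo the frame every period of [sigma u] may be taken in a fixed ball;
   the periods in it accumulate only at periods of [sigma b], since [M] is
   Hausdorff. *)
Lemma isotropy_near_reduction B' E b (Q : 'rV[R]_n -> 'rV[R]_k -> Prop) :
  isotropy_frame B' E -> B' b ->
  (forall T0, L (sigma b) T0 -> \forall v \near row_mx b T0,
     L (sigma (lsubmx v)) (rsubmx v) -> Q (rsubmx v) (lsubmx v)) ->
  \forall u \near b, forall T, L (sigma u) T ->
    exists s : 'rV[int]_n, Q (T - map_mx intr s *m E u) u.
Proof.
move=> [B'o HE] B'b HQ; have [Bb _ Eb] := HE b B'b.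
(* A combination of the rows with coefficients in [[0, 1[] is no longer than the sum of the row
   norms; the summands 1 allow for [E u] in place of [E b]. *)
pose C := \sum_i (`|row i (E b)| + 1).
pose K : set 'rV[R]_n := [set T | `|T| <= C].
have cK : compact K.
  apply: bounded_closed_compact.
    by exists C; split; [exact: num_real|move=> r Cr T KT; exact: le_trans KT (ltW Cr)].
  rewrite (_ : K = closed_ball_ Num.norm 0 C); first exact: closed_closed_ball_.
  by apply/seteqP; split=> T; rewrite /K /closed_ball_ /= sub0r normrN.
have nK : \forall u \near b, K `<=` (fun T => L (sigma u) T -> Q T u).
  apply: ((compact_near_coveringP K).1 cK _ (nbhs b)) => T _.
  pose v0 : 'rV[R]_(k + n) := row_mx b T.
  suff nv : \forall v \near v0, L (sigma (lsubmx v)) (rsubmx v) -> Q (rsubmx v) (lsubmx v).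
    by apply: filterS (near_row_mx nv) => z; rewrite row_mxKl row_mxKr.
  have [LT|nLT] := pselect (L (sigma b) T); first exact: HQ.
  have B0 : B (lsubmx v0) by rewrite row_mxKl.
  have [cf _] := curve_smooth_flow_out sB B0.
  have cs : {for v0, continuous (fun v : 'rV[R]_(k + n) => sigma (lsubmx v))}.
    apply: (@continuous_comp _ _ _ (fun v : 'rV[R]_(k + n) => lsubmx v) sigma).
      exact/smooth_near_continuous/smooth_near_lsubmx/smooth_near_id.
    by have [[]] := (proj2 sB) _ B0.
  have := hausdorff_near_neq (X := X) cf cs.
  rewrite /flow_out row_mxKl row_mxKr => /(_ nLT).
  by apply: filterS => v nv Lv; case: nv.

have nC : \forall u \near b, \sum_i `|row i (E u)| <= C.
  have : \forall u \near b, forall i, `|row i (E u)| <= `|row i (E b)| + 1.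
    apply: near_ord => i; have [sE _] := Eb i.
    have cE : {for b, continuous (fun u => `|row i (E u)|)}.
      exact/continuous_norm_comp/smooth_near_continuous.
    by apply: (cvgr_le _ cE); rewrite ltrDl.
  by apply: filterS => u Hu; exact: ler_sum.
have nB' : \forall u \near b, B' u by exact: open_nbhs_nbhs (conj B'o B'b).
near=> u => T LT.
have [Bu uE Eu] : [/\ B u, E u \in unitmx & forall i,
    smooth_near (fun u => row i (E u)) u /\ L (sigma u) (row i (E u))].
  by apply: HE; near: u.
pose c := T *m invmx (E u); pose s : 'rV[int]_n := \row_i Num.floor (c 0 i).
exists s; have sC : \sum_i `|row i (E u)| <= C by near: u.
have Ls : L (sigma u) (T - map_mx intr s *m E u).
  by apply: isotropyB => //; apply: isotropy_comb => i; have [] := Eu i.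
have HK : K `<=` (fun T => L (sigma u) T -> Q T u) by near: u.
apply: HK => //; rewrite /K /=.
have -> : T - map_mx intr s *m E u = \sum_i (c 0 i - (Num.floor (c 0 i))%:~R) *: row i (E u).
  rewrite -[T](mulmxKV uE) -/c -mulmxBl mulmx_sum_row; apply: eq_bigr => i _.
  by rewrite !mxE.
apply: le_trans (ler_norm_sum _ _ _) _; apply: le_trans sC.
apply: ler_sum => i _; rewrite normrZ ler_piMl //.
have /andP[h1 h2] := Num.Theory.floor_itv (c 0 i).
rewrite ger0_norm; first by rewrite lerBlDr; apply/ltW; move: h2; rewrite intrD addrC.
by rewrite subr_ge0.
Unshelve. all: by end_near. Qed.

(** Together with [isotropy_near_reduction] this shows that a frame which is a basis of the periods
    at [b] remains a basis nearby. *)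
Lemma isotropy_comb_unique b E B' (s : 'rV[int]_n) T0 :
  isotropy_frame B' E -> B' b -> T0 = map_mx intr s *m E b ->
  \forall v \near row_mx b T0, L (sigma (lsubmx v)) (rsubmx v) ->
    rsubmx v = map_mx intr s *m E (lsubmx v).
Proof.
move=> [B'o HE] B'b T0E; have [Bb _ Eb] := HE b B'b.
have LT0 : L (sigma b) T0.
  by rewrite T0E; apply: isotropy_comb => i; have [] := Eb i.
have [tau [B'' [N [tb B''o B''b No [N0 HB'' HN]]]]] := isotropy_continuation sB Bb LT0.
have sc : smooth_near (fun u => map_mx intr s *m E u) b.
  by apply: smooth_near_mulmx => [|i]; [exact: smooth_near_cst|have [] := Eb i].
(* The combination of the frame is itself a continuous family of periods, so
   it stays in the neighbourhood where the continuation is unique. *)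
have nc : \forall u \near b, tau u = map_mx intr s *m E u.
  have sr : smooth_near (fun u => row_mx u (map_mx intr s *m E u)) b.
    by apply: smooth_near_row_mx => //; exact: smooth_near_id.
  have cr := smooth_near_continuous sr.
  have nN : \forall u \near b, N (row_mx u (map_mx intr s *m E u)).
    by apply: (cr _ _); apply: open_nbhs_nbhs; split=> //; rewrite -T0E.
  have nB' : \forall u \near b, B' u by exact: open_nbhs_nbhs (conj B'o B'b).
  apply: filterS2 nN nB' => u Nu B'u.
  have [_ _ Eu] := HE _ B'u.
  have := HN _ Nu; rewrite row_mxKl row_mxKr => -> //.
  by apply: isotropy_comb => i; have [] := Eu i.
have cl : {for row_mx b T0, continuous (fun v : 'rV[R]_(k + n) => lsubmx v)}.
  exact/smooth_near_continuous/smooth_near_lsubmx/smooth_near_id.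
have nl : \forall v \near row_mx b T0, tau (lsubmx v) = map_mx intr s *m E (lsubmx v).
  have nc' : \forall u \near lsubmx (row_mx b T0), tau u = map_mx intr s *m E u.
    by rewrite row_mxKl.
  exact: (cl _ nc').
have nN : \forall v \near row_mx b T0, N v by exact: open_nbhs_nbhs.
by apply: filterS2 nl nN => v <- Nv Lv; exact: HN.
Qed.

End Frames.

(** * Bases of a discrete subgroup adapted to a homomorphism *)

Section ReplaceRow.
Context {F : fieldType} {n : nat}.

Definition set_row (E : 'M[F]_n) (i0 : 'I_n) (w : 'rV[F]_n) : 'M[F]_n :=
  \matrix_i (if i == i0 then w else row i E).

Lemma row_set_row E i0 w i :
  row i (set_row E i0 w) = if i == i0 then w else row i E.
Proof. by rewrite rowK. Qed.

Lemma det_set_row1 i0 c : \det (set_row 1%:M i0 c) = c 0 i0.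
Proof.
rewrite (expand_det_row _ i0).
have cE j : cofactor (set_row 1%:M i0 c) i0 j = (\adj (1%:M : 'M[F]_n)) j i0.
  rewrite mxE /cofactor; congr (_ * \det _).
  apply/matrixP => i l; rewrite !mxE.
  by rewrite (negbTE (_ : fintype.lift i0 i != i0)) ?mxE // eq_sym neq_lift.
have adj1 : \adj (1%:M : 'M[F]_n) = 1%:M.
  by rewrite -[LHS]mul1mx mul_mx_adj det1.
rewrite (bigD1 i0) //= big1 => [|j ji]; rewrite cE adj1 !mxE.
  by rewrite !eqxx addr0 mulr1.
by rewrite (negbTE ji) mulr0.
Qed.

(** Left multiplication by [set_row 1%:M i0 c] performs the replacement. A row replaced by a vector
    whose coordinate along it is fractional thus shrinks the determinant. *)
Lemma det_set_row E i0 c : \det (set_row E i0 (c *m E)) = c 0 i0 * \det E.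
Proof.
rewrite -(det_set_row1 i0 c) -det_mulmx; congr (\det _).
apply/row_matrixP => i; rewrite row_mul !row_set_row.
by case: eqP => // _; rewrite row1 -rowE.
Qed.

End ReplaceRow.

Lemma mulmx_inj (F : fieldType) m n (A : 'M[F]_n) : A \in unitmx ->
  injective (fun v : 'M[F]_(m, n) => v *m A).
Proof. by move=> uA v w vw; rewrite -[v](mulmxK uA) vw mulmxK. Qed.

Section AdaptedBasis.
Context {R : realType} {n : nat}.
Variable L : set 'rV[R]_n.
Hypotheses (L0 : L 0) (LB : forall T T', L T -> L T' -> L (T - T')).
Variables (d : R) (d_gt0 : 0 < d).
Hypothesis discreteL : forall T, L T -> `|T| < d -> T = 0.

(* Pigeonhole: among [q ^ n + 1] multiples of [T], two have coordinates whose
   fractional parts differ by less than [1 / q]. *)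
Lemma common_denominator (f : 'M[R]_n) : f \in unitmx ->
  (forall i, L (row i f)) ->
  exists2 N : nat, (0 < N)%N & forall T, L T ->
    exists s : 'rV[int]_n, T *+ N = map_mx intr s *m f.
Proof.
move=> uf Lf; have [C C0 HC] := mulmx_norm_le f.
(* A combination of the rows of [f] with coefficients at most [1 / q] is then shorter than [d], so
   it vanishes if it is in [L]. *)
pose q := (Num.truncn (C / d)).+1.
have qC : C / d < q%:R by rewrite /q truncnS_gt.
have q0 : 0 < q%:R :> R by rewrite ltr0n.
(* The multiplier [j2 - j1] found below depends on [T], but it is at most [q ^ n] and so divides
   this factorial. *)
exists (q ^ n)`!%N; first exact: fact_gt0.
move=> T LT; have [c TE] : exists c, T = c *m f by exists (T *m invmx f); rewrite mulmxKV.
pose fr (j : nat) (i : 'I_n) : R := j%:R * c 0 i - (Num.floor (j%:R * c 0 i))%:~R.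
have fr0 j i : 0 <= fr j i by rewrite /fr subr_ge0 floor_le_tmp.
have fr1 j i : fr j i < 1.
  by have /andP[_] := floor_itv (j%:R * c 0 i); rewrite intrD /fr; lra.
pose cell (j : 'I_(q ^ n).+1) : {ffun 'I_n -> 'I_q} :=
  [ffun i => inord (Num.truncn (q%:R * fr j i))].
have [j1 [j2 [j12 cE]]] : exists j1 j2 : 'I_(q ^ n).+1, (j1 < j2)%N /\ cell j1 = cell j2.
  have : ~~ injectiveb cell.
    apply/injectiveP => /leq_card; by rewrite card_ffun !card_ord ltnn.
  move=> /injectivePn[j1 [j2 j12 cE]].
  by case: (ltngtP j1 j2) => [?|?|/val_inj e]; [exists j1, j2|exists j2, j1|rewrite e eqxx in j12].
have close i : `|fr j2 i - fr j1 i| < q%:R^-1.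
  move/ffunP : cE => /(_ i); rewrite !ffunE => /(congr1 val) /=.
  have lt j : (Num.truncn (q%:R * fr j i) < q)%N.
    rewrite truncn_lt_nat ?mulr_ge0 // ?ltW //.
    by rewrite gtr_pMr.
  rewrite !inordK // => e.
  have h1 := truncn_itv (mulr_ge0 (ltW q0) (fr0 j1 i)).
  have h2 := truncn_itv (mulr_ge0 (ltW q0) (fr0 j2 i)).
  rewrite e in h1; move: h1 h2 => /andP[a1 a2] /andP[b1 b2].
  rewrite -[q%:R^-1]mul1r ltr_pdivlMr // mulrC -[q%:R]gtr0_norm // -normrM mulrBr.
  rewrite ltr_norml; move: a2 b2.
  by rewrite -[(Num.truncn _).+1%:R]natr1; lra.
pose s : 'rV[int]_n := \row_i (Num.floor (j2%:R * c 0 i) - Num.floor (j1%:R * c 0 i)).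
have DE : T *+ (j2 - j1) - map_mx intr s *m f = (\row_i (fr j2 i - fr j1 i)) *m f.
  rewrite TE -scaler_nat scalemxAl -mulmxBl; congr (_ *m _); apply/rowP => i.
  by rewrite !mxE natrB ?(ltnW j12) // intrB /fr; ring.
have D0 : T *+ (j2 - j1) - map_mx intr s *m f = 0.
  apply: discreteL.
    apply: LB; last exact: sub_closed_comb.
    exact: (sub_closedMz L0 LB (j2 - j1)%N LT).
  rewrite DE; apply: le_lt_trans (HC _) _.
  have : `|\row_i (fr j2 i - fr j1 i)| <= q%:R^-1.
    apply: row_norm_le => [|i]; first by rewrite invr_ge0 ltW.
    by rewrite mxE ltW.
  move=> h; apply: le_lt_trans (ler_wpM2l (ltW C0) h) _.
  by rewrite ltr_pdivrMr // mulrC -ltr_pdivrMr.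
have jd : (j2 - j1 %| (q ^ n)`!)%N.
  apply: dvdn_fact; rewrite subn_gt0 j12 /=.
  by apply: leq_trans (leq_subr _ _) _; rewrite -ltnS.
clearbody s; pose m := ((q ^ n)`! %/ (j2 - j1))%N; exists (s *+ m).
have -> : (q ^ n)`!%N = ((j2 - j1) * m)%N by rewrite mulnC divnK.
move/eqP : D0; rewrite mulrnA subr_eq0 => /eqP ->.
rewrite -scaler_nat scalemxAl; congr (_ *m _); apply/rowP => i.
by rewrite !mxE mulmxnE rmorphMn mulr_natl.
Qed.

(** Descent on a natural number: with [N] a common denominator relative to [E0], [|det E| * N ^ n]
    is a natural multiple of [|det E0|], so the determinant cannot decrease for ever. [P] is left
    open so that the reduction step may preserve further conditions on the frame. *)
Lemma min_det (P : 'M[R]_n -> Prop) E0 : P E0 ->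
  (forall E, P E -> E \in unitmx /\ forall i, L (row i E)) ->
  (forall E T, P E -> L T -> (exists s : 'rV[int]_n, T = map_mx intr s *m E) \/
     exists E', P E' /\ `|\det E'| < `|\det E|) ->
  exists E, P E /\ forall T, L T -> exists s : 'rV[int]_n, T = map_mx intr s *m E.
Proof.
move=> P0 HP Hred; have [u0 LE0] := HP _ P0.
have [N N0 HN] := common_denominator u0 LE0.
have D0 : 0 < `|\det E0| by rewrite normr_gt0 -unitfE -unitmxE.
have measure E : P E -> exists m : nat, `|\det E| *+ (N ^ n) = `|\det E0| *+ m.
  move=> /HP[_ LE].
  have : forall i, exists s : 'rV[int]_n, row i E *+ N = map_mx intr s *m E0.
    by move=> i; exact: HN.
  move=> /choice[s Hs].
  have EA : E *+ N = map_mx intr (\matrix_i s i) *m E0.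
    apply/row_matrixP => i; rewrite linearMn /= Hs row_mul; congr (_ *m _).
    by rewrite -map_row rowK.
  exists `|\det (\matrix_i s i)|%N.
  have := congr1 (fun A => `|\det A|) EA.
  rewrite det_mulmx -scaler_nat detZ !normrM det_map_mx /=.
  rewrite -natrX normr_nat mulr_natl => ->.
  by rewrite -[RHS]mulr_natr natr_absz intr_norm mulrC.
suff main m E : P E -> `|\det E| *+ (N ^ n) <= `|\det E0| *+ m ->
    exists E, P E /\ forall T, L T -> exists s : 'rV[int]_n, T = map_mx intr s *m E.
  by have [m mE] := measure _ P0; apply: (main m E0) => //; rewrite mE.
elim: m E => [|m IH] E PE Em.
  have [uE _] := HP _ PE.
  move: Em; rewrite mulr0n pmulrn_lle0 ?expn_gt0 ?N0 // normr_le0.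
  by rewrite unitmxE unitfE in uE; rewrite (negbTE uE).
have [good|bad] := pselect (forall T, L T -> exists s : 'rV[int]_n, T = map_mx intr s *m E).
  by exists E.
move/existsNP : bad => [T /not_implyP[LT nT]].
have [//|[E' [PE' lt]]] := Hred _ _ PE LT.
apply: (IH E') => //; have [m' m'E] := measure _ PE'.
have : `|\det E'| *+ (N ^ n) < `|\det E| *+ (N ^ n).
  by rewrite ltr_pMn2r // expn_gt0 N0.
move=> /lt_le_trans /(_ Em); rewrite m'E => h.
by apply: ler_wpMn2l; [exact: ltW|rewrite -ltnS -(ltr_pMn2l D0)].
Qed.

Variable h : 'rV[R]_n -> int.
Hypothesis hB : forall T T', L T -> L T' -> h (T - T') = h T - h T'.

Theorem adapted_basis (f : 'M[R]_n) T0 (t : 'I_n) : f \in unitmx ->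
  (forall i, L (row i f)) -> L T0 -> h T0 = 1 ->
  exists E : 'M[R]_n, [/\ E \in unitmx, forall i, L (row i E),
    forall i, h (row i E) = (i == t)%:R &
    forall T, L T -> exists s : 'rV[int]_n, T = map_mx intr s *m E].
Proof.
move=> uf Lf LT0 hT0.
pose P (E : 'M[R]_n) := [/\ E \in unitmx, forall i, L (row i E) &
  forall i, h (row i E) = (i == t)%:R].
suff [E0 PE0] : exists E0, P E0.
  have HP E : P E -> E \in unitmx /\ forall i, L (row i E) by case.
  have [E T [uE LE hE] LT|E [[uE LE hE] HE]] := min_det PE0 HP; last by exists E.
  (* Subtracting a multiple of row [t] brings [T] to value 0, after which row [t] can be kept. *)
  pose T' := T - row t E *~ h T.
  have LtE : L (row t E *~ h T) by exact: sub_closedMz.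
  have LT' : L T' by exact: LB.
  have hT' : h T' = 0.
    by rewrite /T' hB // (homMz L0 LB hB) // hE eqxx mul1r subrr.
  have [c cE] : exists c, T' = c *m E by exists (T' *m invmx E); rewrite mulmxKV.
  (* [T'] need not be an integer combination of the rows of [E], but a multiple of it is, and [h] of
     that multiple is its coefficient on row [t]. *)
  have ct : c 0 t = 0.
    have [N N0 HN] := common_denominator uE LE.
    have [s sE] := HN _ LT'.
    have st : s 0 t = 0.
      have := congr1 h sE; rewrite -[T' *+ N]/(T' *~ N%:Z) (homMz L0 LB hB) // hT' mul0r.
      rewrite (hom_comb L0 LB hB) // (bigD1 t) //= hE eqxx mul1r big1 ?addr0 // => i it.
      by rewrite hE (negbTE it) mul0r.
    move: sE; rewrite cE -scaler_nat scalemxAl => /(mulmx_inj uE) /rowP /(_ t).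
    by rewrite !mxE st => /eqP; rewrite mulf_eq0 pnatr_eq0 -leqn0 leqNgt N0 => /eqP.
  pose s : 'rV[int]_n := \row_i Num.floor (c 0 i).
  pose w := T' - map_mx intr s *m E.
  have wE : w = (c - map_mx intr s) *m E by rewrite /w cE mulmxBl.
  have Lw : L w by apply: LB => //; exact: sub_closed_comb.
  have st : s 0 t = 0 by rewrite mxE ct floor0.
  have [w0|w0] := eqVneq (c - map_mx intr s) 0.
    left; exists (s + h T *: delta_mx 0 t).
    rewrite map_mxD mulmxDl map_mxZ map_delta_mx -scalemxAl -rowE.
    have /eqP := wE; rewrite w0 mul0mx subr_eq0 => /eqP <-.
    by rewrite /T' scaler_int subrK.
  have [i0 ci0] : exists i0, (c - map_mx intr s) 0 i0 != 0.
    by move/rV0Pn : w0.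
  (* The replaced row is not row [t], on which [w] has coefficient 0, so the values of [h] survive;
     the determinant is multiplied by a fractional part in []0, 1[]. *)
  right; exists (set_row E i0 w).
  have fE : (c - map_mx intr s) 0 i0 = c 0 i0 - (Num.floor (c 0 i0))%:~R by rewrite !mxE.
  have /andP[f1 f2] := floor_itv (c 0 i0).
  have detE : \det (set_row E i0 w) = (c - map_mx intr s) 0 i0 * \det E.
    by rewrite wE det_set_row.
  have D0 : \det E != 0 by rewrite -unitfE -unitmxE.
  split; last first.
    rewrite detE normrM gtr_pMl ?normr_gt0 // fE ger0_norm ?subr_ge0 //.
    by move: f2; rewrite intrD; lra.
  split.
  - by rewrite unitmxE unitfE detE mulf_neq0.
  - by move=> i; rewrite row_set_row; case: eqP.
  move=> i; rewrite row_set_row; have [->|//] := eqVneq i i0.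
  have i0t : i0 != t.
    by apply: contraNneq ci0 => ->; rewrite !mxE ct -[Num.floor _]/(Num.floor 0) floor0 subr0.
  rewrite (negbTE i0t) /w hB //; last exact: sub_closed_comb.
  rewrite hT' (hom_comb L0 LB hB) // (bigD1 t) //= st mulr0 big1 ?addr0 ?subr0 // => i' it.
  by rewrite hE (negbTE it) mul0r.
(* An initial frame: [T0], nonzero because of its value 1, takes the place of a row along which it
   has a nonzero coordinate and is moved to position [t]; its multiples then correct the other
   rows. *)
have [c cE] : exists c, T0 = c *m f by exists (T0 *m invmx f); rewrite mulmxKV.
have [j cj] : exists j, c 0 j != 0.
  apply/rV0Pn; apply: contra_eq_neq hT0 => c0.
  by rewrite cE c0 mul0mx (hom0 L0 hB).
pose f1 := xrow t j (set_row f j T0).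
have uf1 : f1 \in unitmx.
  rewrite /f1 xrowE unitmx_mul unitmx_perm /= unitmxE cE det_set_row unitfE mulf_neq0 //.
  by rewrite -unitfE -unitmxE.
have rf1 i : row i f1 = row (tperm t j i) (set_row f j T0).
  by apply/rowP => l; rewrite !mxE.
have f1t : row t f1 = T0.
  by rewrite rf1 tpermL row_set_row eqxx.
have Lf1 i : L (row i f1).
  by rewrite rf1 row_set_row; case: eqP.
pose a : 'cV[R]_n := \col_i (if i == t then 0 else (h (row i f1))%:~R).
have rE i : row i (f1 - a *m row t f1) = row i f1 - T0 *~ (if i == t then 0 else h (row i f1)).
  rewrite linearB /= row_mul f1t; congr (_ - _).
  rewrite -scaler_int; apply/rowP => l; rewrite !mxE big_ord1 !mxE.
  by case: eqP => //; rewrite mulr0z.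
exists (f1 - a *m row t f1); split.
- rewrite -row_free_unit; apply/inj_row_free => v /eqP.
  rewrite mulmxBr subr_eq0 rowE !mulmxA => /eqP /(mulmx_inj uf1) vE.
  have v0 i : i != t -> v 0 i = 0.
    move=> it; rewrite vE mxE big_ord1 [X in _ * X]mxE (negbTE it) andbF.
    by rewrite mulr0.
  have va : v *m a = 0.
    apply/rowP => l; rewrite !mxE big1 // => i _; rewrite mxE.
    by have [->|it] := eqVneq i t; rewrite ?mulr0 // v0 // mul0r.
  by rewrite vE va mul0mx.
- move=> i; rewrite rE; apply: LB => //; exact: sub_closedMz.
- move=> i; rewrite rE hB //; last exact: sub_closedMz.
  rewrite (homMz L0 LB hB) // hT0 mul1r.
  by have [->|it] := eqVneq i t; rewrite ?f1t ?hT0 ?subr0 ?subrr.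
Qed.

End AdaptedBasis.

(** * Homology classes of periods *)
Section HomologyClasses.
Context {R : realType} {M : topologicalType}.

Lemma homology_class_boundary (c1 c2 : Defs.cycle R M 0) (d : chain R M 2) :
  val c1 - val c2 = boundary d -> homology_class c1 = homology_class c2.
Proof.
move=> E; rewrite /homology_class; congr (\pi_(_) _)%qT.
apply/eqP; rewrite -Quotient.idealrBE unfold_in; apply/asboolP; exists d.
by rewrite raddfB.
Qed.

Lemma homology_classD (c1 c2 : Defs.cycle R M 0) :
  homology_class (c1 + c2) = homology_class c1 + homology_class c2.
Proof. by rewrite /homology_class !raddfD. Qed.

Lemma extend_continuous q (f : 'rV[R]_q.+1 -> M) :
  (forall v, std_simplex R q v -> {for v, continuous f}) ->
  continuous (fun t : std_simplex R q => f (set_val t)).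
Proof.
move=> cf t; apply: (@continuous_comp _ _ _ (@set_val _ (std_simplex R q)) f).
  exact: initial_continuous.
exact/cf/set_valP.
Qed.

(** Simplices are written as formulas in ambient coordinates; continuity is asked on the simplex
    only, because the homotopies below are controlled only for parameters in [[0, 1]]. *)
Definition simplex_of q (f : 'rV[R]_q.+1 -> M)
    (cf : forall v, std_simplex R q v -> {for v, continuous f}) :
    singular_simplex R M q :=
  mkcts (extend_continuous cf).

Lemma boundary2 (s : singular_simplex R M 2) : boundary << s >> =
  << singular_face s 0 >> - << singular_face s 1 >> + << singular_face s 2 >>.
Proof.
rewrite /boundary liftU scale1r !big_ord_recl big_ord0 addr0.
have -> : fintype.lift ord0 ord0 = 1 :> 'I_3 by exact/val_inj.
have -> : fintype.lift ord0 (fintype.lift ord0 ord0) = 2 :> 'I_3 by exact/val_inj.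
by rewrite expr0 scale1r expr1 scaleN1r sqrrN expr1n scale1r addrA.
Qed.

Lemma face_row_lift q (i : 'I_q.+2) (t : 'rV[R]_q.+1) l :
  face_row i t 0 (fintype.lift i l) = t 0 l.
Proof. by rewrite mxE liftK. Qed.

Lemma face_row_at q (i : 'I_q.+2) (t : 'rV[R]_q.+1) : face_row i t 0 i = 0.
Proof. by rewrite mxE unlift_none. Qed.

Lemma face_row0E (t : 'rV[R]_2) :
  (face_row (0 : 'I_3) t 0 1 = t 0 0) * (face_row (0 : 'I_3) t 0 2 = t 0 1).
Proof.
by split; rewrite -[in RHS](face_row_lift 0 t); congr (face_row _ _ _ _); exact/val_inj.
Qed.

Lemma face_row1E (t : 'rV[R]_2) :
  (face_row (1 : 'I_3) t 0 1 = 0) * (face_row (1 : 'I_3) t 0 2 = t 0 1).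
Proof.
split; first exact: face_row_at.
by rewrite -[in RHS](face_row_lift 1 t); congr (face_row _ _ _ _); exact/val_inj.
Qed.

Lemma face_row2E (t : 'rV[R]_2) :
  (face_row (2 : 'I_3) t 0 1 = t 0 1) * (face_row (2 : 'I_3) t 0 2 = 0).
Proof.
split; last exact: face_row_at.
by rewrite -[in RHS](face_row_lift 2 t); congr (face_row _ _ _ _); exact/val_inj.
Qed.

Lemma singular_faceE q (f : 'rV[R]_q.+2 -> M) cf (i : 'I_q.+2) t :
  (singular_face (@simplex_of q.+1 f cf) i : continuousType _ _) t =
  f (face_row i (set_val t)).
Proof. by []. Qed.

Lemma std_simplex1 (t : std_simplex R 1) :
  (set_val t 0 0 = 1 - set_val t 0 1) * (0 <= set_val t 0 1 <= 1).
Proof.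
have [t0 t1] := set_valP t; rewrite big_ord_recl big_ord1 in t1.
have e : fintype.lift ord0 ord0 = 1 :> 'I_2 by exact/val_inj.
rewrite e in t1; have := t0 0; have := t0 1.
by move: t1; rewrite -[ord0]/(0 : 'I_2) => t1 h1 h0; split; [|apply/andP]; lra.
Qed.

Lemma std_simplex2 v : std_simplex R 2 v ->
  (0 <= v 0 2 <= 1) * (0 <= v 0 1 + v 0 2 <= 1).
Proof.
move=> [v0 v1]; rewrite !big_ord_recl big_ord0 in v1.
have e1 : fintype.lift ord0 ord0 = 1 :> 'I_3 by exact/val_inj.
have e2 : fintype.lift ord0 (fintype.lift ord0 ord0) = 2 :> 'I_3 by exact/val_inj.
rewrite e1 e2 in v1; have := v0 0; have := v0 1; have := v0 2.
by move: v1; rewrite -[ord0]/(0 : 'I_3) => v1 h2 h1 h0; split; apply/andP; lra.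
Qed.

End HomologyClasses.

Section LoopClasses.
Context {R : realType} {k n : nat} {M : topologicalType}.
Context {X : manifold R (k + n) M}.
Variable S : regular_system X.
Local Notation L := (isotropy (act S)).

(** [rho] is tied to the chosen representative of each orbit. Basing the loop at any [x], with 0 as
    default off the periods, lets base point and period vary freely. *)
Definition loop_class x T : H1_mod_torsion R M :=
  if pselect (L x T) is left xT
  then homology_class (exist (fun c => c \in @is_cycle R M 0) _ (act_path_cycle xT))
  else 0.

Lemma loop_classE x T (xT : L x T) : loop_class x T =
  homology_class (exist (fun c => c \in @is_cycle R M 0) _ (act_path_cycle xT)).
Proof.
by rewrite /loop_class; case: pselect => // xT'; rewrite (Prop_irrelevance xT xT').
Qed.

Lemma rho_loop_class (w : lattice_bundle S) :
  rho S w = loop_class (orbit_repr (set_val w).1) (set_val w).2.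
Proof. by rewrite (loop_classE (lattice_bundle_isotropy w)). Qed.

Lemma act2_continuous (T : topologicalType) (f : T -> 'rV[R]_n) (g : T -> M) v :
  {for v, continuous f} -> {for v, continuous g} ->
  {for v, continuous (fun w => act S (f w) (g w))}.
Proof.
move=> cf cg; exact: (@continuous2_cvg _ _ _ _ (nbhs v) _ _ _ (act S) _ _
  (@act_continuous2 _ _ _ _ _ S (f v) (g v)) cf cg).
Qed.

Lemma scale_continuous (T : topologicalType) (a : T -> R) (f : T -> 'rV[R]_n) v :
  {for v, continuous a} -> {for v, continuous f} ->
  {for v, continuous (fun w => a w *: f w)}.
Proof. by move=> ca cf; exact: (cvgZ ca cf). Qed.

(* The triangle [0, T, T + T'] of R^n, moved along the orbit. *)
Lemma loop_classD x T T' : L x T -> L x T' ->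
  loop_class x (T + T') = loop_class x T + loop_class x T'.
Proof.
move=> xT xT'; have xTT' := isotropyD xT xT'.
pose f (v : 'rV[R]_3) := act S ((v 0 1 + v 0 2) *: T + v 0 2 *: T') x.
have cf v : std_simplex R 2 v -> {for v, continuous f}.
  move=> _; apply: (@act2_continuous _ _ (fun=> x)); last exact: cst_continuous.
  have c1 := @coord_continuous R 1 3 0 1 v; have c2 := @coord_continuous R 1 3 0 2 v.
  apply: continuousD; apply: scale_continuous; try exact: cst_continuous.
    exact: (continuousD c1 c2).
  exact: c2.
rewrite (loop_classE xT) (loop_classE xT') (loop_classE xTT') -homology_classD.
apply: (homology_class_boundary (d := - << simplex_of cf >>)).
rewrite raddfN /= boundary2 !raddfD /=.
have -> : singular_face (simplex_of cf) 0 = act_path S T' x.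
  apply/continuousEP => t; rewrite singular_faceE /f !face_row0E (std_simplex1 t) subrK.
  by rewrite scale1r addrC actD xT.
have -> : singular_face (simplex_of cf) 1 = act_path S (T + T') x.
  apply/continuousEP => t; rewrite singular_faceE /f !face_row1E add0r.
  by rewrite -scalerDr.
have -> : singular_face (simplex_of cf) 2 = act_path S T x.
  apply/continuousEP => t; rewrite singular_faceE /f !face_row2E addr0 scale0r addr0.
  by [].
by rewrite opprK [RHS]addrC [LHS]addrC addrA.
Qed.

(* The square [(s, tau) |-> act (s T_tau) x_tau], cut along its diagonal. *)
Lemma loop_class_homotopy (T_ : R -> 'rV[R]_n) (x_ : R -> M) :
  (forall tau, 0 <= tau <= 1 -> [/\ {for tau, continuous T_},
     {for tau, continuous x_} & L (x_ tau) (T_ tau)]) ->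
  loop_class (x_ 0) (T_ 0) = loop_class (x_ 1) (T_ 1).
Proof.
move=> H.
have [_ _ L0] : [/\ {for 0, continuous T_}, {for 0, continuous x_} & L (x_ 0) (T_ 0)].
  by apply: H; rewrite lexx ler01.
have [_ _ L1] : [/\ {for 1, continuous T_}, {for 1, continuous x_} & L (x_ 1) (T_ 1)].
  by apply: H; rewrite lexx ler01.
pose K (s tau : R) := act S (s *: T_ tau) (x_ tau).
have cK (a b : 'rV[R]_3 -> R) v : {for v, continuous a} -> {for v, continuous b} ->
    0 <= b v <= 1 -> {for v, continuous (fun w => K (a w) (b w))}.
  move=> ca cb /H[cT cx _].
  apply: (@act2_continuous _ (fun w => a w *: T_ (b w)) (fun w => x_ (b w))).
    by apply: scale_continuous => //; exact: (continuous_comp cb cT).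
  exact: (continuous_comp cb cx).
have c2 v := @coord_continuous R 1 3 0 2 v.
have c12 (v : 'rV[R]_3) : {for v, continuous (fun w : 'rV[R]_3 => w 0 1 + w 0 2)}.
  exact: (continuousD (@coord_continuous R 1 3 0 1 v) (c2 v)).
have cA (v : 'rV[R]_3) : std_simplex R 2 v ->
    {for v, continuous (fun w : 'rV[R]_3 => K (w 0 1 + w 0 2) (w 0 2))}.
  by move=> /std_simplex2 vs; apply: cK; rewrite ?vs //; exact: c2.
have cB (v : 'rV[R]_3) : std_simplex R 2 v ->
    {for v, continuous (fun w : 'rV[R]_3 => K (w 0 2) (w 0 1 + w 0 2))}.
  by move=> /std_simplex2 vs; apply: cK; rewrite ?vs //; exact: c2.
rewrite (loop_classE L0) (loop_classE L1).
apply: (homology_class_boundary (d := << simplex_of cA >> - << simplex_of cB >>)).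
rewrite raddfB /= !boundary2.
(* The sides [s = 0] and [s = 1] of the square are the same path [x_], because each [T_ tau] is a
   period at [x_ tau]; they cancel, and so do the diagonals, leaving the two loops. *)
have -> : singular_face (simplex_of cA) 0 = singular_face (simplex_of cB) 2.
  apply/continuousEP => t; rewrite !singular_faceE !face_row0E !face_row2E.
  rewrite (std_simplex1 t) subrK addr0 /K scale1r scale0r act0.
  by have [_ _] := H _ (std_simplex1 t).2.
have -> : singular_face (simplex_of cA) 1 = singular_face (simplex_of cB) 1.
  by apply/continuousEP => t; rewrite !singular_faceE !face_row1E add0r.
have -> : singular_face (simplex_of cA) 2 = act_path S (T_ 0) (x_ 0).
  by apply/continuousEP => t; rewrite singular_faceE !face_row2E addr0.
have -> : singular_face (simplex_of cB) 0 = act_path S (T_ 1) (x_ 1).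
  apply/continuousEP => t; rewrite singular_faceE !face_row0E.
  by rewrite (std_simplex1 t) subrK.
set a := << singular_face (simplex_of cB) 2 >>.
set b := << singular_face (simplex_of cB) 1 >>.
set p := << act_path S (T_ 1) (x_ 1) >>.
by rewrite [a - b + _]addrC -[p - b + a]addrA [- b + a]addrC [p + (a - b)]addrC addrKA.
Qed.

(** The base point slides along [act S (tau *: T') x] with the period unchanged, since isotropy
    groups are constant along orbits. *)
Lemma loop_class_act x T T' : L x T -> loop_class (act S T' x) T = loop_class x T.
Proof.
move=> xT.
have := @loop_class_homotopy (fun=> T) (fun tau => act S (tau *: T') x).
rewrite scale0r act0 scale1r => -> // tau _; split.
- exact: cst_continuous.
- apply: act2_continuous; last exact: cst_continuous.
  by apply: scale_continuous; [exact: cvg_id|exact: cst_continuous].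
- by rewrite isotropy_act.
Qed.

End LoopClasses.

Section LocalConstancy.
Context {R : realType} {k n : nat} {M : topologicalType}.
Context {X : manifold R (k + n) M}.
Variable S : regular_system X.
Local Notation L := (isotropy (act S)).

Lemma sub_section (B B' : set 'rV[R]_k) sigma :
  is_section S B sigma -> open B' -> B' `<=` B -> is_section S B' sigma.
Proof. by move=> [_ sB] B'o B'B; split=> // u /B'B /sB. Qed.

(** A ball around [b] is convex, so the period can be continued along the segment from [b] to [u];
    this is a homotopy of loops. *)
Lemma loop_class_near B sigma b T0 : is_section S B sigma -> B b ->
  L (sigma b) T0 -> \forall v \near row_mx b T0,
    L (sigma (lsubmx v)) (rsubmx v) ->
    loop_class S (sigma (lsubmx v)) (rsubmx v) = loop_class S (sigma b) T0.
Proof.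
move=> sB Bb LT0.
have [tau [B' [N [tb B'o B'b No [N0 HB' HN]]]]] := isotropy_continuation sB Bb LT0.
have [e /= e0 He] := (nbhs_ballP _ _).1 (open_nbhs_nbhs (conj B'o B'b)).
have nN : \forall v \near row_mx b T0, N v by exact: open_nbhs_nbhs.
have nb : \forall v \near row_mx b T0, ball b e (lsubmx v).
  have cl : {for row_mx b T0, continuous (fun v : 'rV[R]_(k + n) => lsubmx v)}.
    exact/smooth_near_continuous/smooth_near_lsubmx/smooth_near_id.
  have nb' : \forall u \near lsubmx (row_mx b T0), ball b e u.
    by rewrite row_mxKl; exact: nbhsx_ballx.
  exact: (cl _ nb').
apply: filterS2 nN nb => v Nv bv Lv; rewrite (HN _ Nv Lv).
set u := lsubmx v in bv *.
pose seg (t : R) := b + t *: (u - b).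
have segB t : 0 <= t <= 1 -> B' (seg t).
  move=> /andP[t0 t1]; apply: He; rewrite -ball_normE /= /seg opprD addrA subrr sub0r normrN.
  rewrite normrZ ger0_norm //; move: bv; rewrite -ball_normE /= distrC => bv.
  by apply: le_lt_trans bv; rewrite ler_piMl.
have cseg t : {for t, continuous seg}.
  apply: continuousD; first exact: cst_continuous.
  by apply: scale_continuous; [exact: cvg_id|exact: cst_continuous].
have := @loop_class_homotopy _ _ _ _ _ S (fun t => tau (seg t)) (fun t => sigma (seg t)).
rewrite /seg scale0r addr0 scale1r [b + (u - b)]addrC subrK tb => -> // t t01.
have [Bt [st Lt]] := HB' _ (segB t t01); split=> //.
- exact: (continuous_comp (cseg t) (smooth_near_continuous st)).
- by have [[cs _] _] := (proj2 sB) _ Bt; exact: (continuous_comp (cseg t) cs).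
Qed.

Lemma near_graph (b : 'rV[R]_k) (tau : 'rV[R]_k -> 'rV[R]_n) (P : 'rV[R]_(k + n) -> Prop) :
  smooth_near tau b -> (\forall v \near row_mx b (tau b), P v) ->
  \forall u \near b, P (row_mx u (tau u)).
Proof.
move=> st nP.
have cr : {for b, continuous (fun u => row_mx u (tau u))}.
  by apply/smooth_near_continuous/smooth_near_row_mx => //; exact: smooth_near_id.
exact: (cr _ nP).
Qed.

(** Flowing out the slice covers a neighbourhood of [x], so a property of nearby points is checked
    on translates of points of the slice. *)
Lemma near_base x B sigma (P : M -> Prop) : is_section S B sigma ->
  B (momentum S x) -> sigma (momentum S x) = x ->
  (\forall u \near momentum S x, forall T, P (act S T (sigma u))) ->
  \forall y \near x, P y.
Proof.
set b := momentum S x => sB Bb sb nP.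
pose v0 : 'rV[R]_(k + n) := row_mx b 0.
have B0 : B (lsubmx v0) by rewrite row_mxKl.
have nP' : \forall v \near v0, forall T, P (act S T (sigma (lsubmx v))).
  have cl : {for v0, continuous (fun v : 'rV[R]_(k + n) => lsubmx v)}.
    exact/smooth_near_continuous/smooth_near_lsubmx/smooth_near_id.
  have nb' : \forall u \near lsubmx v0, forall T, P (act S T (sigma u)).
    by rewrite row_mxKl.
  exact: (cl _ nb').
have [A [ O [H [Ao Av0 Oo [AO OA AP _]]]]] := flow_out_etale sB B0 nP'.
have Ox : O x by have [] := AO _ Av0; rewrite /flow_out row_mxKl row_mxKr act0 sb.
have nO : \forall y \near x, O y by exact: open_nbhs_nbhs.
apply: filterS nO => y Oy.
by have [AH <-] := OA _ Oy; exact: AP.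
Qed.

End LocalConstancy.

(** * The first coordinate of rho on all period lattices *)

Section RhoCoordinate.
Context {R : realType} {k n : nat} {M : topologicalType}.
Context {X : manifold R (k + n) M}.
Variable S : regular_system X.
Variables (l : nat) (l_gt0 : (0 < l)%N) (phi : H1_mod_torsion R M -> 'rV[int]_l).
Hypothesis phi_iso : rho_coordinates S phi.
Local Notation L := (isotropy (act S)).

Definition rho1 x T : int := phi (loop_class S x T) 0 (Ordinal l_gt0).

Lemma isotropy_orbit x y : orbit_proj S x = orbit_proj S y -> L x = L y.
Proof. by move=> /orbit_projP[T <-]; rewrite isotropy_act. Qed.

Lemma lattice_bundle_mem x T : L x T -> (orbit_proj S x, T) \in lattice_bundle S.
Proof. by move=> xT; apply/mem_set => y /= /isotropy_orbit ->. Qed.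

Lemma loop_class_orbit x y T : orbit_proj S x = orbit_proj S y -> L x T ->
  loop_class S x T = loop_class S y T.
Proof. by move=> /orbit_projP[T' <-] xT; rewrite loop_class_act. Qed.

(** [phi] is additive on [range rho] only, so its use on loops at arbitrary base points rests on
    this membership. *)
Lemma loop_class_range x T : L x T -> range (rho S) (loop_class S x T).
Proof.
move=> xT; exists (exist _ (orbit_proj S x, T) (lattice_bundle_mem xT)) => //.
rewrite rho_loop_class set_valE /=; apply/esym/loop_class_orbit => //.
by rewrite orbit_reprK.
Qed.

Lemma rho1D x T T' : L x T -> L x T' -> rho1 x (T + T') = rho1 x T + rho1 x T'.
Proof.
move=> xT xT'; rewrite /rho1 loop_classD // phi_iso.2 ?mxE //.
all: by apply/mem_set/loop_class_range.
Qed.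

Lemma rho1B x T T' : L x T -> L x T' -> rho1 x (T - T') = rho1 x T - rho1 x T'.
Proof.
move=> xT xT'; apply/eqP; rewrite eq_sym subr_eq -rho1D ?subrK //.
exact: isotropyB.
Qed.

Lemma rho1_orbit x y T : orbit_proj S x = orbit_proj S y -> L x T ->
  rho1 x T = rho1 y T.
Proof. by move=> xy xT; rewrite /rho1 (loop_class_orbit xy xT). Qed.

Lemma rho1_near B sigma b T0 : is_section S B sigma -> B b -> L (sigma b) T0 ->
  \forall v \near row_mx b T0, L (sigma (lsubmx v)) (rsubmx v) ->
    rho1 (sigma (lsubmx v)) (rsubmx v) = rho1 (sigma b) T0.
Proof.
move=> sB Bb LT0; apply: filterS (loop_class_near sB Bb LT0) => v H Lv.
by rewrite /rho1 H.
Qed.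

Lemma rho1_comb x m (E : 'M[R]_(m, n)) (s : 'rV[int]_m) : (forall i, L x (row i E)) ->
  rho1 x (map_mx intr s *m E) = \sum_i rho1 x (row i E) * s 0 i.
Proof.
move=> LE; apply: (hom_comb (isotropy0 S x) (@isotropyB _ _ _ _ _ S x)) => // T T'.
exact: rho1B.
Qed.

Lemma rho1_frame_near B sigma B' E b : is_section S B sigma ->
  isotropy_frame S B sigma B' E -> B' b ->
  \forall u \near b, forall i, rho1 (sigma u) (row i (E u)) = rho1 (sigma b) (row i (E b)).
Proof.
move=> sB [B'o HE] B'b; have [Bb _ Eb] := HE _ B'b.
apply: near_ord => i; have [sE LE] := Eb i.
have nB' : \forall u \near b, B' u by exact: open_nbhs_nbhs.
apply: filterS2 nB' (near_graph sE (rho1_near sB Bb LE)) => u /HE[_ _ Eu].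
by rewrite row_mxKl row_mxKr; apply; have [] := Eu i.
Qed.

Definition primitive_at x := exists2 T, L x T & rho1 x T = 1.

Lemma primitive_orbit x y : orbit_proj S x = orbit_proj S y ->
  primitive_at x <-> primitive_at y.
Proof.
move=> xy; split=> -[T LT T1]; exists T.
- by rewrite -(isotropy_orbit xy).
- by rewrite -(rho1_orbit xy).
- by rewrite (isotropy_orbit xy).
- by rewrite (rho1_orbit xy) // (isotropy_orbit xy).
Qed.

(** From [x] to a nearby orbit, a period of value 1 is continued along the section. Conversely, a
    period of [sigma u] minus an integer combination of the frame has the value of some period [T0]
    of [sigma b]; adding to [T0] the same combination of the frame at [b] restores the value 1. The
    two directions make the set and its complement open. *)
Lemma primitive_near x : \forall y \near x, primitive_at y <-> primitive_at x.
Proof.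
have [B [sigma [Bo Bb sb sBu]]] := local_section S x.
have sB : is_section S B sigma by split.
set b := momentum S x in Bb sb.
apply: (near_base sB Bb sb); rewrite -/b.
suff : \forall u \near b, primitive_at (sigma u) <-> primitive_at x.
  apply: filterS => u Hu T; rewrite -Hu; apply: primitive_orbit.
  by rewrite orbit_proj_act.
have [f [uf Lf]] := isotropy_independent sB Bb.
have [B' [E [[B'o HE] B'b Eb]]] := frame_continuation sB Bb uf Lf.
(* Of the closeness to a period [T0] at [b], the predicate [Q] retains only the equality of
   values. *)
have red := isotropy_near_reduction sB (Q := fun T u => exists T0,
  L (sigma b) T0 /\ rho1 (sigma u) T = rho1 (sigma b) T0) (conj B'o HE) B'b _.
have {}red := red (fun T0 LT0 => filterS (fun v H Lv =>
  ex_intro _ T0 (conj LT0 (H Lv))) (rho1_near sB Bb LT0)).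
have n1 : \forall u \near b, B' u by exact: open_nbhs_nbhs.
have n2 := rho1_frame_near sB (conj B'o HE) B'b.
have n3 : \forall u \near b, primitive_at x -> primitive_at (sigma u).
  have [[T LT T1]|nx] := pselect (primitive_at x); last first.
    by apply: near_all => u /nx.
  rewrite -sb in LT T1.
  have [tau [B'' [N [tb B''o B''b No [N0 HB'' HN]]]]] := isotropy_continuation sB Bb LT.
  have n4 : \forall u \near b, B'' u by exact: open_nbhs_nbhs.
  have [_ [st _]] := HB'' _ B''b.
  have LT' : L (sigma b) (tau b) by rewrite tb.
  have := near_graph st (rho1_near sB Bb LT').
  apply: filterS2 n4 => u /HB''[_ [_ Lu]].
  rewrite row_mxKl row_mxKr => /(_ Lu) e _.
  by exists (tau u) => //; rewrite e tb.
near=> u; split; last by near: u.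
move=> [T LT T1].
have B'u : B' u by near: u.
have [_ _ Eu] := HE _ B'u.
have LE i : L (sigma u) (row i (E u)) by have [] := Eu i.
have [s [T0 [LT0 sE]]] : exists s : 'rV[int]_n, exists T0, L (sigma b) T0 /\
    rho1 (sigma u) (T - map_mx intr s *m E u) = rho1 (sigma b) T0.
  by move: T LT {T1}; near: u; exact: red.
have rE : forall i, rho1 (sigma u) (row i (E u)) = rho1 (sigma b) (row i (E b)).
  by near: u.
have LEb i : L (sigma b) (row i (E b)) by rewrite Eb.
rewrite -sb; exists (T0 + map_mx intr s *m E b).
  by apply: isotropyD => //; exact: isotropy_comb.
rewrite rho1D //; last exact: isotropy_comb.
rewrite -sE rho1B //; last exact: isotropy_comb.
rewrite T1 !rho1_comb //.
under [X in _ + X]eq_bigr do rewrite -rE.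
by rewrite subrK.
Unshelve. all: by end_near. Qed.

Hypothesis M_connected : connected [set: M].

Lemma primitive_everywhere x : primitive_at x.
Proof.
have [_ _ surj] := phi_iso.1.
(* Only the first coordinate of this vector matters. *)
have [_ [w _ <-] wE] := surj (const_mx 1) I.
have Vw : primitive_at (orbit_repr (set_val w).1).
  exists (set_val w).2; first exact: lattice_bundle_isotropy.
  by rewrite /rho1 -rho_loop_class wE mxE.
have Vo : open (primitive_at : set M).
  rewrite openE => y Vy; apply: filterS (primitive_near y) => z [_]; exact.
have Vc : closed (primitive_at : set M).
  rewrite -openC openE => y Vy; apply: filterS (primitive_near y) => z [Hz _] /Hz.
  exact: Vy.
have VT : (primitive_at : set M) = setT.
  apply: M_connected; first by exists (orbit_repr (set_val w).1).
    by exists primitive_at => //; rewrite setTI.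
  by exists primitive_at => //; rewrite setTI.
by have : [set: M] x by []; rewrite -VT.
Qed.

(** For [n = 0] a period of value 1 would equal its difference with itself, of value 0. *)
Lemma n_gt0 (x : M) : (0 < n)%N.
Proof.
have [T LT T1] := primitive_everywhere x.
rewrite lt0n; apply: contra_eq_neq T1 => n0.
have -> : T = T - T.
  by apply/rowP => i; have := ltn_ord i; rewrite [X in (_ < X)%N]n0.
by rewrite rho1B // subrr eq_sym oner_eq0.
Qed.

(** The continuation of an adapted basis at the centre keeps its values, [rho1] being locally
    constant. It stays a basis: a nearby period reduced modulo the frame is close to an integer
    combination of the basis at the centre, hence equal to the same combination of the frame. *)
Theorem adapted_frame (t : 'I_n) x : exists B sigma E,
  [/\ is_section S B sigma, B (momentum S x), sigma (momentum S x) = x,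
      isotropy_frame S B sigma B E &
      forall u, B u -> (forall i, rho1 (sigma u) (row i (E u)) = (i == t)%:R) /\
        forall T, L (sigma u) T -> exists s : 'rV[int]_n, T = map_mx intr s *m E u].
Proof.
have [B [sigma [Bo Bb sb sBu]]] := local_section S x.
have sB : is_section S B sigma by split.
set b := momentum S x in Bb sb *.
have [f0 [uf0 Lf0]] := isotropy_independent sB Bb.
have [d d0 Hd] := isotropy_discrete S (sigma b).
have [T0 LT0 T01] := primitive_everywhere (sigma b).
have [f [uf Lf hf gf]] := adapted_basis (isotropy0 S _) (@isotropyB _ _ _ _ _ S _)
  d0 Hd (@rho1B (sigma b)) t uf0 Lf0 LT0 T01.
have [B' [E [[B'o HE] B'b Eb]]] := frame_continuation sB Bb uf Lf.
have frE : isotropy_frame S B sigma B' E by [].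
have n1 : \forall u \near b, B' u by exact: open_nbhs_nbhs.
have n2 := rho1_frame_near sB frE B'b.
have n3 : \forall u \near b, forall T, L (sigma u) T ->
    exists s : 'rV[int]_n, T = map_mx intr s *m E u.
  have := isotropy_near_reduction sB (Q := fun T u => exists s : 'rV[int]_n,
    T = map_mx intr s *m E u) frE B'b.
  move=> H; have : \forall u \near b, forall T, L (sigma u) T ->
      exists s, exists s' : 'rV[int]_n,
      T - map_mx intr s *m E u = map_mx intr s' *m E u.
    apply: H => T1 LT1; have [s sE] := gf _ LT1; rewrite -Eb in sE.
    apply: filterS (isotropy_comb_unique sB frE B'b sE) => v H Lv.
    by exists s; exact: H.
  apply: filterS => u Hu T /Hu[s [s' E']].
  by exists (s' + s); rewrite map_mxD mulmxDl -E' subrK.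
have : \forall u \near b, B' u /\ (forall i, rho1 (sigma u) (row i (E u)) = (i == t)%:R) /\
    forall T, L (sigma u) T -> exists s : 'rV[int]_n, T = map_mx intr s *m E u.
  near=> u; split; first by near: u.
  split; last by near: u.
  move=> i; rewrite -hf -Eb; move: i; near: u; exact: n2.
move=> /near_open[W [Wo Wb HW]].
exists W, sigma, E; split=> //.
- by apply: (sub_section sB) => // u /HW[/HE[]].
- by split=> // u Wu; have [/HE[_ uE Eu] _] := HW u Wu; split.
- by move=> u /HW[_].
Unshelve. all: by end_near. Qed.

End RhoCoordinate.

(** * The trivialization *)
Section TorusCharts.
Context {R : realType} {m : nat}.
Local Notation proj := (@torus_proj R m).

Lemma torus_projP (v w : 'rV[R]_m) :
  proj v = proj w <-> exists s : 'rV[int]_m, v - w = map_mx intr s.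
Proof.
split=> [/eqquotP /forallP vw|[s sE]].
  exists (\row_j Num.floor (v 0 j - w 0 j)); apply/rowP => j; rewrite !mxE.
  by have := vw j; rewrite intrEfloor => /eqP.
apply/eqquotP/forallP => j; move/rowP : sE => /(_ j); rewrite !mxE => ->.
exact: intr_int.
Qed.

Lemma torus_proj_continuous : continuous proj.
Proof. exact: pi_continuous. Qed.

Definition torus_repr (z : torus R m) : 'rV[R]_m :=
  repr (z : quotient_topology {eq_quot (@eq_mod_Z R m)}%qT).

Lemma torus_proj_repr (z : torus R m) :
  proj (torus_repr z) = z.
Proof. exact: reprK. Qed.

Lemma torus_proj_open (O : set 'rV[R]_m) : open O -> open (proj @` O).
Proof.
move=> Oo; suff : open (proj @^-1` (proj @` O)) by [].
rewrite openE => v [w Ow /torus_projP[s sE]].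
have wE : w = v + map_mx intr s by rewrite -sE addrC subrK.
have ct : {for v, continuous (fun v' : 'rV[R]_m => v' + map_mx intr s)}.
  apply/smooth_near_continuous/smooth_nearD; first exact: smooth_near_id.
  exact: smooth_near_cst.
have nO : \forall v' \near v, O (v' + map_mx intr s).
  have nw : \forall w' \near v + map_mx intr s, O w'.
    by rewrite -wE; exact: open_nbhs_nbhs.
  exact: (ct _ nw).
apply: filterS nO => v' Ov'; exists (v' + map_mx intr s) => //.
by apply/torus_projP; exists s; rewrite addrC addKr.
Qed.

Lemma small_int_row (s : 'rV[int]_m) : `|map_mx intr s : 'rV[R]_m| < 1 -> s = 0.
Proof.
move=> s1; apply/rowP => j; rewrite mxE; apply/eqP.
have := le_lt_trans (coord_le_norm (map_mx intr s : 'rV[R]_m) j) s1.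
by rewrite mxE -intr_norm -[1]/(1%:~R) ltr_int; case: (s 0 j) => -[].
Qed.

(** Two points of a sup-norm ball of radius 1/2 differ by less than 1 in every coordinate, so no
    nonzero integer vector separates them. *)
Lemma torus_proj_ball_inj (v0 v w : 'rV[R]_m) :
  ball v0 2^-1 v -> ball v0 2^-1 w -> proj v = proj w -> v = w.
Proof.
move=> /row_ballP v0v /row_ballP v0w /torus_projP[s sE].
have s0 : s = 0.
  apply: small_int_row; rewrite -sE.
  have := ler_distD v0 v w; rewrite (distrC v v0); lra.
by apply/eqP; rewrite -subr_eq0 sE s0 map_mx0.
Qed.

Definition torus_chart (v0 : 'rV[R]_m) : chart R m (torus R m) :=
  Chart (proj @` ball v0 2^-1) (ball v0 2^-1)
    (fun x => xget v0 [set v | ball v0 2^-1 v /\ proj v = x]) proj.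

Lemma torus_chart_map v0 v : ball v0 2^-1 v ->
  chart_map (torus_chart v0) (proj v) = v.
Proof.
move=> bv; rewrite /=; case: xgetP => [w _ [bw /esym vw]|/(_ v)]; last by case.
exact/esym/(torus_proj_ball_inj bv bw).
Qed.

Lemma torus_chart_is_chart v0 : is_chart (torus_chart v0).
Proof.
have bo : open (ball v0 (2^-1 : R)) by exact: ball_open.
split=> //.
- exact: torus_proj_open.
- by move=> _ [v bv <-]; rewrite torus_chart_map.
- by move=> v bv; exists v.
- by move=> _ [v bv <-]; rewrite torus_chart_map.
- exact: torus_chart_map.
- move=> _ [v bv <-] U; rewrite torus_chart_map // => nU.
  have nb : \forall w \near v, ball v0 2^-1 w by exact: open_nbhs_nbhs.
  have nUb : \forall w \near v, U w /\ ball v0 2^-1 w by exact: filterI.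
  have [W [Wo Wv WU]] := near_open nUb.
  have nW : nbhs (proj v) (proj @` W).
    have pv : (proj @` W) (proj v) by exists v.
    exact: (open_nbhs_nbhs (conj (torus_proj_open Wo) pv)).
  have WU' : proj @` W `<=` chart_map (torus_chart v0) @^-1` U.
    by move=> _ [w Ww <-]; have [Uw bw] := WU _ Ww; rewrite /preimage /mkset torus_chart_map.
  exact: (filterS WU' nW).
- by move=> v _; exact: torus_proj_continuous.
Qed.

Lemma torus_chart_in v0 : torus_atlas (torus_chart v0).
Proof. by split; [exact: torus_chart_is_chart|]. Qed.

End TorusCharts.

Section ProductCharts.
Context {R : realType} {m p : nat} {M N : topologicalType}.

Lemma continuous_pair (T : topologicalType) (f : T -> M) (g : T -> N) x :
  {for x, continuous f} -> {for x, continuous g} ->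
  {for x, continuous (fun y => (f y, g y))}.
Proof. by move=> cf cg; exact: cvg_pair. Qed.

Lemma row_mx_continuous (T : topologicalType) (f : T -> 'rV[R]_m)
    (g : T -> 'rV[R]_p) x :
  {for x, continuous f} -> {for x, continuous g} ->
  {for x, continuous (fun y => row_mx (f y) (g y))}.
Proof.
move=> cf cg; apply: row_continuous => j; case: (fintype.splitP j) => i ij.
  have -> : j = lshift p i by exact/val_inj.
  rewrite (_ : (fun _ => _) = (fun y => f y 0 i)).
    exact: (continuous_comp cf (@coord_continuous _ _ _ 0 i (f x))).
  by apply/funext => y; rewrite row_mxEl.
have -> : j = rshift m i by exact/val_inj.
rewrite (_ : (fun _ => _) = (fun y => g y 0 i)).
  exact: (continuous_comp cg (@coord_continuous _ _ _ 0 i (g x))).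
by apply/funext => y; rewrite row_mxEr.
Qed.

Lemma lsubmx_continuous (v : 'rV[R]_(m + p)) :
  {for v, continuous (fun v : 'rV[R]_(m + p) => lsubmx v)}.
Proof. exact/smooth_near_continuous/smooth_near_lsubmx/smooth_near_id. Qed.

Lemma rsubmx_continuous (v : 'rV[R]_(m + p)) :
  {for v, continuous (fun v : 'rV[R]_(m + p) => rsubmx v)}.
Proof. exact/smooth_near_continuous/smooth_near_rsubmx/smooth_near_id. Qed.

Lemma open_product (U : set M) (V : set N) : open U -> open V -> open (U `*` V).
Proof.
move=> Uo Vo; rewrite openE => -[x y] [/= Ux Vy].
exists (U, V) => //=; split; exact: open_nbhs_nbhs.
Qed.

Lemma prod_chart_is_chart (c : chart R m M) (d : chart R p N) :
  is_chart c -> is_chart d -> is_chart (prod_chart c d).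
Proof.
move=> hc hd; split=> /=.
- by apply: open_product; exact: dom_open.
- rewrite (_ : [set _ | _] = (setT `&` (fun v : 'rV[R]_(m + p) => lsubmx v) @^-1` img c) `&`
      (setT `&` (fun v : 'rV[R]_(m + p) => rsubmx v) @^-1` img d)).
    apply: openI; apply: open_preimage_on; try exact: openT; try exact: img_open.
      by move=> v _; exact: lsubmx_continuous.
    by move=> v _; exact: rsubmx_continuous.
  by rewrite !setTI.
- by move=> [x y] [/= cx dy]; rewrite row_mxKl row_mxKr; split; exact: chart_map_img.
- by move=> v [cv dv]; split; exact: chart_inv_dom.
- by move=> [x y] [/= cx dy]; rewrite row_mxKl row_mxKr !chart_mapK.
- by move=> v [cv dv]; rewrite !chart_invK // hsubmxK.
- move=> [x y] [/= cx dy]; apply: (row_mx_continuous (f := fun z : M * N => chart_map c z.1)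
    (g := fun z : M * N => chart_map d z.2)).
    apply: (@continuous_comp _ _ _ fst (chart_map c)); first exact: cvg_fst.
    exact: chart_map_continuous.
  apply: (@continuous_comp _ _ _ snd (chart_map d)); first exact: cvg_snd.
  exact: chart_map_continuous.
- move=> v [cv dv]; apply: (continuous_pair (f := fun v : 'rV[R]_(m + p) => chart_inv c (lsubmx v))
    (g := fun v : 'rV[R]_(m + p) => chart_inv d (rsubmx v))).
    apply: (@continuous_comp _ _ _ (fun v : 'rV[R]_(m + p) => lsubmx v) (chart_inv c)).
      exact: lsubmx_continuous.
    exact: chart_inv_continuous.
  apply: (@continuous_comp _ _ _ (fun v : 'rV[R]_(m + p) => rsubmx v) (chart_inv d)).
    exact: rsubmx_continuous.
  exact: chart_inv_continuous.
Qed.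

End ProductCharts.

Section SmoothAt.
Context {R : realType} {m p : nat} {M N : topologicalType}.

Lemma smooth_near_open (f : 'rV[R]_m -> 'rV[R]_p) x : smooth_near f x ->
  exists W, [/\ open W, W x & Cinfty W f].
Proof.
move=> /smooth_near_join /near_open[W [Wo Wx HW]].
by exists W; split=> //; exact: smooth_near_Cinfty.
Qed.

Lemma smooth_at_of_curve (X : manifold R p N) (A : set (chart R m M)) c
    (g : 'rV[R]_m -> N) (f : M -> N) x :
  is_chart c -> A c -> dom c x -> curve_smooth X g (chart_map c x) ->
  (forall y, dom c y -> f y = g (chart_map c y)) -> smooth_at A X f x.
Proof.
move=> hc Ac cx [cg sg] fE.
have nc : \forall y \near x, dom c y.
  by apply: open_nbhs_nbhs; split=> //; exact: dom_open.
split.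
  have cc : {for x, continuous (fun y => g (chart_map c y))}.
    exact: (continuous_comp (chart_map_continuous hc cx) cg).
  by apply: near_eq_continuous cc; apply: filterS nc => y /fE.
have [d Xd dx] := exists_chart X (g (chart_map c x)).
exists c, d; split=> //; first by rewrite fE.
apply: smooth_near_open; apply: smooth_near_eq (sg d Xd dx).
have ni : \forall w \near chart_map c x, img c w.
  apply: open_nbhs_nbhs; split; first exact: img_open.
  exact: chart_map_img.
apply: filterS ni => w cw; rewrite /in_charts /= fE ?chart_invK //.
exact: chart_inv_dom.
Qed.

Lemma smooth_at_of_fun (X : manifold R m M) (A : set (chart R p N)) c
    (H : M -> 'rV[R]_p) (f : M -> N) x :
  is_chart c -> A c -> fun_smooth X H x -> img c (H x) ->
  (\forall y \near x, f y = chart_inv c (H y)) -> smooth_at X A f x.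
Proof.
move=> hc Ac sH cH fE; have fx := nbhs_singleton fE.
have cont := fun_smooth_continuous sH.
split.
  have cc : {for x, continuous (fun y => chart_inv c (H y))}.
    exact: (continuous_comp cont (chart_inv_continuous hc cH)).
  by apply: near_eq_continuous cc; apply: filterS fE => y ->.
have [d Xd dx] := exists_chart X x; have hd := atlas_chart Xd.
exists d, c; split=> //; first by rewrite fx; exact: chart_inv_dom.
apply: smooth_near_open; apply: smooth_near_eq (sH d Xd dx).
have ni : \forall y \near x, img c (H y).
  have ni' : \forall w \near H x, img c w.
    by apply: open_nbhs_nbhs; split=> //; exact: img_open.
  exact: (cont _ ni').
have nfi : \forall y \near x, f y = chart_inv c (H y) /\ img c (H y) by exact: filterI.
have cd : {for chart_map d x, continuous (chart_inv d)}.
  by apply: chart_inv_continuous => //; exact: chart_map_img.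
have nw : \forall w \near chart_map d x,
    f (chart_inv d w) = chart_inv c (H (chart_inv d w)) /\ img c (H (chart_inv d w)).
  have nfi' : \forall y \near chart_inv d (chart_map d x),
      f y = chart_inv c (H y) /\ img c (H y) by rewrite (chart_mapK hd dx).
  exact: (cd _ nfi').
by apply: filterS nw => w [fw cw]; rewrite /in_charts /= fw chart_invK.
Qed.

End SmoothAt.

(** * Coordinates given by a basis of the periods *)

Section FrameCoordinates.
Context {R : realType} {k n : nat} {M : topologicalType}.
Context {X : manifold R (k + n) M}.
Variable S : regular_system X.
Variables (B : set 'rV[R]_k) (sigma : 'rV[R]_k -> M) (E : 'rV[R]_k -> 'M[R]_n).
Hypotheses (sB : is_section S B sigma) (fE : isotropy_frame S B sigma B E).
Hypothesis genE : forall u, B u -> forall T, isotropy (act S) (sigma u) T ->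
  exists s : 'rV[int]_n, T = map_mx intr s *m E u.
Local Notation L := (isotropy (act S)).
Local Notation q := (orbit_proj S).

(** In units of the frame the period lattice is Z^n over every [u], so that [theta] descends to a
    family of standard tori. *)
Definition theta (v : 'rV[R]_(k + n)) : M :=
  act S (rsubmx v *m E (lsubmx v)) (sigma (lsubmx v)).

Let uE u : B u -> E u \in unitmx.
Proof. by case: fE => _ HE /HE[]. Qed.

Let rowE_smooth u i : B u -> smooth_near (fun u => row i (E u)) u.
Proof. by case: fE => _ HE /HE[_ _ /(_ i)[]]. Qed.

Let rowE_isotropy u i : B u -> L (sigma u) (row i (E u)).
Proof. by case: fE => _ HE /HE[_ _ /(_ i)[]]. Qed.

Lemma momentum_theta v : B (lsubmx v) -> momentum S (theta v) = lsubmx v.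
Proof. by move=> Bv; rewrite momentum_act; have [_ ->] := (proj2 sB) _ Bv. Qed.

Lemma orbit_theta v : q (theta v) = q (sigma (lsubmx v)).
Proof. exact: orbit_proj_act. Qed.

Lemma near_lsub_comp m (F : 'rV[R]_k -> 'rV[R]_m) (v : 'rV[R]_(k + n)) :
  smooth_near F (lsubmx v) -> smooth_near (fun w : 'rV[R]_(k + n) => F (lsubmx w)) v.
Proof.
move=> sF; apply: (@smooth_near_comp _ _ _ _ (fun w : 'rV[R]_(k + n) => lsubmx w) F) => //.
exact/smooth_near_lsubmx/smooth_near_id.
Qed.

Lemma theta_smooth v : B (lsubmx v) -> curve_smooth X theta v.
Proof.
move=> Bv; apply: (@curve_smooth_act _ _ _ _ _ _ _
  (fun v => rsubmx v *m E (lsubmx v)) (fun v => sigma (lsubmx v))).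
  apply: smooth_near_mulmx => [|i]; first exact/smooth_near_rsubmx/smooth_near_id.
  by apply: (near_lsub_comp (F := fun u => row i (E u))); exact: rowE_smooth.
apply: (@curve_smooth_comp _ _ _ _ _ _ (fun v => lsubmx v) sigma).
  exact/smooth_near_lsubmx/smooth_near_id.
by have [] := (proj2 sB) _ Bv.
Qed.

Lemma near_lsub_B (v : 'rV[R]_(k + n)) : B (lsubmx v) -> \forall w \near v, B (lsubmx w).
Proof. exact: (near_lsubmx sB). Qed.

Definition frame_to_flow (v : 'rV[R]_(k + n)) : 'rV[R]_(k + n) :=
  row_mx (lsubmx v) (rsubmx v *m E (lsubmx v)).

Definition flow_to_frame (v : 'rV[R]_(k + n)) : 'rV[R]_(k + n) :=
  row_mx (lsubmx v) (rsubmx v *m invmx (E (lsubmx v))).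

Lemma theta_flow_out v : theta v = flow_out S sigma (frame_to_flow v).
Proof. by rewrite /flow_out row_mxKl row_mxKr. Qed.

Lemma frame_to_flowK v : B (lsubmx v) -> flow_to_frame (frame_to_flow v) = v.
Proof.
by move=> Bv; rewrite /flow_to_frame row_mxKl row_mxKr mulmxK ?uE // hsubmxK.
Qed.

Lemma flow_to_frameK v : B (lsubmx v) -> frame_to_flow (flow_to_frame v) = v.
Proof.
by move=> Bv; rewrite /frame_to_flow row_mxKl row_mxKr mulmxKV ?uE // hsubmxK.
Qed.

Lemma flow_to_frame_smooth v : B (lsubmx v) -> smooth_near flow_to_frame v.
Proof.
move=> Bv; apply: smooth_near_row_mx; first exact/smooth_near_lsubmx/smooth_near_id.
apply: smooth_near_mulmx => [|i]; first exact/smooth_near_rsubmx/smooth_near_id.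
apply: (near_lsub_comp (F := fun u => row i (invmx (E u)))).
have [_] := smooth_near_invmx (uE Bv) (fun i => rowE_smooth i Bv); exact.
Qed.

(** Frame coordinates differ from flow coordinates by the smooth fibrewise linear change
    [frame_to_flow], so the local inverse of [flow_out] carries over. *)
Lemma theta_etale v0 (P : 'rV[R]_(k + n) -> Prop) : B (lsubmx v0) ->
  (\forall v \near v0, P v) ->
  exists (O : set M) (H : M -> 'rV[R]_(k + n)),
    [/\ open O, O (theta v0), H (theta v0) = v0 &
      forall x, O x -> [/\ B (lsubmx (H x)), P (H x), theta (H x) = x & fun_smooth X H x]].
Proof.
move=> Bv0 nP; pose w0 := frame_to_flow v0.
have lw0 : lsubmx w0 = lsubmx v0 by rewrite row_mxKl.
have Bw0 : B (lsubmx w0) by rewrite lw0.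
have nP' : \forall w \near w0, B (lsubmx w) /\ P (flow_to_frame w).
  apply: filterI; first exact: near_lsub_B.
  have cw := smooth_near_continuous (flow_to_frame_smooth Bw0).
  have nP2 : \forall v \near flow_to_frame w0, P v by rewrite frame_to_flowK.
  exact: (cw _ nP2).
have [A [ O [H [Ao Aw0 Oo [AO OA AP sH]]]]] := flow_out_etale sB Bw0 nP'.
have [ Ow0 Hw0] := AO _ Aw0.
exists O, (fun x => flow_to_frame (H x)); rewrite theta_flow_out; split=> //.
  by rewrite Hw0 frame_to_flowK.
move=> x Ox; have [AHx Hx] := OA _ Ox; have [BHx PHx] := AP _ AHx.
split=> //.
- by rewrite row_mxKl.
- by rewrite theta_flow_out flow_to_frameK.
- by apply: fun_smooth_comp; [exact: sH|exact: flow_to_frame_smooth].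
Qed.

(** The momentum recovers [u]; the difference of the flow times is then a period of [sigma u], which
    [genE] turns into an integer vector. *)
Lemma theta_eq v v' : B (lsubmx v) -> B (lsubmx v') ->
  theta v = theta v' <->
  lsubmx v = lsubmx v' /\ exists s : 'rV[int]_n, rsubmx v - rsubmx v' = map_mx intr s.
Proof.
move=> Bv Bv'; split=> [vv'|[lv [s sE]]]; last first.
  have rE : rsubmx v = map_mx intr s + rsubmx v' by rewrite -sE subrK.
  rewrite /theta lv rE mulmxDl addrC actD.
  rewrite (_ : act S (map_mx intr s *m _) _ = sigma (lsubmx v')) //.
  by apply: isotropy_comb => i; exact: rowE_isotropy.
have lv : lsubmx v = lsubmx v'.
  by rewrite -(momentum_theta Bv) vv' momentum_theta.
split=> //.
have : L (sigma (lsubmx v')) ((rsubmx v - rsubmx v') *m E (lsubmx v')).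
  move: vv'; rewrite /theta lv => vv'.
  by rewrite /isotropy /= mulmxBl addrC actD vv' actNK.
move=> /(genE Bv')[s sE]; exists s; exact: (mulmx_inj (uE Bv') sE).
Qed.

Definition slice_preimage : set M := q @^-1` @slice_orbits _ _ _ _ _ S B sigma.

Lemma slice_preimageP x :
  slice_preimage x <-> exists2 v, B (lsubmx v) & theta v = x.
Proof.
split=> [[u Bu /orbit_projP[T Tx]]|[v Bv <-]]; last first.
  by exists (lsubmx v) => //; rewrite orbit_theta.
exists (row_mx u (T *m invmx (E u))); first by rewrite row_mxKl.
by rewrite /theta row_mxKl row_mxKr mulmxKV ?uE.
Qed.

Section Leaves.
Variables (l : nat) (l_gt0 : (0 < l)%N) (phi : H1_mod_torsion R M -> 'rV[int]_l).
Hypothesis phi_iso : rho_coordinates S phi.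
Variable t : 'I_n.
Hypothesis rhoE : forall u, B u -> forall i,
  rho1 S l_gt0 phi (sigma u) (row i (E u)) = (i == t)%:R.
Local Notation K := (ker_rho S phi (Ordinal l_gt0)).

Lemma ker_rho_memP x T : (exists w : lattice_bundle S, K w /\ set_val w = (q x, T)) <->
  L x T /\ rho1 S l_gt0 phi x T = 0.
Proof.
split=> [[w [Kw wE]]|[LT T0]].
  have Lw := lattice_bundle_isotropy w.
  have qw : q (orbit_repr (set_val w).1) = q x by rewrite wE /= orbit_reprK.
  have LxT : L x T by rewrite -(isotropy_orbit qw); move: Lw; rewrite wE.
  split=> //; rewrite -(rho1_orbit l_gt0 phi qw); last by move: Lw; rewrite wE.
  by move: Kw; rewrite /ker_rho /= rho_loop_class wE.
exists (exist _ (q x, T) (lattice_bundle_mem LT)); split; last by rewrite set_valE.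
rewrite /ker_rho /= rho_loop_class set_valE /= -T0 /rho1; congr (phi _ _ _).
by apply/esym/loop_class_orbit => //; rewrite orbit_reprK.
Qed.

(** On integer combinations of the frame [rho1] is the coordinate [t]; its kernel is generated by
    the other rows, whose real span is the hyperplane where that coordinate is 0. *)
Lemma fiber_span_theta u : B u -> fiber_span K (q (sigma u)) =
  [set s *m E u | s in [set s : 'rV[R]_n | s 0 t = 0]].
Proof.
move=> Bu; apply/seteqP; split=> [T [ts tsK Tts]|_ [s s0 <-]].
  exists (T *m invmx (E u)); last by rewrite mulmxKV ?uE.
  rewrite /= (coord_span (X := in_tuple ts) Tts) mulmx_suml summxE /= big1 // => i _.
  rewrite -scalemxAl mxE.
  have : [set` ts] ts`_i by rewrite /= mem_nth.
  move=> /tsK /ker_rho_memP[LT rT].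
  have [z zE] := genE Bu LT.
  have z0 : z 0 t = 0.
    move: rT; rewrite zE (rho1_comb l_gt0 phi_iso) => [|j]; last exact: rowE_isotropy.
    rewrite (bigD1 t) //= (rhoE Bu) eqxx mul1r big1 ?addr0 // => j jt.
    by rewrite (rhoE Bu) (negbTE jt) mul0r.
  by rewrite zE mulmxK ?uE // mxE z0 mulr0.
exists [seq row i (E u) | i <- enum 'I_n & i != t].
  move=> T /mapP[i]; rewrite mem_filter => /andP[it _] ->.
  apply/ker_rho_memP; split; first exact: rowE_isotropy.
  by rewrite (rhoE Bu) (negbTE it).
rewrite mulmx_sum_row (bigD1 t) //= s0 scale0r add0r.
apply: memv_suml => i it; apply/memvZ/memv_span/map_f.
by rewrite mem_filter it mem_enum.
Qed.

Definition leaf (p : M) : set M := [set act S v p | v in fiber_span K (q p)].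

Lemma leaf_theta v : B (lsubmx v) -> leaf (theta v) =
  [set theta (row_mx (lsubmx v) s) | s in [set s : 'rV[R]_n | s 0 t = rsubmx v 0 t]].
Proof.
move=> Bv; rewrite /leaf orbit_theta fiber_span_theta //.
apply/seteqP; split=> [_ [_ [s s0 <-] <-]|_ [s st <-]].
  exists (rsubmx v + s); first by rewrite /= mxE s0 addr0.
  by rewrite /theta row_mxKl row_mxKr mulmxDl addrC actD.
exists ((s - rsubmx v) *m E (lsubmx v)).
  by exists (s - rsubmx v) => //; rewrite /= mxE [X in _ + X]mxE st subrr.
by rewrite /theta row_mxKl row_mxKr -actD -mulmxDl subrK.
Qed.

End Leaves.
End FrameCoordinates.

Section Trivialization.
Context {R : realType} {k n' : nat} {M : topologicalType}.
Context {X : manifold R (k + n'.+1) M}.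
Variable S : regular_system X.
Variables (B : set 'rV[R]_k) (sigma : 'rV[R]_k -> M) (E : 'rV[R]_k -> 'M[R]_n'.+1).
Hypotheses (sB : is_section S B sigma) (fE : isotropy_frame S B sigma B E).
Hypothesis genE : forall u, B u -> forall T, isotropy (act S) (sigma u) T ->
  exists s : 'rV[int]_n'.+1, T = map_mx intr s *m E u.
Local Notation q := (orbit_proj S).
Local Notation th := (theta S sigma E).
Local Notation U := (@slice_orbits _ _ _ _ _ S B sigma).

(** The annotation [1 + n'], convertible to [n'.+1], lets the first frame coordinate be split off as
    the circle coordinate. *)
Definition coords (u : 'rV[R]_k) (z : 'rV[R]_1) (t : 'rV[R]_n') : 'rV[R]_(k + n'.+1) :=
  row_mx u (row_mx z t : 'rV[R]_(1 + n')).

Definition zpart (v : 'rV[R]_(k + n'.+1)) : 'rV[R]_1 :=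
  lsubmx (rsubmx v : 'rV[R]_(1 + n')).

Definition tpart (v : 'rV[R]_(k + n'.+1)) : 'rV[R]_n' :=
  rsubmx (rsubmx v : 'rV[R]_(1 + n')).

Lemma upart_coords u z t : lsubmx (coords u z t) = u.
Proof. exact: row_mxKl. Qed.

Lemma zpart_coords u z t : zpart (coords u z t) = z.
Proof. by rewrite /zpart /coords row_mxKr row_mxKl. Qed.

Lemma tpart_coords u z t : tpart (coords u z t) = t.
Proof. by rewrite /tpart /coords row_mxKr row_mxKr. Qed.

Lemma coordsK v : coords (lsubmx v) (zpart v) (tpart v) = v.
Proof. by rewrite /coords /zpart /tpart !hsubmxK. Qed.

Lemma theta_coords_eq u z t u' z' t' : B u -> B u' ->
  th (coords u z t) = th (coords u' z' t') <->
  [/\ u = u', torus_proj z = torus_proj z' & torus_proj t = torus_proj t'].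
Proof.
move=> Bu Bu'; have := @theta_eq _ _ _ _ _ S B sigma E sB fE genE
  (coords u z t) (coords u' z' t').
rewrite !upart_coords => /(_ Bu Bu') ->.
have D : row_mx z t - row_mx z' t' = row_mx (z - z') (t - t').
  by rewrite opp_row_mx add_row_mx.
rewrite /coords !row_mxKr; split=> [[-> [s sE]]|[-> ]].
  have {}sE : row_mx (z - z') (t - t') = map_mx intr (s : 'rV[int]_(1 + n')).
    by rewrite -D; exact: sE.
  split=> //; apply/torus_projP.
    exists (lsubmx (s : 'rV[int]_(1 + n'))).
    by rewrite -[z - z'](row_mxKl _ (t - t')) sE map_lsubmx.
  exists (rsubmx (s : 'rV[int]_(1 + n'))).
  by rewrite -[t - t'](row_mxKr (z - z')) sE map_rsubmx.
move=> /torus_projP[a aE] /torus_projP[b bE]; split=> //.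
exists (row_mx a b : 'rV[int]_(1 + n')); apply: etrans D _.
by rewrite aE bE -map_row_mx.
Qed.

Lemma zpart_smooth v : smooth_near zpart v.
Proof.
apply: (smooth_near_lsubmx (f := fun v => rsubmx v : 'rV[R]_(1 + n'))).
exact/smooth_near_rsubmx/smooth_near_id.
Qed.

Lemma tpart_smooth v : smooth_near tpart v.
Proof.
apply: (smooth_near_rsubmx (f := fun v => rsubmx v : 'rV[R]_(1 + n'))).
exact/smooth_near_rsubmx/smooth_near_id.
Qed.

Lemma coords_smooth m (f : 'rV[R]_m -> 'rV[R]_k) (g : 'rV[R]_m -> 'rV[R]_1)
    (h : 'rV[R]_m -> 'rV[R]_n') v :
  smooth_near f v -> smooth_near g v -> smooth_near h v ->
  smooth_near (fun w => coords (f w) (g w) (h w)) v.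
Proof.
move=> sf sg sh; apply: smooth_near_row_mx => //.
exact: (smooth_near_row_mx sg sh).
Qed.

(** Charts of the iterated product live in dimension [k + 1 + n'], those of [M] in [k + n'.+1];
    these maps only regroup the blocks. *)
Definition assoc_coords (w : 'rV[R]_(k + 1 + n')) : 'rV[R]_(k + n'.+1) :=
  coords (lsubmx (lsubmx w)) (rsubmx (lsubmx w)) (rsubmx w).

Definition unassoc_coords (v : 'rV[R]_(k + n'.+1)) : 'rV[R]_(k + 1 + n') :=
  row_mx (row_mx (lsubmx v) (zpart v)) (tpart v).

Lemma assoc_coords_smooth w : smooth_near assoc_coords w.
Proof.
have sl : smooth_near (fun w : 'rV[R]_(k + 1 + n') => lsubmx w) w.
  exact/smooth_near_lsubmx/smooth_near_id.
apply: coords_smooth; [exact: (smooth_near_lsubmx sl)|exact: (smooth_near_rsubmx sl)|].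
exact/smooth_near_rsubmx/smooth_near_id.
Qed.

Lemma unassoc_coords_smooth v : smooth_near unassoc_coords v.
Proof.
apply: smooth_near_row_mx; last exact: tpart_smooth.
apply: smooth_near_row_mx; last exact: zpart_smooth.
exact/smooth_near_lsubmx/smooth_near_id.
Qed.

(** The representatives of torus points are arbitrary and need not vary continuously; by
    [theta_coords_eq] the value does not depend on them. *)
Definition trivialization (p : orbit_space S * torus R 1 * torus R n') : M :=
  th (coords (momentum_bar p.1.1) (torus_repr p.1.2) (torus_repr p.2)).

Definition triv_chart (z0 : 'rV[R]_1) (t0 : 'rV[R]_n') :
    chart R (k + 1 + n') (orbit_space S * torus R 1 * torus R n')%type :=
  prod_chart (prod_chart (slice_chart S B sigma) (torus_chart z0)) (torus_chart t0).

Lemma triv_chart_mapE z0 t0 o z t : chart_map (triv_chart z0 t0) (o, z, t) =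
  row_mx (row_mx (momentum_bar o) (chart_map (torus_chart z0) z))
    (chart_map (torus_chart t0) t).
Proof. by []. Qed.

Lemma triv_chart_is_chart z0 t0 : is_chart (triv_chart z0 t0).
Proof.
apply: prod_chart_is_chart; last exact: torus_chart_is_chart.
apply: prod_chart_is_chart; last exact: torus_chart_is_chart.
by have [] := slice_chart_in sB.
Qed.

Local Notation triv_atlas :=
  (prod_atlas (prod_atlas (orbit_atlas S) (@torus_atlas R 1)) (@torus_atlas R n')).

Lemma triv_chart_in z0 t0 : triv_atlas (triv_chart z0 t0).
Proof.
exists (prod_chart (slice_chart S B sigma) (torus_chart z0)); last first.
  by exists (torus_chart t0) => //; exact: torus_chart_in.
exists (slice_chart S B sigma); first exact: slice_chart_in.
by exists (torus_chart z0) => //; exact: torus_chart_in.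
Qed.

Lemma slice_orbits_momentum o : U o -> B (momentum_bar o) /\ q (sigma (momentum_bar o)) = o.
Proof.
by move=> [u Bu <-]; rewrite momentum_bar_proj; have [_ ->] := (proj2 sB) _ Bu.
Qed.

Lemma trivialization_smooth :
  smooth_on triv_atlas X (U `*` setT `*` setT) trivialization.
Proof.
move=> [[ o z] t] [[/= Uo _] _]; have [Bo qo] := slice_orbits_momentum Uo.
apply: (smooth_at_of_curve (c := triv_chart (torus_repr z) (torus_repr t))
  (g := fun w => th (assoc_coords w))).
- exact: triv_chart_is_chart.
- exact: triv_chart_in.
- split; first split=> //=.
    by exists (torus_repr z); [exact: ballxx|exact: torus_proj_repr].
  by exists (torus_repr t); [exact: ballxx|exact: torus_proj_repr].
- apply: (@curve_smooth_comp _ _ _ _ _ _ assoc_coords th).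
    exact: assoc_coords_smooth.
  apply: (theta_smooth sB fE).
  by rewrite /assoc_coords upart_coords /= !row_mxKl.
move=> [[ o' z'] t'] Dp; have [[Uo' [a ba az]] [b bb bt]] := Dp; rewrite /= in az bt.
have [Bo' _] := slice_orbits_momentum Uo'.
rewrite triv_chart_mapE /trivialization /assoc_coords.
rewrite !row_mxKl !row_mxKr -az -bt !torus_chart_map //=.
apply/theta_coords_eq => //.
by split=> //; rewrite torus_proj_repr.
Qed.

Lemma trivialization_orbit o z t : U o -> q (trivialization (o, z, t)) = o.
Proof.
by move=> Uo; rewrite /trivialization orbit_theta upart_coords; have [] := slice_orbits_momentum Uo.
Qed.

Lemma trivialization_diffeomorphism :
  diffeomorphism triv_atlas X (U `*` setT `*` setT) (q @^-1` U) trivialization.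
Proof.
have Uo : open U by exact: slice_orbits_open sB.
have pre := slice_preimageP fE.
have : forall x, exists v, (q @^-1` U) x -> B (lsubmx v) /\ th v = x.
  move=> x; have [Vx|nVx] := pselect ((q @^-1` U) x); last by exists 0.
  by have /pre[v Bv vx] := Vx; exists v.
(* [G] is an arbitrary choice of coordinates. The inverse [g] uses only their torus classes, which
   are well defined, so near a given point [gE] lets the smooth [H] of [theta_etale] replace [G]. *)
move=> /choice[G HG].
pose g x : orbit_space S * torus R 1 * torus R n' :=
  (q x, torus_proj (zpart (G x)), torus_proj (tpart (G x))).
have gE v : B (lsubmx v) ->
      g (th v) = (q (sigma (lsubmx v)), torus_proj (zpart v), torus_proj (tpart v)).
  move=> Bv; have Vv : (q @^-1` U) (th v) by apply/pre; exists v.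
  have [BG thG] := HG _ Vv.
  have thE : th (coords (lsubmx (G (th v))) (zpart (G (th v))) (tpart (G (th v)))) =
      th (coords (lsubmx v) (zpart v) (tpart v)) by rewrite !coordsK.
  have [_ zE tE] := (theta_coords_eq _ _ _ _ BG Bv).1 thE.
  by rewrite /g orbit_theta zE tE.
have gK p : (U `*` setT `*` setT) p -> g (trivialization p) = p.
  move: p => [[ o z] t] [[/= Uo' _] _]; have [Bo qo] := slice_orbits_momentum Uo'.
  rewrite /trivialization gE ?upart_coords // zpart_coords tpart_coords /= qo.
  by rewrite !torus_proj_repr.
split.
- by apply: open_product; last exact: openT; apply: open_product => //; exact: openT.
- by apply: open_comp => // x _; exact: orbit_proj_continuous.
- split.
  + by move=> [[ o z] t] [[/= Uo' _] _]; rewrite /= trivialization_orbit.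
  + move=> p p' /set_mem Up /set_mem Up' pp'.
    by rewrite -(gK p Up) pp' gK.
  + move=> x Vx; have [BG thG] := HG _ Vx.
    exists (q x, torus_proj (zpart (G x)), torus_proj (tpart (G x))).
      by split; [split|].
    rewrite /trivialization /= -[RHS]thG -[G x in RHS]coordsK; apply/theta_coords_eq => //.
      by have [] := slice_orbits_momentum Vx.
    split; rewrite ?torus_proj_repr //.
    by rewrite momentum_bar_proj -[in LHS]thG (momentum_theta _ sB).
- exact: trivialization_smooth.
exists g; split; first by move=> p /set_mem; exact: gK.
move=> x Vx; have [BG thG] := HG _ Vx.
have [ O [H [Oo Ox Hx HO]]] := theta_etale sB fE (P := fun=> True) BG (near_all _ (fun=> I)).
rewrite thG in Ox Hx.
apply: (smooth_at_of_fun (c := triv_chart (zpart (G x)) (tpart (G x)))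
  (H := fun y => unassoc_coords (H y))).
- exact: triv_chart_is_chart.
- exact: triv_chart_in.
- apply: fun_smooth_comp; last exact: unassoc_coords_smooth.
  by have [] := HO _ Ox.
- rewrite Hx /unassoc_coords; split; last by rewrite row_mxKr; exact: ballxx.
  by split; rewrite !row_mxKl ?row_mxKr //; exact: ballxx.
have nO : \forall y \near x, O y by exact: open_nbhs_nbhs.
apply: filterS nO => y Oy; have [BH _ thH _] := HO _ Oy.
rewrite -[in LHS]thH gE // /triv_chart /= /unassoc_coords.
by rewrite !row_mxKl !row_mxKr.
Qed.

Section LeafTori.
Variables (l : nat) (l_gt0 : (0 < l)%N) (phi : H1_mod_torsion R M -> 'rV[int]_l).
Hypothesis phi_iso : rho_coordinates S phi.
Hypothesis rhoE : forall u, B u -> forall i,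
  rho1 S l_gt0 phi (sigma u) (row i (E u)) = (i == ord0)%:R.
Local Notation lf := (leaf S l_gt0 phi).

Lemma leaf_coords u z t : B u -> lf (th (coords u z t)) =
  [set th (coords u z t') | t' in [set: 'rV[R]_n']].
Proof.
move=> Bu; rewrite (leaf_theta fE genE phi_iso rhoE) ?upart_coords //.
have z0 (s : 'rV[R]_(1 + n')) : s 0 ord0 = lsubmx s 0 ord0.
  by rewrite mxE; congr (s _ _); exact/val_inj.
apply/seteqP; split=> [_ [s s0 <-]|_ [t' _ <-]].
  have sz : lsubmx (s : 'rV[R]_(1 + n')) = z.
    apply/rowP => i; rewrite (ord1 i) -z0; move: s0.
    by rewrite /= /coords row_mxKr (z0 (row_mx z t)) row_mxKl.
  exists (rsubmx (s : 'rV[R]_(1 + n'))) => //.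
  rewrite /coords -sz; congr (th (row_mx u _)).
  exact: (hsubmxK (s : 'rV[R]_(1 + n'))).
exists (row_mx z t' : 'rV[R]_(1 + n')) => //.
by rewrite /= /coords row_mxKr !z0 !row_mxKl.
Qed.

Lemma trivialization_leaf o z : U o ->
  trivialization @` [set (o, z, t) | t in [set: torus R n']] =
  lf (th (coords (momentum_bar o) (torus_repr z) 0)).
Proof.
move=> Uo; have [Bo qo] := slice_orbits_momentum Uo; rewrite leaf_coords //.
apply/seteqP; split=> [_ [_ [t _ <-] <-]|_ [t _ <-]]; first by exists (torus_repr t).
exists (o, z, torus_proj t); first by exists (torus_proj t).
by apply/theta_coords_eq => //; split=> //=; rewrite torus_proj_repr.
Qed.

(** For the immersion property, the [t] part of the local inverse of [theta] provides a smooth left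
    inverse [r] of the parametrization, so the chain rule gives a right inverse of its Jacobian
    matrix. *)
Lemma leaf_embedded_torus u z t : B u -> embedded_torus n' X (lf (th (coords u z t))).
Proof.
move=> Bu; pose g (t : torus R n') := th (coords u z (torus_repr t)).
have inc_smooth w : smooth_near (fun t => coords u z t) w.
  by apply: coords_smooth; [exact: smooth_near_cst|exact: smooth_near_cst|exact: smooth_near_id].
have sc w : curve_smooth X (fun t => th (coords u z t)) w.
  apply: (@curve_smooth_comp _ _ _ _ _ _ (fun t => coords u z t) th) => //.
  by apply: (theta_smooth sB fE); rewrite upart_coords.
have gE t0 y : dom (torus_chart t0) y -> g y = th (coords u z (chart_map (torus_chart t0) y)).
  move=> [a ba <-]; rewrite torus_chart_map // /g; apply/theta_coords_eq => //.
  by split=> //; rewrite torus_proj_repr.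
exists g; split.
- split=> [y _|y].
    apply: (smooth_at_of_curve (c := torus_chart (torus_repr y))
      (g := fun t => th (coords u z t))) => //.
    + exact: torus_chart_is_chart.
    + exact: torus_chart_in.
    + by exists (torus_repr y); [exact: ballxx|exact: torus_proj_repr].
    + by move=> y'; exact: gE.
  have [d Xd dy] := exists_chart X (g y); have hd := atlas_chart Xd.
  pose t0 := torus_repr y; pose c := torus_chart t0.
  have bt0 : ball t0 (2^-1 : R) t0 by exact: ballxx.
  have cy : dom c y by exists t0 => //; exact: torus_proj_repr.
  have cyE : chart_map c y = t0 by rewrite -[y]torus_proj_repr torus_chart_map.
  exists c, d; split=> //; first exact: torus_chart_in.
  rewrite cyE; pose f w := chart_map d (th (coords u z w)).
  have dt0 : dom d (th (coords u z t0)) by [].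
  have sf : smooth_near f t0 by have [_] := sc t0; exact.
  have nball : \forall w \near t0, ball t0 2^-1 w by exact: nbhsx_ballx.
  have ff : \forall w \near t0, f w = in_charts c d g w.
    apply: filterS nball => w bw; rewrite /in_charts /= (gE t0); last by exists w.
    by rewrite torus_chart_map.
  have sin : smooth_near (in_charts c d g) t0 by exact: smooth_near_eq ff sf.
  have Bv : B (lsubmx (coords u z t0)) by rewrite upart_coords.
  have nP : \forall v \near coords u z t0, ball (coords u z t0) 2^-1 v.
    exact: nbhsx_ballx.
  have [ O [H [Oo Ox Hx HO]]] := theta_etale sB fE Bv nP.
  have sH : fun_smooth X H (th (coords u z t0)) by have [] := HO _ Ox.
  pose r w := tpart (H (chart_inv d w)).
  have sr : smooth_near r (f t0).
    apply: (@smooth_near_comp _ _ _ _ (fun w => H (chart_inv d w)) tpart).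
      exact: sH d Xd dt0.
    exact: tpart_smooth.
  have nO : \forall w \near t0, O (th (coords u z w)) /\ dom d (th (coords u z w)).
    have [cg _] := sc t0; apply: filterI.
      exact: (cg _ (open_nbhs_nbhs (conj Oo Ox))).
    exact: (cg _ (near_dom Xd dt0)).
  have rf : \forall w \near t0, r (f w) = w.
    apply: filterS2 nball nO => w bw [ Ow dw].
    rewrite /r /f (chart_mapK hd dw).
    have [BH bH thH _] := HO _ Ow.
    have thE : th (coords (lsubmx (H (th (coords u z w)))) (zpart (H (th (coords u z w))))
        (tpart (H (th (coords u z w))))) = th (coords u z w) by rewrite coordsK.
    have [_ _ tE] := (theta_coords_eq _ _ _ _ BH Bu).1 thE.
    (* [tE] is an equality modulo Z; it lifts because both sides lie within 1/2 of [t0]. *)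
    apply: (torus_proj_ball_inj _ bw tE); apply/row_ballP.
    move/row_ballP : bH; apply: le_lt_trans.
    rewrite -[t0 in X in X <= _](tpart_coords u z t0).
    apply: row_norm_le => // i; rewrite !mxE.
    have := coord_le_norm (coords u z t0 - H (th (coords u z w))) (rshift k (rshift 1 i)).
    by rewrite !mxE.
  move=> v w; rewrite -!mulmx_jacobi //.
  have -> : jacobi (in_charts c d g) t0 = jacobi f t0.
    by apply: jacobi_eq; apply: filterS ff => y' ->.
  move=> vw; have J1 : jacobi f t0 *m jacobi r (f t0) = 1%:M.
    rewrite -jacobi_comp // -[RHS](jacobi_affine 1%:M 0 t0); apply: jacobi_eq.
    by apply: filterS rf => y' ->; rewrite mulmx1 add0r.
  by rewrite -[v]mulmx1 -[w]mulmx1 -J1 !mulmxA vw.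
- move=> y y' /theta_coords_eq[//|//|_ _].
  by rewrite !torus_proj_repr.
- rewrite leaf_coords //; apply/seteqP; split=> [_ [y _ <-]|_ [t' _ <-]].
    by exists (torus_repr y).
  exists (torus_proj t') => //; apply/theta_coords_eq => //.
  by split=> //; rewrite torus_proj_repr.
Qed.

End LeafTori.
End Trivialization.

(** * The foliation *)
Section LeavesPartition.
Context {R : realType} {k n : nat} {M : topologicalType}.
Context {X : manifold R (k + n) M}.
Variable S : regular_system X.
Variables (l : nat) (l_gt0 : (0 < l)%N) (phi : H1_mod_torsion R M -> 'rV[int]_l).
Local Notation lf := (leaf S l_gt0 phi).

Lemma linear_span0 (A : set 'rV[R]_n) : linear_span A 0.
Proof. by exists [::]; rewrite ?mem0v. Qed.

Lemma linear_spanB (A : set 'rV[R]_n) v w :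
  linear_span A v -> linear_span A w -> linear_span A (v - w).
Proof.
move=> [s sA vs] [s' sA' ws]; exists (s ++ s').
  by move=> x /=; rewrite mem_cat => /orP[/sA|/sA'].
rewrite span_cat memvB //; first exact: subvP (addvSl _ _) _ vs.
exact: subvP (addvSr _ _) _ ws.
Qed.

Lemma leaf_self p : lf p p.
Proof. by exists 0; [exact: linear_span0|exact: act0]. Qed.

(** [fiber_span] depends on the orbit alone and is a subgroup of R^n, so the leaves in an orbit are
    the orbits of a group. *)
Lemma leaf_eq p y : lf p y -> lf y = lf p.
Proof.
move=> [v Vv <-]; rewrite /leaf orbit_proj_act; apply/seteqP.
split=> _ [w Vw <-].
  exists (w + v); last by rewrite actD.
  rewrite -[v]opprK; apply: linear_spanB => //; rewrite -sub0r.
  by apply: linear_spanB => //; exact: linear_span0.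
by exists (w - v); [exact: linear_spanB|rewrite -actD subrK].
Qed.

End LeavesPartition.

Lemma fun_smooth_eq (R : realType) m p (M : topologicalType) (X : manifold R m M)
    (f g : M -> 'rV[R]_p) x :
  (\forall y \near x, f y = g y) -> fun_smooth X f x -> fun_smooth X g x.
Proof.
move=> fg sf d Xd dx; apply: smooth_near_eq (sf d Xd dx); have hd := atlas_chart Xd.
have cd : {for chart_map d x, continuous (chart_inv d)}.
  by apply: chart_inv_continuous => //; exact: chart_map_img.
have fg' : \forall y \near chart_inv d (chart_map d x), f y = g y.
  by rewrite (chart_mapK hd dx).
exact: (cd _ fg').
Qed.

Section FoliatedChart.
Context {R : realType} {k n' : nat} {M : topologicalType}.
Context {X : manifold R (k + n'.+1) M}.
Variable S : regular_system X.
Variables (B : set 'rV[R]_k) (sigma : 'rV[R]_k -> M) (E : 'rV[R]_k -> 'M[R]_n'.+1).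
Hypotheses (sB : is_section S B sigma) (fE : isotropy_frame S B sigma B E).
Hypothesis genE : forall u, B u -> forall T, isotropy (act S) (sigma u) T ->
  exists s : 'rV[int]_n'.+1, T = map_mx intr s *m E u.
Variables (l : nat) (l_gt0 : (0 < l)%N) (phi : H1_mod_torsion R M -> 'rV[int]_l).
Hypothesis phi_iso : rho_coordinates S phi.
Hypothesis rhoE : forall u, B u -> forall i,
  rho1 S l_gt0 phi (sigma u) (row i (E u)) = (i == ord0)%:R.
Variables (v0 : 'rV[R]_(k + n'.+1)) (r : R).
Hypotheses (r_gt0 : 0 < r) (r_le : r <= 2^-1).
Local Notation box := (ball v0 r).
Hypothesis boxB : forall v, box v -> B (lsubmx v).
Local Notation q := (orbit_proj S).
Local Notation th := (theta S sigma E).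
Local Notation lf := (leaf S l_gt0 phi).

Lemma box_part m (f : 'rV[R]_(k + n'.+1) -> 'rV[R]_m) (h : 'I_m -> 'I_(k + n'.+1)) v :
  (forall w i, f w 0 i = w 0 (h i)) -> box v -> ball (f v0) 2^-1 (f v).
Proof.
move=> fh /row_ballP bv; apply/row_ballP; apply: lt_le_trans r_le.
apply: le_lt_trans bv; apply: row_norm_le => // i; rewrite !mxE !fh.
by have := coord_le_norm (v0 - v) (h i); rewrite !mxE.
Qed.

Lemma box_zpart v : box v -> ball (zpart v0) 2^-1 (zpart v).
Proof.
by apply: (@box_part 1 zpart (fun i => rshift k (lshift n' i : 'I_n'.+1))) => w i;
  rewrite !mxE.
Qed.

Lemma box_tpart v : box v -> ball (tpart v0) 2^-1 (tpart v).
Proof.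
by apply: (@box_part n' tpart (fun i => rshift k (rshift 1 i : 'I_n'.+1))) => w i;
  rewrite !mxE.
Qed.

(** Here [r <= 2^-1] enters: on the box the torus coordinates lift uniquely. *)
Lemma theta_box_inj v v' : box v -> box v' -> th v = th v' -> v = v'.
Proof.
move=> bv bv'; rewrite -[v]coordsK -[v']coordsK.
move=> /(theta_coords_eq sB fE genE _ _ _ _ (boxB bv) (boxB bv'))[-> zE tE].
rewrite (torus_proj_ball_inj (box_zpart bv) (box_zpart bv') zE).
by rewrite (torus_proj_ball_inj (box_tpart bv) (box_tpart bv') tE).
Qed.

Definition box_inv (x : M) : 'rV[R]_(k + n'.+1) :=
  xget v0 [set v | box v /\ th v = x].

Lemma box_invK v : box v -> box_inv (th v) = v.
Proof.
move=> bv; rewrite /box_inv; case: xgetP => [w _ [bw wE]|/(_ v)]; last by case.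
exact: theta_box_inj.
Qed.

Lemma box_near v : box v -> \forall w \near v, box w.
Proof. by move=> bv; apply: open_nbhs_nbhs; split=> //; exact: ball_open. Qed.

(** Injectivity on the box leaves no choice to [box_inv], so near each point it is the smooth local
    inverse of [theta]. *)
Lemma box_inv_near v : box v -> exists (O : set M) (H : M -> 'rV[R]_(k + n'.+1)),
  [/\ open O, O (th v), fun_smooth X H (th v) &
      forall y, O y -> [/\ box (H y), th (H y) = y & box_inv y = H y]].
Proof.
move=> bv; have [ O [H [Oo Ox Hx HO]]] := theta_etale sB fE (boxB bv) (box_near bv).
exists O, H; split=> //; first by have [] := HO _ Ox.
move=> y /HO[_ bH thH _]; split=> //.
by rewrite -[in LHS]thH box_invK.
Qed.

Lemma box_inv_smooth v : box v -> fun_smooth X box_inv (th v).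
Proof.
move=> bv; have [ O [H [Oo Ox sH HO]]] := box_inv_near bv.
have nO : \forall y \near th v, O y by exact: open_nbhs_nbhs.
by apply: fun_smooth_eq sH; apply: filterS nO => y /HO[].
Qed.

Definition rev_row (w : 'rV[R]_(k + n'.+1)) : 'rV[R]_(k + n'.+1) :=
  \row_i w 0 (rev_ord i).

Lemma rev_rowK w : rev_row (rev_row w) = w.
Proof. by apply/rowP => i; rewrite !mxE rev_ordK. Qed.

Lemma rev_row_smooth w : smooth_near rev_row w.
Proof. exact: smooth_near_coordfun. Qed.

(* Reversing the order of the coordinates [(u, z, t)] of [theta] puts the
   torus directions [t] of the leaves first. *)
Definition box_chart : chart R (k + n'.+1) M :=
  Chart (th @` box) (rev_row @^-1` box) (fun x => rev_row (box_inv x))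
    (fun w => th (rev_row w)).

Lemma theta_rev_smooth w : box (rev_row w) -> curve_smooth X (fun w => th (rev_row w)) w.
Proof.
move=> bw; apply: (@curve_smooth_comp _ _ _ _ _ _ rev_row th).
  exact: rev_row_smooth.
exact/(theta_smooth sB fE)/boxB.
Qed.

Lemma box_chart_is_chart : is_chart box_chart.
Proof.
split=> /=.
- rewrite openE => _ [v bv <-]; have [ O [H [Oo Ox _ HO]]] := box_inv_near bv.
  have nO : \forall y \near th v, O y by exact: open_nbhs_nbhs.
  by apply: filterS nO => y /HO[bH thH _]; exists (H y).
- apply: open_comp; last exact: ball_open.
  by move=> w _; exact/smooth_near_continuous/rev_row_smooth.
- by move=> _ [v bv <-]; rewrite /= rev_rowK box_invK.
- by move=> w bw; exists (rev_row w).
- by move=> _ [v bv <-]; rewrite rev_rowK box_invK.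
- by move=> w bw; rewrite box_invK // rev_rowK.
- move=> _ [v bv <-].
  apply: (@continuous_comp _ _ _ box_inv rev_row).
    exact: fun_smooth_continuous (box_inv_smooth bv).
  exact/smooth_near_continuous/rev_row_smooth.
- by move=> w bw; have [] := theta_rev_smooth bw.
Qed.

Lemma box_chart_maximal : maximal_atlas X box_chart.
Proof.
split; first exact: box_chart_is_chart.
move=> d Xd; have hd := atlas_chart Xd; split.
  apply: smooth_near_Cinfty => w [/= bw dw].
  by have [_] := theta_rev_smooth bw; apply.
apply: smooth_near_Cinfty => w [/= dw [v bv vE]].
have dx := chart_inv_dom hd dw.
have := fun_smooth_comp (box_inv_smooth bv) (rev_row_smooth (box_inv (th v))).
by rewrite vE => /(_ d Xd dx); rewrite chart_invK.
Qed.

Lemma plaqueP v v' : (forall i : 'I_(k + n'.+1), (n' <= i)%N ->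
    rev_row v' 0 i = rev_row v 0 i) <-> lsubmx v' = lsubmx v /\ zpart v' = zpart v.
Proof.
have le_u (j : 'I_k) : (n' <= rev_ord (lshift n'.+1 j))%N.
  by have := ltn_ord j; rewrite /=; lia.
have le_z (j : 'I_1) : (n' <= rev_ord (rshift k (lshift n' j) : 'I_(k + n'.+1)))%N.
  by have := ltn_ord j; rewrite /=; lia.
split=> [H|[uE zE] i ni].
  split; apply/rowP => j.
    have := H _ (le_u j); rewrite mxE [RHS]mxE rev_ordK => e.
    by rewrite !mxE.
  have := H _ (le_z j); rewrite mxE [RHS]mxE rev_ordK => e.
  by rewrite !mxE.
rewrite mxE [RHS]mxE; set j := rev_ord i.
have jk : (j <= k)%N by have := ltn_ord i; rewrite /j /=; lia.
case: (ltngtP j k) jk => // [jk|jk] _.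
  have -> : j = lshift n'.+1 (Ordinal jk) by exact/val_inj.
  by move/rowP : uE => /(_ (Ordinal jk)); rewrite !mxE.
have -> : j = rshift k (lshift n' (0 : 'I_1)) by apply/val_inj; rewrite /= addn0.
by move/rowP : zE => /(_ 0); rewrite !mxE.
Qed.

(** A priori the leaf could return to the box with [z] shifted by an integer; the size of the box
    excludes this, so it meets the box in a single plaque. *)
Lemma leaf_box v : box v -> lf (th v) `&` (th @` box) =
  [set y | exists v', [/\ box v', th v' = y, lsubmx v' = lsubmx v & zpart v' = zpart v]].
Proof.
move=> bv; have Bv := boxB bv.
rewrite -[v in LHS]coordsK (leaf_coords fE genE phi_iso rhoE) //.
apply/seteqP; split=> [_ [[t _ <-] [v' bv' thE]]|_ [v' [bv' <- uE zE]]].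
  exists v'; have thE' : th (coords (lsubmx v') (zpart v') (tpart v')) =
    th (coords (lsubmx v) (zpart v) t) by rewrite coordsK.
  have [uE zE _] := (theta_coords_eq sB fE genE _ _ _ _ (boxB bv') Bv).1 thE'.
  split=> //; exact: torus_proj_ball_inj (box_zpart bv') (box_zpart bv) zE.
split; last by exists v'.
by exists (tpart v') => //; rewrite -uE -zE coordsK.
Qed.

Lemma box_chart_foliated :
  foliated_chart n' (foliation_by S (ker_rho S phi (Ordinal l_gt0))) box_chart.
Proof.
move=> _ [p _ <-] x [Lx [v bv vx]].
rewrite -/(lf p) in Lx *; rewrite -(leaf_eq Lx) -vx /= leaf_box //.
transitivity [set y | exists v', [/\ box v', th v' = y, lsubmx v' = lsubmx v & zpart v' = zpart v]].
  apply/seteqP; split; first exact: connected_component_sub.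
  move=> y [v' [bv' <- uE zE]].
  (* The box is convex and both ends share [u] and [z], so the segment joins them inside the plaque,
     which is therefore connected. *)
  pose seg (t : R) := v + t *: (v' - v).
  have bseg t : 0 <= t <= 1 -> box (seg t).
    move=> /andP[t0 t1]; apply/row_ballP.
    have -> : v0 - seg t = (1 - t) *: (v0 - v) + t *: (v0 - v').
      by apply/rowP => i; rewrite !mxE; ring.
    move/row_ballP : bv => bv; move/row_ballP : bv' => bv'.
    apply: le_lt_trans (ler_normD _ _) _.
    rewrite !normrZ ger0_norm ?subr_ge0 // ger0_norm //.
    set a := `|v0 - v| in bv *; set b := `|v0 - v'| in bv' *.
    apply: (@le_lt_trans _ _ (Num.max a b)); last by rewrite gt_max bv bv'.
    have am : a <= Num.max a b by rewrite le_max lexx.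
    have bm : b <= Num.max a b by rewrite le_max lexx orbT.
    have t1' : 0 <= 1 - t by rewrite subr_ge0.
    have := ler_wpM2l t1' am; have := ler_wpM2l t0 bm; lra.
  have cseg t : {for t, continuous seg}.
    apply: continuousD; first exact: cst_continuous.
    by apply: scale_continuous; [exact: cvg_id|exact: cst_continuous].
  have : ((fun t => th (seg t)) @` `[0, 1]) (th v').
    by exists 1; [rewrite /= in_itv /= ler01 lexx|rewrite /seg scale1r addrC subrK].
  apply: connected_component_max.
  - by exists 0; [rewrite /= in_itv /= ler01 lexx|rewrite /seg scale0r addr0].
  - move=> _ [t /= /[!in_itv]/= t01 <-]; exists (seg t); split=> //; first exact: bseg.
      by rewrite /seg linearD linearZ linearB /= uE subrr scaler0 addr0.
    apply/rowP => j; move/rowP : zE => /(_ j); rewrite /seg !mxE => ->.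
    by rewrite subrr mulr0 addr0.
  - apply: connected_continuous_connected; first exact: segment_connected.
    apply: continuous_in_subspaceT => t /[1!inE] /= /[!in_itv]/= t01.
    apply: (@continuous_comp _ _ _ seg th); first exact: cseg.
    by have [] := theta_smooth sB fE (boxB (bseg t t01)).
apply/seteqP; split=> [y [v' [bv' <- uE zE]]|y [[v' bv' <-] H]].
  by split; [exists v'|rewrite /= !box_invK //; exact/plaqueP].
exists v'; have [uE zE] : lsubmx v' = lsubmx v /\ zpart v' = zpart v.
  by apply/plaqueP => i ni; have := H i ni; rewrite /= !box_invK.
by split.
Qed.

End FoliatedChart.

Theorem corollary17 (R : realType) (k n : nat) (M : topologicalType)
    (X : manifold R (k + n) M) (S : regular_system X)
    (M_connected : connected [set: M])
    (l : nat) (l_gt0 : (0 < l)%N)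
    (phi : H1_mod_torsion R M -> 'rV[int]_l)
    (phi_iso : rho_coordinates S phi) :
  let F1 := foliation_by S (ker_rho S phi (Ordinal l_gt0)) in
  [/\ toric_foliation n.-1 X F1,
      refines F1 (orbit_foliation S) &
      forall b : orbit_space S,
        exists U : set (orbit_space S),
        exists psi : orbit_space S * torus R 1 * torus R n.-1 -> M,
          [/\ open U, U b, local_trivialization U psi &
              forall (u : orbit_space S) (z : torus R 1), U u ->
                F1 (psi @` [set (u, z, t) | t in [set: torus R n.-1]])]].
Proof.
move: X S M_connected l phi l_gt0 phi_iso.
case: n => [|n'] X S M_connected l phi l_gt0 phi_iso F1.
  (* Contradicting [n = 0] takes a point of [M], which the nonempty range of [rho] provides. *)
  have [_ _ surj] := phi_iso.1; have [_ [w _ _] _] := surj 0 I.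
  by have := n_gt0 l_gt0 phi_iso M_connected (orbit_repr (set_val w).1).
have frame := adapted_frame l_gt0 phi_iso M_connected ord0.
have base sigma E x : sigma (momentum S x) = x ->
    theta S sigma E (coords (momentum S x) 0 (0 : 'rV[R]_n')) = x.
  move=> sx; rewrite /theta /coords row_mxKl row_mxKr sx.
  by rewrite (row_mx0 _ 1 1 n') mul0mx act0.
split.
- split.
  + split.
    * apply/seteqP; split=> // x _; exists (leaf S l_gt0 phi x); first by exists x.
      exact: leaf_self.
    * move=> _ _ [p _ <-] [p' _ <-] [x [xp xp']].
      have e : leaf S l_gt0 phi x = leaf S l_gt0 phi p by exact: leaf_eq.
      have e' : leaf S l_gt0 phi x = leaf S l_gt0 phi p' by exact: leaf_eq.
      exact: etrans (esym e) e'.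
    * by move=> _ [p _ <-]; exists p; exact: leaf_self.
  + move=> _ [p _ <-]; have [B [sigma [E [sB Bp sp fE HB]]]] := frame p.
    rewrite -/(leaf S l_gt0 phi p) -(base sigma E p sp).
    apply: (leaf_embedded_torus sB fE (fun u Bu => (HB u Bu).2) phi_iso
      (fun u Bu => (HB u Bu).1)) => //.
  + move=> x; have [B [sigma [E [sB Bx sx fE HB]]]] := frame x.
    pose v0 : 'rV[R]_(k + n'.+1) := coords (momentum S x) 0 0.
    have Bv0 : B (lsubmx v0) by rewrite upart_coords.
    have [e /= e0 He] := (nbhs_ballP _ _).1 (near_lsubmx sB Bv0).
    (* [e] keeps the box over [B], and [2^-1] makes [theta] injective on it. *)
    pose r := Num.min e 2^-1.
    have r0 : 0 < r by rewrite lt_min e0 /=; rewrite invr_gt0.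
    have rle : r <= 2^-1 by rewrite ge_min lexx orbT.
    have boxB v : ball v0 r v -> B (lsubmx v).
      by move=> bv; apply: He; apply: le_ball bv; rewrite ge_min lexx.
    have genE u (Bu : B u) := (HB u Bu).2.
    exists (box_chart S sigma E v0 r); split.
    * exact: (box_chart_maximal sB fE genE rle boxB).
    * by exists v0; [exact: ballxx|exact: base].
    * exact: (box_chart_foliated sB fE genE phi_iso (fun u Bu => (HB u Bu).1) r0 rle boxB).
- move=> _ [p _ <-]; exists (orbit_of (act S) p); first by exists p.
  by move=> _ [v _ <-]; exists v.
move=> b; pose x := orbit_repr b.
have [B [sigma [E [sB Bx sx fE HB]]]] := frame x.
have genE u (Bu : B u) := (HB u Bu).2.
exists (@slice_orbits _ _ _ _ _ S B sigma), (@trivialization _ _ _ _ _ S sigma E); split.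
- exact: slice_orbits_open sB.
- by exists (momentum S x) => //; rewrite sx orbit_reprK.
- split; first exact: (trivialization_diffeomorphism sB fE genE).
  by move=> u z t Uu; exact: (trivialization_orbit E sB z t Uu).
move=> u z Uu.
rewrite (trivialization_leaf sB fE genE phi_iso (fun u Bu => (HB u Bu).1)) //.
by eexists.
Qed.
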